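(* Let $o(t,x)=\sigma\int_0^t\int_{\mathcal O}G_{t-s}(x,y)\,B^H(\mathrm ds,\mathrm dy)$ be the stochastic convolution. For any $p\ge1$ and $0\le\beta<4H_1+H_2-1$, $$\mathbb E\left[\sup_{t\in[0,T]}\|o(t,\cdot)\|_{\dot H^\beta}^p\right]<\infty .$$ Moreover, for arbitrarily small $\epsilon>0$ there exists a constant $C>0$ such that for any $0\le s<t\le T$, $$\mathbb E\left[\|o(t,\cdot)-o(s,\cdot)\|_{\dot H^\beta}^p\right]\le C(t-s)^{\left(\frac{4H_1+H_2-1-\beta}{4}-\frac{\epsilon}{2}\right)p},$$ and for any $x,z\in\mathcal O$, $$\sup_{t\in[0,T]}\mathbb E\left[|o(t,x)-o(t,z)|^p\right]\le C|x-z|^p .$$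
   Context: $T>0$, $\mathcal O=(0,\pi)$, $H=(H_1,H_2)\in[\frac12,1)\times[\frac12,1)$, $\sigma\in\mathbb R$ is a constant. $B^H=\{B^H(t,x)\}_{(t,x)\in[0,T]\times\mathcal O}$ is a fractional Brownian sheet on $(\Omega,\mathcal F,\mathbb P)$, i.e. a centered Gaussian process (continuous version) with $$\mathbb E[B^H(t,x)B^H(s,y)]=\tfrac14\left(t^{2H_1}+s^{2H_1}-|t-s|^{2H_1}\right)\left(x^{2H_2}+y^{2H_2}-|x-y|^{2H_2}\right).$$ Integrals of deterministic functions against $B^H(\mathrm ds,\mathrm dy)$ are Wiener integrals (the $L^2(\Omega)$-linear extension of $\mathbf 1_{[0,t]\times[0,x]}\mapsto B^H(t,x)$). $\lambda_j=j^2$ $(j\ge0)$, $\phi_0=\sqrt{1/\pi}$, $\phi_j(x)=\sqrt{2/\pi}\cos(jx)$ $(j\ge1)$, and $G_t(x,y)=\sum_{j\ge0}e^{-\lambda_j^2t}\phi_j(x)\phi_j(y)$ is the Green function of $\partial_t+\Delta^2$ on $\mathcal O$ with homogeneous Neumann boundary conditions. $\|v\|_{\dot H^\beta}=\left(\sum_{j\ge0}\lambda_j^\beta|\langle v,\phi_j\rangle_{L^2}|^2\right)^{1/2}$, with $0^0=1$ (so $\|\cdot\|_{\dot H^0}=\|\cdot\|_{L^2}$). A suitable version of the process $o$ (continuous in $t$) is used in the supremum. *)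

(* Defs.v *)
From HB Require Import structures.
From mathcomp Require Import all_boot all_order all_algebra.
From mathcomp Require Import all_classical all_reals all_analysis.

Set Implicit Arguments.
Unset Strict Implicit.
Unset Printing Implicit Defensive.

Import Order.TTheory GRing.Theory Num.Theory.
Import numFieldNormedType.Exports.

Local Open Scope classical_set_scope.
Local Open Scope ring_scope.

(** * The spectral basis on (0, pi) *)

Definition dom (R : realType) : set R := `]0, pi[%classic.
Arguments dom {R}.

Definition eigval (R : realType) (j : nat) : R := j%:R ^+ 2.

Definition eigfun (R : realType) (j : nat) (x : R) : R :=
  if j is 0%N then Num.sqrt (1 / pi) else Num.sqrt (2 / pi) * cos (j%:R * x).

(* The series converges absolutely for [0 < t]; no other value is used. *)
Definition green (R : realType) (t x y : R) : R :=
  limn (series (fun j : nat =>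
    expR (- eigval R j ^+ 2 * t) * eigfun j x * eigfun j y)).

(** * The norm of the space \dot H^beta *)

Definition l2sqnorm (R : realType) (v : R -> R) : \bar R :=
  (\int[lebesgue_measure]_(x in dom) (v x ^+ 2)%:E)%E.

Definition square_integrable (R : realType) (v : R -> R) : Prop :=
  measurable_fun dom v /\ (l2sqnorm v < +oo)%E.

Definition fourier_coef (R : realType) (v : R -> R) (j : nat) : R :=
  \int[lebesgue_measure]_(x in dom) (v x * eigfun j x).

(* The library's integral takes a junk value on non-integrable functions, so
   the norm is set to +oo outside L^2 instead of being read off meaningless
   Fourier coefficients.  Note that [0 `^ 0 = 1] and [0 `^ beta = 0] for
   [beta != 0]. *)
Definition hnorm (R : realType) (beta : R) (v : R -> R) : \bar R :=
  if `[< square_integrable v >] then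
    poweR (\sum_(0 <= j <oo)
             (eigval R j `^ beta * `|fourier_coef v j| ^+ 2)%:E)%E 2^-1
  else +oo%E.

(** * Fractional Brownian sheet *)

(* A finite family of weighted points [(a, (t, x))], and the two objects it
   represents: the elementary function \sum a 1_{[0,t] x [0,x]} and the random
   variable \sum a B(t,x). *)
Definition elem (R : realType) : Type := seq (R * (R * R)).

Definition elem_in (R : realType) (T : R) (e : elem R) : Prop :=
  forall c, c \in e -> 0 <= c.2.1 <= T /\ 0 < c.2.2 < pi.

Definition elem_fun (R : realType) (e : elem R) (u : R * R) : R :=
  \sum_(c <- e) c.1 * \1_(`[0, c.2.1] `*` `[0, c.2.2]) u.

Definition elem_int (R : realType) (Omega : Type) (B : R -> R -> Omega -> R)
    (e : elem R) (w : Omega) : R :=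
  \sum_(c <- e) c.1 * B c.2.1 c.2.2 w.

(* Degenerate laws are allowed; they are treated apart because the library's
   [normal_prob m 0] is not a Dirac mass. *)
Definition gaussian d (Omega : measurableType d) (R : realType)
    (P : probability Omega R) (X : Omega -> R) : Prop :=
  exists m s : R, forall A : set R, measurable A ->
    P (X @^-1` A) = if s == 0 then \d_m A else normal_prob m s A.

Definition fbm_cov (R : realType) (H t s : R) : R :=
  t `^ (2 * H) + s `^ (2 * H) - `|t - s| `^ (2 * H).

Definition fractional_brownian_sheet d (Omega : measurableType d)
    (R : realType) (P : probability Omega R) (T H1 H2 : R)
    (B : R -> R -> {RV P >-> R}) : Prop :=
  [/\ forall e : elem R, elem_in T e -> gaussian P (elem_int B e),
      forall t x : R, 0 <= t <= T -> 0 < x < pi -> ('E_P[B t x] = 0)%E,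
      forall t s x y : R, 0 <= t <= T -> 0 <= s <= T ->
        0 < x < pi -> 0 < y < pi ->
        ('E_P[fun w => (B t x w * B s y w)%R]
           = (4^-1 * fbm_cov H1 t s * fbm_cov H2 x y)%:E)%E
    & forall w : Omega,
        {within `[0, T] `*` dom, continuous (fun u : R * R => B u.1 u.2 w)}].

(** * Wiener integral and stochastic convolution *)

(* [W] is a version of \int_0^T \int_O f(s,y) B(ds,dy).  For Hurst indices in
   [1/2, 1) the linear map [elem_fun e |-> elem_int B e] is bounded from
   L^2([0,T] x O) to L^2(Omega), and its domain is dense in L^2([0,T] x O); the
   Wiener integral is its continuous linear extension, so that [W] is
   determined by [f] up to a null set. *)
Definition wiener_integral d (Omega : measurableType d) (R : realType)
    (P : probability Omega R) (T : R) (B : R -> R -> Omega -> R)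
    (f : R * R -> R) (W : Omega -> R) : Prop :=
  [/\ measurable_fun (`[0, T] `*` dom) f,
      measurable_fun setT W
    & exists e : nat -> elem R,
      [/\ forall n, elem_in T (e n),
          (\int[lebesgue_measure \x lebesgue_measure]_(u in (`[0%R, T] `*` dom)%classic)
             ((elem_fun (e n) u - f u) ^+ 2)%:E)%E @[n --> \oo] --> 0%E
        & (\int[P]_w ((elem_int B (e n) w - W w) ^+ 2)%:E)%E
             @[n --> \oo] --> 0%E]].

Definition convolution_integrand (R : realType) (t x : R) (u : R * R) : R :=
  \1_(`[0, t[ `*` dom) u * green (t - u.1) x u.2.

(* Measurability in [(w, x)] makes the functions [o t ^~ w] legitimate elements
   of the spaces of functions of [x]. *)
Definition measurable_field d (Omega : measurableType d) (R : realType)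
    (T : R) (o : R -> R -> Omega -> R) : Prop :=
  forall t : R, 0 <= t <= T ->
    measurable_fun ([set: Omega] `*` dom) (fun u : Omega * R => o t u.2 u.1).

Definition stochastic_convolution d (Omega : measurableType d) (R : realType)
    (P : probability Omega R) (T sigma : R) (B : R -> R -> Omega -> R)
    (o : R -> R -> Omega -> R) : Prop :=
  measurable_field T o /\
  forall t x : R, 0 <= t <= T -> 0 < x < pi ->
    exists W : Omega -> R,
      wiener_integral P T B (convolution_integrand t x) W /\
      {ae P, forall w, o t x w = sigma * W w}.

(* A version of [o] all of whose paths are continuous from [0,T] to L^2(O). *)
Definition continuous_version d (Omega : measurableType d) (R : realType)
    (P : probability Omega R) (T : R) (o o' : R -> R -> Omega -> R) : Prop :=
  [/\ measurable_field T o',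
      forall t x : R, 0 <= t <= T -> 0 < x < pi ->
        {ae P, forall w, o' t x w = o t x w}
    & forall (w : Omega) (t : R), 0 <= t <= T ->
        square_integrable (fun x => o' t x w) /\
        l2sqnorm (fun x => o' s x w - o' t x w)
          @[s --> within `[0, T] (nbhs t)] --> 0%E].

(* Main.v *)
Require Import Defs.
From HB Require Import structures.
From mathcomp Require Import all_boot all_order all_algebra.
From mathcomp Require Import all_classical all_reals all_analysis.
From mathcomp Require Import measurable_realfun.
From mathcomp Require Import zify ring lra.

(** The Green function is diagonal in the cosine basis phi_j, so that
    o(t,x) = \sum_j phi_j(x) W_j(t), where the mode W_j(t) is sigma times the
    Wiener integral of 1_(s < t) exp (- j^4 (t - s)) phi_j(y). The theorem rests
    on one mean square estimate for the increments of the modes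
    ([mode_increment]):
      E |W_j(t) - W_j(s)|^2 <= C (j+1)^(1-2H2) min(t - s, (j+1)^(-4))^(2H1),
    hence also C (j+1)^(1-2H2-8H1+8th) (t - s)^(2th) for 0 <= th <= H1.

    Why the estimate holds. For H >= 1/2 the increments of fractional Brownian
    motion over disjoint cells are positively correlated, and each row of their
    covariance matrix sums to at most a constant times the length of the cell.
    Schur's test then bounds the Wiener integral on L2 ([fbm_form_le_min]), which
    gives its existence but ignores the oscillation of cos (j y). On a uniform
    grid the covariance of two increments also decreases with their distance, so
    that summation by parts gives the order h A^(2H-1) for a row tested against a
    bounded sequence whose sums over intervals, times the mesh h, are at most A
    ([uniform_row_bound]). In space cos (j y) has A of order 1/(j+1); in time
    the difference of two exponential kernels has A and L1 norm of order
    min(t - s, (j+1)^(-4)).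

    From modes to norms. A bound on the mean square of a Gaussian variable bounds
    all its even moments ([gaussian_moment]). The expansion of o converges in
    mean square, uniformly in x ([convolution_tail]), which by Tonelli identifies
    the W_j(t) with the Fourier coefficients of almost every path
    ([ae_fourier_coef]). Jensen's inequality with the weights (j+1)^(-1-kap)
    reduces moments of the norm of \dot H^beta to moments of single modes
    ([hnorm_pow_le]); the exponents balance exactly when
    th = (4H1+H2-1-beta)/4 - kap/8, which is the time regularity claimed, with an
    arbitrarily small loss ([increment_moment]).

    Suprema and continuity. For each mode, chaining along dyadic times bounds the
    values at all dyadic times by one random variable with moments of the same
    order ([dyadic_floor_chain], [chain_moment]). Together with the reduction
    above this bounds the supremum over t ([sup_moment_finite]). With th = 1/8 the
    same bounds are summable over j, so that the modes have continuous versions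
    whose spectral series converges uniformly: this is the continuous version of o
    ([continuous_version_exists]).

    Regularity in space. By orthogonality of the phi_j in the variable y, the
    squared L2 distance of the kernels at x and z is at most
    \sum_j (phi_j(x) - phi_j(z))^2 / (2 j^4) <= |x - z|^2
    ([convolution_lipschitz]). *)

Import Order.TTheory GRing.Theory Num.Theory.
Import numFieldNormedType.Exports.

Set Implicit Arguments.
Unset Strict Implicit.
Unset Printing Implicit Defensive.

Local Open Scope classical_set_scope.
Local Open Scope ring_scope.

(** * Convexity of real powers *)

Section powers.
Context {R : realType}.
Implicit Types x y u p q : R.

(** Concavity of the logarithm: ln v <= v - 1 is used at v = u / a and at
    v = 1 / a, where a is the right-hand side, with weights p and 1 - p. *)
Lemma powR_bernoulli p u : 0 <= p <= 1 -> 0 <= u -> u `^ p <= 1 + p * (u - 1).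
Proof.
move=> /andP[p0 p1]; rewrite le_eqVlt => /predU1P[<-|u0].
  have [->|pn0] := eqVneq p 0; first by rewrite powRr0; lra.
  by rewrite powR0//; lra.
have [->|pn1] := eqVneq p 1; first by rewrite powRr1 ?(ltW u0)//; lra.
have a0 : 0 < 1 + p * (u - 1).
  have p1' : p < 1 by rewrite lt_neqAle pn1.
  suff : 0 <= p * u by lra.
  by rewrite mulr_ge0// ltW.
set a := 1 + _ in a0 *.
rewrite -[leRHS]lnK ?posrE// /powR gt_eqF// ler_expR.
have lnle v : 0 < v -> ln v <= v - 1.
  move=> v0; have := expR_ge1Dx (ln v); rewrite lnK ?posrE//; lra.
have h1 : ln u - ln a <= u / a - 1 by rewrite -ln_div ?posrE//; apply: lnle; rewrite divr_gt0.
have h2 : - ln a <= a^-1 - 1 by rewrite -lnV ?posrE//; apply: lnle; rewrite invr_gt0.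
have : p * (ln u - ln a) + (1 - p) * (- ln a) <= p * (u / a - 1) + (1 - p) * (a^-1 - 1).
  by apply: lerD; apply: ler_wpM2l => //; lra.
have -> : p * (u / a - 1) + (1 - p) * (a^-1 - 1) = 0.
  have -> : p * (u / a - 1) + (1 - p) * (a^-1 - 1) = (1 + p * (u - 1)) / a - 1 by ring.
  by rewrite divff ?subrr// gt_eqF.
lra.
Qed.

Lemma powR_le_tangent p x y : 0 <= p <= 1 -> 0 <= x -> 0 < y ->
  x `^ p <= y `^ p + p * y `^ (p - 1) * (x - y).
Proof.
move=> p01 x0 y0.
have := powR_bernoulli p01 (divr_ge0 x0 (ltW y0)).
rewrite -(ler_pM2l (powR_gt0 p y0)) -powRM ?(ltW y0)// ?divr_ge0 ?(ltW y0)//.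
rewrite mulrC divfK ?gt_eqF// => /le_trans; apply.
have -> : y `^ (p - 1) = y `^ p / y.
  by rewrite powRB ?(gt_eqF y0) ?implybT// powRr1 ?(ltW y0).
rewrite [leRHS](_ : _ = y `^ p * (1 + p * (x / y - 1)))//.
by field; rewrite gt_eqF.
Qed.

(** The concave tangent inequality at exponent 1 / q, applied to the q-th
    powers of x and y. *)
Lemma powR_ge_tangent q x y : 1 <= q -> 0 <= x -> 0 < y ->
  y `^ q + q * y `^ (q - 1) * (x - y) <= x `^ q.
Proof.
move=> q1 x0 y0; have q0 : 0 < q by lra.
have iq : 0 <= q^-1 <= 1 by rewrite invr_ge0 ltW//= invf_le1.
have := powR_le_tangent iq (powR_ge0 x q) (powR_gt0 q y0).
rewrite -!powRrM !(divff, mulfV) ?gt_eqF// !powRr1 ?(ltW y0)//.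
set e := q * (q^-1 - 1); have -> : e = 1 - q by rewrite /e; field; rewrite gt_eqF.
move=> h; have := h; rewrite -(ler_pM2l (mulr_gt0 q0 (powR_gt0 (q - 1) y0))).
rewrite mulrDr.
have -> : q * y `^ (q - 1) * (q^-1 * y `^ (1 - q) * (x `^ q - y `^ q)) = x `^ q - y `^ q.
  rewrite -(opprB q 1) powRN; field; rewrite !gt_eqF ?powR_gt0//.
lra.
Qed.

Lemma powR_increment_le q x y : 1 <= q -> 0 <= x -> x <= y ->
  y `^ q - x `^ q <= q * y `^ (q - 1) * (y - x).
Proof.
move=> q1 x0; rewrite le_eqVlt => /predU1P[->|xy]; first by rewrite !subrr mulr0.
have := powR_ge_tangent q1 x0 (le_lt_trans x0 xy); lra.
Qed.

(** Convexity in chord form: y and x + u lie between x and y + u and have the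
    same sum as these end points. *)
Lemma powR_increment_mono q x y u : 1 <= q -> 0 <= x -> x <= y -> 0 <= u ->
  (x + u) `^ q - x `^ q <= (y + u) `^ q - y `^ q.
Proof.
move=> q1 x0 xy u0.
have [h|h] := eqVneq (y + u) x.
  have -> : y = x by lra.
  by [].
have D0 : 0 < y + u - x by rewrite lt_neqAle eq_sym subr_eq0 h/=; lra.
have chord z : x <= z <= y + u ->
    (y + u - x) * z `^ q <= (y + u - z) * x `^ q + (z - x) * (y + u) `^ q.
  move=> /andP[xz zb]; have := le_trans x0 xz; rewrite le_eqVlt => /predU1P[z0|z0].
    have x0' : x = 0 by lra.
    by rewrite -z0 x0' powR0 ?gt_eqF//; lra.
  have h1 := powR_ge_tangent q1 x0 z0.
  have h2 := powR_ge_tangent q1 (le_trans x0 (le_trans xz zb)) z0.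
  have h3 := ler_wpM2l (_ : 0 <= y + u - z) h1.
  have h4 := ler_wpM2l (_ : 0 <= z - x) h2.
  have := h3 ltac:(lra); have := h4 ltac:(lra).
  by move: (z `^ q) (z `^ (q - 1)) ((y + u) `^ q) (x `^ q) => A B C D'; nra.
have c1 := chord y ltac:(lra); have c2 := chord (x + u) ltac:(lra).
rewrite -(ler_pM2l D0).
move: c1 c2; move: (x `^ q) (y `^ q) ((x + u) `^ q) ((y + u) `^ q) => A B C D'; lra.
Qed.

(** The derivative of the second difference is q times a second difference of
    the power q - 1, and that power is concave since q - 1 <= 1. *)
Lemma powR_second_diff_nincr q x y : 1 <= q <= 2 -> 1 < x -> x <= y ->
  (y + 1) `^ q + (y - 1) `^ q - 2 * y `^ q <= (x + 1) `^ q + (x - 1) `^ q - 2 * x `^ q.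
Proof.
move=> /andP[q1 q2] x1; rewrite le_eqVlt => /predU1P[->//|xy].
pose f z : R := (z + 1) `^ q + (z - 1) `^ q - 2 * z `^ q.
pose df z : R := q * ((z + 1) `^ (q - 1) + (z - 1) `^ (q - 1) - 2 * z `^ (q - 1)).
have der (z : R) : 1 < z -> is_derive z 1 f (df z).
  move=> z1.
  have zp : 0 < z + 1 by lra.
  have zm : 0 < z - 1 by lra.
  have z0 : 0 < z by lra.
  have hz := is_derive1_powR q z0.
  have hp : is_derive z 1 (fun u => (u + 1) `^ q) (q * (z + 1) `^ (q - 1)).
    have hc : is_derive z 1 (fun u : R => u + 1) 1.
      by apply: is_derive_eq; rewrite addr0.
    have := @is_derive1_comp R (fun x : R => x `^ q) (fun u : R => u + 1) z _ _ (is_derive1_powR q zp) hc.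
    by rewrite mulr1.
  have hm : is_derive z 1 (fun u => (u - 1) `^ q) (q * (z - 1) `^ (q - 1)).
    have hc : is_derive z 1 (fun u : R => u - 1) 1.
      by apply: is_derive_eq; rewrite subr0.
    have := @is_derive1_comp R (fun x : R => x `^ q) (fun u : R => u - 1) z _ _ (is_derive1_powR q zm) hc.
    by rewrite mulr1.
  rewrite /f /df; apply: is_derive_eq.
  rewrite /GRing.scale/=; ring.
have [||c /andP[cx cy]] := @MVT _ f df x y xy.
- by move=> z /[!in_itv]/= /andP[xz _]; apply: der; lra.
- apply: derivable_within_continuous => z /[!in_itv]/= /andP[xz _].
  by have [] := der z ltac:(lra).
rewrite /f -/(f x) -/(f y) => hc.
have c1 : 1 < c by move: cx; rewrite bnd_simp; lra.
suff : df c <= 0.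
  move=> dc; have : df c * (y - x) <= 0 by rewrite mulr_le0_ge0// ; lra.
  by rewrite -hc /f; lra.
have p01 : 0 <= q - 1 <= 1 by lra.
have c0 : 0 < c by lra.
have h1 := @powR_le_tangent (q - 1) (c + 1) c p01 ltac:(lra) c0.
have h2 := @powR_le_tangent (q - 1) (c - 1) c p01 ltac:(lra) c0.
rewrite /df mulr_ge0_le0//; first by lra.
move: h1 h2; set A := _ * c `^ _; lra.
Qed.

End powers.

(** * Quadratic forms on grids *)

Section quadratic_forms.
Context {R : realType}.

(** Used with chi the indicator that a cell lies below a grid point: a form in
    weighted points becomes a form in the weights they put on the cells. *)
Lemma quad_form_change (I : Type) (s : seq I) (Q : finType) (a : I -> R)
    (chi : I -> Q -> R) (m : Q -> Q -> R) :
  \sum_(c <- s) \sum_(c' <- s) a c * a c' *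
      (\sum_p \sum_p' chi c p * chi c' p' * m p p') =
  \sum_p \sum_p' (\sum_(c <- s) a c * chi c p) *
      (\sum_(c <- s) a c * chi c p') * m p p'.
Proof.
under eq_bigr do under eq_bigr do rewrite mulr_sumr.
under eq_bigr do rewrite exchange_big/=.
rewrite exchange_big/=; apply: eq_bigr => p _.
under eq_bigr do under eq_bigr do rewrite mulr_sumr.
under eq_bigr do rewrite exchange_big/=.
rewrite exchange_big/=; apply: eq_bigr => p' _.
rewrite !mulr_suml; apply: eq_bigr => c _.
rewrite mulr_sumr mulr_suml; apply: eq_bigr => c' _; ring.
Qed.

(** By 2 a b <= a^2 + b^2 and the symmetry of the kernel. *)
Lemma schur_test (Q : finType) (A r : Q -> R) (m : Q -> Q -> R) :
  (forall p p', 0 <= m p p') -> (forall p p', m p p' = m p' p) ->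
  (forall p, \sum_p' m p p' <= r p) ->
  \sum_p \sum_p' A p * A p' * m p p' <= \sum_p A p ^+ 2 * r p.
Proof.
move=> m0 msym mr.
have h : \sum_p \sum_p' A p * A p' * m p p' <=
    \sum_p \sum_p' (2^-1 * (A p ^+ 2 * m p p') + 2^-1 * (A p' ^+ 2 * m p' p)).
  apply: ler_sum => p _; apply: ler_sum => p' _.
  rewrite (msym p' p); have := mulr_ge0 (sqr_ge0 (A p - A p')) (m0 p p').
  by rewrite sqrrB; nra.
apply: (le_trans h); under eq_bigr do rewrite big_split/=.
rewrite big_split/= [X in _ + X]exchange_big/= -big_split/=.
apply: ler_sum => p _.
rewrite -!mulr_sumr -mulrDl (_ : 2^-1 + 2^-1 = 1) ?mul1r; last by lra.
by apply: ler_wpM2l; rewrite ?sqr_ge0.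
Qed.

(** For a covariance sampled on a grid this is the covariance of the increments
    over the cells i and j. *)
Definition cell (K : nat -> nat -> R) i j :=
  K i.+1 j.+1 - K i j.+1 - K i.+1 j + K i j.

Lemma kernel_telescope (K : nat -> nat -> R) n m :
  (forall i, K i 0%N = 0) -> (forall j, K 0%N j = 0) ->
  K n m = \sum_(i < n) \sum_(j < m) cell K i j.
Proof.
move=> K0 K0'.
rewrite (eq_bigr (fun i : 'I_n => K i.+1 m - K i m)); last first.
  move=> i _; rewrite (eq_bigr (fun j : 'I_m =>
    (K i.+1 j.+1 - K i j.+1) - (K i.+1 j - K i j))); last first.
    by move=> j _; rewrite /cell; ring.
  rewrite -(big_mkord xpredT (fun j => (K i.+1 j.+1 - K i j.+1) - (K i.+1 j - K i j))).
  by rewrite telescope_sumr// !K0; ring.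
rewrite -(big_mkord xpredT (fun i => K i.+1 m - K i m)) telescope_sumr// K0'.
by rewrite subr0.
Qed.

(** The indicator that the cell i lies before the grid point n, real-valued so as
    to be summed against cells. *)
Definition bef (i n : nat) : R := (i < n)%:R.

Lemma sum_bef (F : nat -> R) n N : (n <= N)%N ->
  \sum_(i < n) F i = \sum_(i < N) bef i n * F i.
Proof.
move=> nN; rewrite (big_ord_widen N _ nN) big_mkcond/=.
by apply: eq_bigr => i _; rewrite /bef; case: ifP => _; rewrite ?mul1r ?mul0r.
Qed.

Lemma kernel_telescope_bef (K : nat -> nat -> R) n m N :
  (forall i, K i 0%N = 0) -> (forall j, K 0%N j = 0) ->
  (n <= N)%N -> (m <= N)%N ->
  K n m = \sum_(i < N) \sum_(j < N) bef i n * bef j m * cell K i j.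
Proof.
move=> K0 K0' nN mN; rewrite kernel_telescope// (sum_bef (fun i => \sum_(j < m) cell K i j) nN).
apply: eq_bigr => i _; rewrite (sum_bef (cell K i) mN) mulr_sumr.
by apply: eq_bigr => j _; rewrite mulrA.
Qed.

Lemma min_telescope (tau : nat -> R) n m N :
  tau 0%N = 0 -> (n <= N)%N -> (m <= N)%N ->
  tau (minn n m) = \sum_(i < N) bef i n * bef i m * (tau i.+1 - tau i).
Proof.
move=> tau0 nN mN.
have -> : tau (minn n m) = \sum_(i < minn n m) (tau i.+1 - tau i).
  rewrite -(big_mkord xpredT (fun i => tau i.+1 - tau i)) telescope_sumr//.
  by rewrite tau0 subr0.
rewrite (sum_bef (fun i => tau i.+1 - tau i) (leq_trans (geq_minl n m) nN)).
apply: eq_bigr => i _; rewrite /bef leq_min.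
by case: (i < n)%N; case: (i < m)%N; rewrite ?(mul1r, mul0r, mulr0).
Qed.

(** By telescoping, both sides are quadratic forms in the weights that the
    points put on the product cells. The form on the right is diagonal, with the
    areas of the cells as entries; the kernel on the left is nonnegative, and its
    rows sum to at most C1 C2 times these areas, so Schur's test applies. *)
Lemma tensor_form_le (I : Type) (s : seq I) (a : I -> R) (n l : I -> nat)
    (N L : nat) (K1 K2 : nat -> nat -> R) (tau xi : nat -> R) (C1 C2 : R) :
  (forall c, n c <= N)%N -> (forall c, l c <= L)%N ->
  (forall i, K1 i 0%N = 0) -> (forall j, K1 0%N j = 0) ->
  (forall i, K2 i 0%N = 0) -> (forall j, K2 0%N j = 0) ->
  (forall i j, cell K1 i j = cell K1 j i) ->
  (forall i j, cell K2 i j = cell K2 j i) ->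
  (forall i j, (i < N)%N -> (j < N)%N -> 0 <= cell K1 i j) ->
  (forall i j, (i < L)%N -> (j < L)%N -> 0 <= cell K2 i j) ->
  (forall i, (i < N)%N -> \sum_(j < N) cell K1 i j <= C1 * (tau i.+1 - tau i)) ->
  (forall i, (i < L)%N -> \sum_(j < L) cell K2 i j <= C2 * (xi i.+1 - xi i)) ->
  tau 0%N = 0 -> xi 0%N = 0 ->
  \sum_(c <- s) \sum_(c' <- s) a c * a c' * (K1 (n c) (n c') * K2 (l c) (l c'))
  <= C1 * C2 * \sum_(c <- s) \sum_(c' <- s) a c * a c' *
      (tau (minn (n c) (n c')) * xi (minn (l c) (l c'))).
Proof.
move=> nN lL K10 K10' K20 K20' sym1 sym2 pos1 pos2 row1 row2 tau0 xi0.
pose chi c (p : 'I_N * 'I_L) := bef p.1 (n c) * bef p.2 (l c).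
pose m (p p' : 'I_N * 'I_L) := cell K1 p.1 p'.1 * cell K2 p.2 p'.2.
pose w (p : 'I_N * 'I_L) := (tau p.1.+1 - tau p.1) * (xi p.2.+1 - xi p.2).
have E1 c c' : K1 (n c) (n c') * K2 (l c) (l c') =
    \sum_p \sum_p' chi c p * chi c' p' * m p p'.
  rewrite (kernel_telescope_bef K10 K10' (nN c) (nN c')).
  rewrite (kernel_telescope_bef K20 K20' (lL c) (lL c')).
  rewrite big_distrlr/= pair_big/=; apply: eq_bigr => p _.
  rewrite big_distrlr/= pair_big/=; apply: eq_bigr => p' _.
  by rewrite /chi /m; ring.
have E2 c c' : tau (minn (n c) (n c')) * xi (minn (l c) (l c')) =
    \sum_p \sum_p' chi c p * chi c' p' * ((p == p')%:R * w p).
  rewrite (min_telescope tau0 (nN c) (nN c')) (min_telescope xi0 (lL c) (lL c')).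
  rewrite big_distrlr/= pair_big/=; apply: eq_bigr => p _.
  rewrite (bigD1 p)//= eqxx [X in _ = _ + X]big1 ?addr0; last first.
    by move=> p' /negPf np; rewrite eq_sym np mul0r mulr0.
  by rewrite /chi /w mulr1n; ring.
under eq_bigr do under eq_bigr do rewrite E1.
under [in leRHS]eq_bigr do under eq_bigr do rewrite E2.
rewrite !quad_form_change.
set A := fun p => \sum_(c <- s) a c * chi c p.
have -> : \sum_p \sum_p' A p * A p' * ((p == p')%:R * w p) = \sum_p A p ^+ 2 * w p.
  apply: eq_bigr => p _; rewrite (bigD1 p)//= eqxx [X in _ + X]big1 ?addr0; last first.
    by move=> p' /negPf np; rewrite eq_sym np mul0r mulr0.
  by rewrite mul1r expr2.
rewrite mulr_sumr [leRHS](eq_bigr (fun p => A p ^+ 2 * (C1 * C2 * w p))); last first.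
  by move=> p _; ring.
apply: schur_test => [p p'|p p'|p].
- by rewrite mulr_ge0// ?pos1 ?pos2.
- by rewrite /m (sym1 p.1) (sym2 p.2).
- have -> : \sum_p' m p p' = (\sum_(j < N) cell K1 p.1 j) * (\sum_(j < L) cell K2 p.2 j).
    by rewrite big_distrlr/= pair_big.
  have -> : C1 * C2 * w p =
    (C1 * (tau p.1.+1 - tau p.1)) * (C2 * (xi p.2.+1 - xi p.2)) by rewrite /w; ring.
  apply: ler_pM; rewrite ?row1 ?row2//.
  + by apply: sumr_ge0 => j _; apply: pos1.
  + by apply: sumr_ge0 => j _; apply: pos2.
Qed.

End quadratic_forms.

(** * The fractional Brownian covariance on a grid *)

Section fbm_kernel.
Context {R : realType}.
Implicit Types H t s : R.

Lemma fbm_covC H t s : fbm_cov H t s = fbm_cov H s t.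
Proof. by rewrite /fbm_cov distrC (addrC (t `^ _)). Qed.

Lemma fbm_cov0 H s : 0 < H -> 0 <= s -> fbm_cov H 0 s = 0.
Proof.
move=> H0 s0; rewrite /fbm_cov powR0 ?gt_eqF ?mulr_gt0//.
by rewrite sub0r normrN ger0_norm// add0r subrr.
Qed.

Definition grid_cov H (tau : nat -> R) i j := fbm_cov H (tau i) (tau j).

Lemma cell_grid_covC H (tau : nat -> R) i j :
  cell (grid_cov H tau) i j = cell (grid_cov H tau) j i.
Proof.
rewrite /cell /grid_cov (fbm_covC _ (tau i.+1) (tau j.+1)).
rewrite (fbm_covC _ (tau i) (tau j.+1)) (fbm_covC _ (tau i.+1) (tau j)).
by rewrite (fbm_covC _ (tau i) (tau j)); ring.
Qed.

Lemma cell_grid_covE H (tau : nat -> R) i j :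
  cell (grid_cov H tau) i j =
  `|tau i - tau j.+1| `^ (2 * H) + `|tau i.+1 - tau j| `^ (2 * H)
   - `|tau i.+1 - tau j.+1| `^ (2 * H) - `|tau i - tau j| `^ (2 * H).
Proof. by rewrite /cell /grid_cov /fbm_cov; ring. Qed.

Lemma grid_mono (tau : nat -> R) N :
  (forall i, (i < N)%N -> tau i <= tau i.+1) ->
  forall i j, (i <= j)%N -> (j <= N)%N -> tau i <= tau j.
Proof.
move=> mono i j; elim: j => [|j IH]; first by rewrite leqn0 => /eqP->.
rewrite leq_eqVlt => /predU1P[->//|]; rewrite ltnS => ij jN.
exact: le_trans (IH ij (ltnW jN)) (mono _ jN).
Qed.

(** Disjoint increments are positively correlated because the power 2 H is
    convex. *)
Lemma cell_grid_cov_ge0 H (tau : nat -> R) N i j : 2^-1 <= H ->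
  (forall i, (i < N)%N -> tau i <= tau i.+1) ->
  (i < N)%N -> (j < N)%N -> 0 <= cell (grid_cov H tau) i j.
Proof.
move=> H12 mono; wlog ij : i j / (i <= j)%N.
  move=> W iN jN; have [ij|/ltnW ji] := leqP i j; first exact: W.
  by rewrite cell_grid_covC; apply: W.
move=> iN jN; have gm := grid_mono mono; rewrite cell_grid_covE.
have mi := mono _ iN; have mj := mono _ jN.
move: ij; rewrite leq_eqVlt => /predU1P[ij|ij].
  have -> : tau i - tau j = 0 by rewrite ij subrr.
  have -> : tau i.+1 - tau j.+1 = 0 by rewrite ij subrr.
  rewrite normr0 powR0; last by rewrite gt_eqF//; lra.
  by rewrite !subr0 addr_ge0// powR_ge0.
have gij : tau i.+1 <= tau j by apply: gm => //; exact: ltnW.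
rewrite ![`|tau _ - tau j.+1|]distrC ![`|tau _ - tau j|]distrC.
rewrite !ger0_norm; [|lra|lra|lra|lra].
have := @powR_increment_mono _ (2 * H) (tau j - tau i.+1) (tau j.+1 - tau i.+1)
  (tau i.+1 - tau i) ltac:(lra) ltac:(lra) ltac:(lra) ltac:(lra).
have -> : tau j - tau i.+1 + (tau i.+1 - tau i) = tau j - tau i by ring.
have -> : tau j.+1 - tau i.+1 + (tau i.+1 - tau i) = tau j.+1 - tau i by ring.
lra.
Qed.

Lemma cell_row_sum (K : nat -> nat -> R) i N : (forall i, K i 0%N = 0) ->
  \sum_(j < N) cell K i j = K i.+1 N - K i N.
Proof.
move=> K0; rewrite (eq_bigr (fun j : 'I_N =>
    (K i.+1 j.+1 - K i j.+1) - (K i.+1 j - K i j))); last first.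
  by move=> j _; rewrite /cell; ring.
rewrite -(big_mkord xpredT (fun j => (K i.+1 j.+1 - K i j.+1) - (K i.+1 j - K i j))).
by rewrite telescope_sumr// !K0; ring.
Qed.

(** A row telescopes to the covariance of one increment with the end point of
    the path, which is Lipschitz in the length of the increment as 2 H >= 1. *)
Lemma cell_grid_cov_row H (tau : nat -> R) T N i : 2^-1 <= H ->
  (forall i, 0 <= tau i) -> tau 0%N = 0 -> tau N <= T ->
  (forall i, (i < N)%N -> tau i <= tau i.+1) -> (i < N)%N ->
  \sum_(j < N) cell (grid_cov H tau) i j <=
    4 * H * T `^ (2 * H - 1) * (tau i.+1 - tau i).
Proof.
move=> H12 tp tau0 tauT mono iN; have gm := grid_mono mono.
rewrite cell_row_sum => [|k]; last first.
  by rewrite /grid_cov tau0 fbm_covC fbm_cov0//; lra.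
have ti := mono _ iN; have t1 : tau i.+1 <= tau N by apply: gm.
rewrite /grid_cov /fbm_cov ![`|_ - tau N|]distrC !ger0_norm; [|lra|lra].
have T0 : 0 <= T by exact: le_trans tauT.
have bnd x y : 0 <= x -> x <= y -> y <= T ->
    y `^ (2 * H) - x `^ (2 * H) <= 2 * H * T `^ (2 * H - 1) * (y - x).
  move=> x0 xy yT; apply: (le_trans (@powR_increment_le _ (2 * H) x y ltac:(lra) x0 xy)).
  apply: ler_wpM2r; first lra.
  apply: ler_wpM2l; first lra.
  by apply: ge0_ler_powR => //; rewrite ?nnegrE; lra.
have b1 := bnd (tau i) (tau i.+1) (tp i) ti (le_trans t1 tauT).
have b2 := bnd (tau N - tau i.+1) (tau N - tau i) ltac:(lra) ltac:(lra)
  ltac:(have := tp i; lra).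
move: b1 b2; move: (tau i `^ _) (tau i.+1 `^ _) (T `^ _) (tau N `^ _)
  ((tau N - tau i.+1) `^ _) ((tau N - tau i) `^ _) => A B' C D E F.
have -> : tau N - tau i - (tau N - tau i.+1) = tau i.+1 - tau i by ring.
move=> b1 b2.
have -> : 4 * H * C * (tau i.+1 - tau i) =
  2 * H * C * (tau i.+1 - tau i) + 2 * H * C * (tau i.+1 - tau i) by ring.
lra.
Qed.

(** Sorting the points gives a grid; repeated points only create empty cells. *)
Lemma grid_through (ts : seq R) T : 0 <= T -> (forall t, t \in ts -> 0 <= t <= T) ->
  exists N (tau : nat -> R) (idx : R -> nat),
  [/\ [/\ tau 0%N = 0, forall i, 0 <= tau i & tau N <= T],
      forall i, (i < N)%N -> tau i <= tau i.+1,
      forall t, (idx t <= N)%N &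
      forall t, t \in ts -> tau (idx t) = t].
Proof.
move=> T0 tsT; pose s := sort <=%R (0 :: ts).
have ss : size s = (size ts).+1 by rewrite size_sort.
have srt : sorted <=%R s by apply: sort_le_sorted.
have memS t : t \in s -> 0 <= t <= T.
  rewrite mem_sort inE => /predU1P[->|/tsT//]; by rewrite lexx T0.
have n0 i : 0 <= nth 0 s i <= T.
  have [h|h] := ltnP i (size s); first exact/memS/mem_nth.
  by rewrite nth_default// lexx T0.
have le_nth i j : (i <= j)%N -> (j < size s)%N -> nth 0 s i <= nth 0 s j.
  move=> ij js; apply: (sorted_leq_nth le_trans le_refl 0 srt) => //.
  by rewrite inE (leq_ltn_trans ij).
exists (size ts), (fun i => nth 0 s i), (fun t => minn (index t s) (size ts)).
split.
- split=> [|i|]; last by have /andP[] := n0 (size ts).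
  + apply/eqP; rewrite eq_le; have /andP[-> _] := n0 0%N; rewrite andbT.
    have zs : 0 \in s by rewrite mem_sort inE eqxx.
    rewrite -{2}(nth_index 0 zs); apply: le_nth => //.
    by rewrite index_mem.
  + by have /andP[] := n0 i.
- by move=> i iN; apply: le_nth => //; rewrite ss.
- by move=> t; exact: geq_minr.
- move=> t tts; have tS : t \in s by rewrite mem_sort inE tts orbT.
  have := tS; rewrite -index_mem ss ltnS => h.
  by rewrite (minn_idPl h) nth_index.
Qed.

(** Since the kernel min is the L2 scalar product of indicators of rectangles,
    this is the boundedness on L2 of the map from elementary functions to their
    integrals. *)
Lemma fbm_form_le_min (H1 H2 T : R) (e : elem R) :
  2^-1 <= H1 -> 2^-1 <= H2 -> 0 <= T -> elem_in T e ->
  \sum_(c <- e) \sum_(c' <- e) c.1 * c'.1 *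
     (fbm_cov H1 c.2.1 c'.2.1 * fbm_cov H2 c.2.2 c'.2.2)
  <= (4 * H1 * T `^ (2 * H1 - 1)) * (4 * H2 * pi `^ (2 * H2 - 1)) *
     \sum_(c <- e) \sum_(c' <- e) c.1 * c'.1 *
     (Num.min c.2.1 c'.2.1 * Num.min c.2.2 c'.2.2).
Proof.
move=> H12 H22 T0 eT.
have [] := @grid_through [seq c.2.1 | c <- e] T T0.
  by move=> _ /mapP[c ce ->]; have [] := eT c ce.
move=> N [tau [idx [[tau0 tp tT] mono idxN idxE]]].
have [] := @grid_through [seq c.2.2 | c <- e] pi (pi_ge0 R).
  by move=> _ /mapP[c ce ->]; have [_ /andP[/ltW-> /ltW->]] := eT c ce.
move=> L [xi [jdx [[xi0 xp xT] xmono jdxL jdxE]]].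
have memt c : c \in e -> tau (idx c.2.1) = c.2.1 by move=> ce; apply/idxE/map_f.
have memx c : c \in e -> xi (jdx c.2.2) = c.2.2.
  by move=> ce; apply/jdxE/(map_f (fun c : R * (R * R) => c.2.2)).
have minE (ta : nat -> R) M i j : (forall i, (i < M)%N -> ta i <= ta i.+1) ->
    (i <= M)%N -> (j <= M)%N -> ta (minn i j) = Num.min (ta i) (ta j).
  move=> mo iM jM; have gm := grid_mono mo.
  have [ij|/ltnW ji] := leqP i j.
    by rewrite min_l//; exact: gm.
  by rewrite min_r//; exact: gm.
have := @tensor_form_le R _ e (fun c => c.1) (fun c => idx c.2.1) (fun c => jdx c.2.2)
  N L (grid_cov H1 tau) (grid_cov H2 xi) tau xi _ _
  (fun c => idxN _) (fun c => jdxL _) _ _ _ _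
  (cell_grid_covC H1 tau) (cell_grid_covC H2 xi)
  (fun i j iN jN => cell_grid_cov_ge0 H12 mono iN jN)
  (fun i j iN jN => cell_grid_cov_ge0 H22 xmono iN jN)
  (fun i iN => cell_grid_cov_row H12 tp tau0 tT mono iN)
  (fun i iN => cell_grid_cov_row H22 xp xi0 xT xmono iN) tau0 xi0.
have z1 i : grid_cov H1 tau 0 i = 0 by rewrite /grid_cov tau0 fbm_cov0//; lra.
have z2 i : grid_cov H2 xi 0 i = 0 by rewrite /grid_cov xi0 fbm_cov0//; lra.
have z1' i : grid_cov H1 tau i 0 = 0 by rewrite /grid_cov fbm_covC; exact: z1.
have z2' i : grid_cov H2 xi i 0 = 0 by rewrite /grid_cov fbm_covC; exact: z2.
move=> /(_ z1' z1 z2' z2).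
congr (_ <= _).
  apply: eq_big_seq => c ce; apply: eq_big_seq => c' ce'.
  by rewrite /grid_cov !memt// !memx.
congr (_ * _).
apply: eq_big_seq => c ce; apply: eq_big_seq => c' ce'.
by rewrite (minE _ _ _ _ mono)// (minE _ _ _ _ xmono)// !memt// !memx.
Qed.

End fbm_kernel.

(** * Cancellation on uniform grids *)

Section uniform_grid.
Context {R : realType}.

(** Summation by parts. *)
Lemma abel_bound (c g : nat -> R) (G : R) n :
  (forall k, 0 <= c k) -> (forall k, c k.+1 <= c k) ->
  (forall k, (k <= n)%N -> `|\sum_(j < k) g j| <= G) ->
  `|\sum_(j < n) c j * g j| <= c 0%N * G.
Proof.
move=> c0 cmono gG.
have G0 : 0 <= G by have := gG 0%N isT; rewrite big_ord0 normr0.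
case: n gG => [|n] gG; first by rewrite big_ord0 normr0 mulr_ge0.
have -> : \sum_(j < n.+1) c j * g j = c n * (\sum_(j < n.+1) g j) +
    \sum_(j < n) (c j - c j.+1) * (\sum_(k < j.+1) g k).
  elim: n {gG} => [|n IH]; first by rewrite big_ord0 !big_ord_recr/= !big_ord0; ring.
  rewrite big_ord_recr/= {}IH [X in _ = _ + X]big_ord_recr/=.
  rewrite [X in _ = c n.+1 * X + _]big_ord_recr/=.
  ring.
apply: (le_trans (ler_normD _ _)).
have -> : c 0%N * G = c n * G + \sum_(j < n) (c j - c j.+1) * G.
  rewrite -mulr_suml -mulrDl; congr (_ * _).
  rewrite -(big_mkord xpredT (fun j => c j - c j.+1)).
  have := telescope_sumr (fun j => - c j) (leq0n n).
  have -> : \sum_(0 <= j < n) (- c j.+1 - - c j) = \sum_(0 <= j < n) (c j - c j.+1).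
    by apply: eq_bigr => j _; ring.
  by move=> ->; ring.
apply: lerD; first by rewrite normrM ger0_norm// ler_wpM2l// gG.
apply: (le_trans (ler_norm_sum _ _ _)); apply: ler_sum => j _.
by rewrite normrM ger0_norm ?subr_ge0// ler_wpM2l ?subr_ge0// gG// ltnS ltnW.
Qed.

(** With q = 2 H, twice the covariance of two unit increments of fractional
    Brownian motion whose starting points are r apart. *)
Definition unit_cov (q : R) (r : nat) : R :=
  (r%:R + 1) `^ q + `|r%:R - 1| `^ q - 2 * r%:R `^ q.

Definition ugrid (h : R) (i : nat) : R := i%:R * h.

Lemma ugrid_mono h N : 0 <= h -> forall i, (i < N)%N -> ugrid h i <= ugrid h i.+1.
Proof. by move=> h0 i _; rewrite /ugrid ler_wpM2r// ler_nat. Qed.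

Lemma cell_uniform H h i j : 2^-1 <= H -> 0 <= h -> (i <= j)%N ->
  cell (grid_cov H (ugrid h)) i j = h `^ (2 * H) * unit_cov (2 * H) (j - i).
Proof.
move=> H12 h0 ij; rewrite cell_grid_covE /ugrid -!mulrBl !normrM (ger0_norm h0).
rewrite !powRM//.
have -> : j%:R = (j - i)%:R + i%:R :> R by rewrite -natrD subnK.
set r := (j - i)%N.
have -> : j.+1%:R = r%:R + 1 + i%:R :> R by rewrite -natr1 -[in LHS](subnK ij) natrD; ring.
rewrite /unit_cov.
have -> : i%:R - (r%:R + 1 + i%:R) = - (r%:R + 1) :> R by ring.
have -> : i.+1%:R - (r%:R + i%:R) = - (r%:R - 1) :> R by rewrite -natr1; ring.
have -> : i.+1%:R - (r%:R + 1 + i%:R) = - r%:R :> R by rewrite -natr1; ring.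
have -> : i%:R - (r%:R + i%:R) = - r%:R :> R by ring.
rewrite !normrN (ger0_norm (_ : 0 <= r%:R + 1)) ?addr_ge0// (ger0_norm (_ : 0 <= r%:R))//.
ring.
Qed.

Lemma unit_cov_ge0 (q : R) r : 1 <= q -> 0 <= unit_cov q r.
Proof.
move=> q1; have q0 : q != 0 by rewrite gt_eqF//; lra.
case: r => [|r].
  by rewrite /unit_cov/= mulr0n (powR0 q0) add0r sub0r normrN1 powR1; lra.
have r1 : 0 <= r.+1%:R - 1 :> R by rewrite -natr1 addrK.
rewrite /unit_cov ger0_norm//.
have := @powR_increment_mono _ q (r.+1%:R - 1) r.+1%:R 1 q1 r1 ltac:(lra) ltac:(lra).
have -> : r.+1%:R - 1 + 1 = r.+1%:R :> R by ring.
lra.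
Qed.

Lemma unit_cov_nincr (q : R) r : 1 <= q <= 2 -> (2 <= r)%N ->
  unit_cov q r.+1 <= unit_cov q r.
Proof.
move=> q12 r2; have r1 : 2 <= r%:R :> R by rewrite ler_nat.
rewrite /unit_cov !ger0_norm; last 2 first.
- lra.
- by rewrite -natr1; lra.
by apply: powR_second_diff_nincr => //; rewrite -?natr1; lra.
Qed.

(** As a second difference, unit_cov telescopes when summed over 2 <= k <= n;
    since it is nonincreasing from 2 on, its last value is at most the average. *)
Lemma unit_cov_le (q : R) n : 1 <= q <= 2 -> (2 <= n)%N ->
  unit_cov q n * (n%:R - 1) <= q * (n%:R + 1) `^ (q - 1).
Proof.
move=> q12 n2; have /andP[q1 q2] := q12.
pose D (r : nat) : R := (r%:R + 1) `^ q - r%:R `^ q.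
have mD r : unit_cov q r.+1 = D r.+1 - D r.
  rewrite /unit_cov /D ger0_norm; last by rewrite -natr1 addrK.
  have -> : r.+1%:R - 1 = r%:R :> R by rewrite -natr1; ring.
  by rewrite -natr1; ring.
have anti : forall k, (2 <= k)%N -> forall j, unit_cov q (k + j) <= unit_cov q k.
  move=> k k2; elim=> [|j IH]; first by rewrite addn0.
  rewrite addnS; apply: le_trans IH; apply: unit_cov_nincr => //.
  exact: leq_trans (leq_addr _ _).
have h : unit_cov q n * (n%:R - 1) <= D n - D 1%N.
  rewrite -(telescope_sumr D (ltnW n2)).
  rewrite (_ : unit_cov q n * (n%:R - 1) = \sum_(1 <= k < n) unit_cov q n); last first.
    by rewrite sumr_const_nat -[RHS]mulr_natr natrB// ltnW.
  rewrite !big_nat; apply: ler_sum => k /andP[k1 kn].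
  rewrite -mD -[X in unit_cov q X](subnKC kn); exact: anti.
have D1 : 0 <= D 1%N.
  rewrite /D subr_ge0; apply: ge0_ler_powR; rewrite ?nnegrE//; lra.
have : D n <= q * (n%:R + 1) `^ (q - 1).
  have := @powR_increment_le _ q n%:R (n%:R + 1) q1 ltac:(by []) ltac:(lra).
  have -> : n%:R + 1 - n%:R = 1 :> R by ring.
  by rewrite mulr1.
lra.
Qed.

Lemma near_cells H h i a b : 2^-1 <= H -> 0 <= h ->
  (a <= i)%N -> (i < b)%N ->
  \sum_(a <= j < b) cell (grid_cov H (ugrid h)) i j =
  h `^ (2 * H) * ((b - i)%:R `^ (2 * H) - (b - i.+1)%:R `^ (2 * H) +
                 ((i.+1 - a)%:R `^ (2 * H) - (i - a)%:R `^ (2 * H))).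
Proof.
move=> H12 h0 ai ib; set K := grid_cov H _.
rewrite (eq_bigr (fun j => (K i.+1 j.+1 - K i j.+1) - (K i.+1 j - K i j))); last first.
  by move=> j _; rewrite /cell; ring.
have ab : (a <= b)%N by apply: leq_trans (ltnW ib).
rewrite (telescope_sumr (fun j => K i.+1 j - K i j) ab).
have absE n m : (n <= m)%N -> `|ugrid h n - ugrid h m| `^ (2 * H) =
    h `^ (2 * H) * (m - n)%:R `^ (2 * H).
  move=> nm; rewrite /ugrid -mulrBl normrM distrC -natrB// (ger0_norm h0).
  by rewrite ger0_norm// powRM// mulrC.
rewrite /K /grid_cov /fbm_cov.
rewrite (absE _ _ ib) (absE _ _ (ltnW ib)).
rewrite (distrC _ (ugrid h a)) (absE _ _ (leqW ai)).
rewrite (distrC _ (ugrid h a)) (absE _ _ ai); ring.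
Qed.

(** Put G = A / h. The cells at distance at most a multiple of G from i are
    summed without cancellation, which telescopes. Farther away the covariances
    decrease with the distance, so that summation by parts only sees the interval
    sums of g, which are at most G. *)
Lemma uniform_row_bound H h N (g : nat -> R) (A : R) i :
  2^-1 <= H <= 1 -> 0 < h -> h <= A ->
  (forall j, (j < N)%N -> `|g j| <= 1) ->
  (forall a b, (a <= b)%N -> (b <= N)%N -> h * `|\sum_(a <= j < b) g j| <= A) ->
  (i < N)%N ->
  `|\sum_(0 <= j < N) cell (grid_cov H (ugrid h)) i j * g j| <=
    32 * h * A `^ (2 * H - 1).
Proof.
move=> /andP[H12 H1] h0 hA g1 gA iN.
set q := 2 * H; have q12 : 1 <= q <= 2 by rewrite /q; lra.
have /andP[q1 q2] := q12.
pose G := A / h.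
have G1 : 1 <= G by rewrite /G ler_pdivlMr// mul1r.
have G0 : 0 <= G by lra.
have [m0 [m02 m0l m0u]] : exists m0 : nat,
    [/\ (2 <= m0)%N, G <= m0%:R - 1 & m0%:R + 1 <= 4 * G].
  have /andP[tr1 tr2] := truncn_itv G0.
  exists (Num.truncn G).+2; split=> //; first by rewrite -natr1 addrK ltW.
  by rewrite -natr1 -natr1; lra.
have sG a b : (a <= b)%N -> (b <= N)%N -> `|\sum_(a <= j < b) g j| <= G.
  by move=> ab bN; rewrite /G ler_pdivlMr// mulrC; exact: gA.
set cl := cell _ i.
pose a := (i.+1 - m0)%N; pose b := minn N (i + m0).
have ai : (a <= i)%N by rewrite /a; clear -m02; lia.
have ib : (i < b)%N by rewrite /b; clear -m02 iN; lia.
have bN : (b <= N)%N by rewrite geq_minl.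
have hq0 : 0 <= h `^ q by exact: powR_ge0.
have Gq : 0 <= (4 * G) `^ (q - 1) by exact: powR_ge0.
rewrite (@big_cat_nat _ _ _ a)//=; last by apply: leq_trans bN; apply: leq_trans (ltnW ib).
rewrite (@big_cat_nat _ _ _ b a)//=; last exact: leq_trans (ltnW ib).
pose c (k : nat) := h `^ q * unit_cov q (m0 + k).
have c0 k : 0 <= c k by rewrite mulr_ge0 ?unit_cov_ge0.
have cm k : c k.+1 <= c k.
  by rewrite /c addnS ler_wpM2l// unit_cov_nincr// (leq_trans m02)// leq_addr.
have c0G : c 0%N * G <= h `^ q * (q * (4 * G) `^ (q - 1)).
  rewrite /c addn0 -mulrA ler_wpM2l//.
  apply: (@le_trans _ _ (unit_cov q m0 * (m0%:R - 1))).
    by rewrite ler_wpM2l// unit_cov_ge0.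
  apply: (le_trans (unit_cov_le q12 m02)); rewrite ler_wpM2l//; first lra.
  by apply: ge0_ler_powR; rewrite ?nnegrE//; lra.
have left_part : `|\sum_(0 <= j < a) cl j * g j| <= h `^ q * (q * (4 * G) `^ (q - 1)).
  apply: le_trans c0G; rewrite big_nat_rev/= add0n.
  have -> : \sum_(0 <= j < a) cl (a - j.+1)%N * g (a - j.+1)%N =
      \sum_(j < a) c j * g (a - j.+1)%N.
    rewrite big_mkord; apply: eq_bigr => j _; congr (_ * _).
    rewrite /cl cell_grid_covC cell_uniform//; [|exact: ltW|by have := ltn_ord j; rewrite /a; clear; lia].
    by congr (_ * unit_cov _ _); have := ltn_ord j; rewrite /a; clear; lia.
  apply: (@abel_bound c (fun j => g (a - j.+1)%N)) => // k ka.
  have -> : \sum_(j < k) g (a - j.+1)%N = \sum_(a - k <= j < a) g j.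
    have -> : \sum_(a - k <= j < a) g j = \sum_(0 <= j < k) g (j + (a - k))%N.
      by rewrite -{1}(add0n (a - k)%N) big_addn subKn.
    rewrite big_nat_rev/= big_mkord.
    by apply: eq_bigr => j _; congr g; have := ltn_ord j; clear -ka; lia.
  by apply: sG; [exact: leq_subr|apply: leq_trans bN; apply: leq_trans (ltnW ib)].
have right_part : `|\sum_(b <= j < N) cl j * g j| <= h `^ q * (q * (4 * G) `^ (q - 1)).
  have [bN'|bN'] := leqP N b.
    by rewrite big_geq// normr0 !mulr_ge0//; lra.
  have bE : b = (i + m0)%N by move: bN'; rewrite /b; clear; lia.
  apply: le_trans c0G; rewrite -{1}(add0n b) big_addn.
  have -> : \sum_(0 <= j < N - b) cl (j + b)%N * g (j + b)%N =
      \sum_(j < N - b) c j * g (j + b)%N.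
    rewrite big_mkord; apply: eq_bigr => j _; congr (_ * _).
    move: (nat_of_ord j) => j'; rewrite /cl cell_uniform//; [|exact: ltW|by clear -ib; lia].
    by congr (_ * unit_cov _ _); rewrite bE; clear; lia.
  apply: (@abel_bound c (fun j => g (j + b)%N)) => // k kb.
  have -> : \sum_(j < k) g (j + b)%N = \sum_(b <= j < k + b) g j.
    by rewrite -{2}(add0n b) big_addn addnK big_mkord.
  by apply: sG; [exact: leq_addl|by move: kb bN'; clear; lia].
have mid_part : `|\sum_(a <= j < b) cl j * g j| <= h `^ q * (2 * q * (4 * G) `^ (q - 1)).
  apply: (@le_trans _ _ (\sum_(a <= j < b) cl j)).
    apply: (le_trans (ler_norm_sum _ _ _)); rewrite !big_nat; apply: ler_sum => j /andP[_ jb].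
    have jN : (j < N)%N by exact: leq_trans jb bN.
    have clj : 0 <= cl j by apply: (cell_grid_cov_ge0 H12 (ugrid_mono (ltW h0)) iN jN).
    by rewrite normrM (ger0_norm clj) ler_piMr// g1.
  rewrite /cl (near_cells H12 (ltW h0) ai ib) ler_wpM2l//.
  have bnd n : (0 < n)%N -> (n <= m0)%N ->
      n%:R `^ q - (n.-1)%:R `^ q <= q * (4 * G) `^ (q - 1).
    move=> n0 nm; have := @powR_increment_le _ q n.-1%:R n%:R q1 ltac:(by []) ltac:(by rewrite ler_nat leq_pred).
    have -> : n%:R - n.-1%:R = 1 :> R by rewrite -[in n%:R](prednK n0) -natr1; ring.
    rewrite mulr1 => /le_trans; apply; rewrite ler_wpM2l//; first lra.
    have : n%:R <= m0%:R :> R by rewrite ler_nat.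
    by move=> ?; apply: ge0_ler_powR; rewrite ?nnegrE//; lra.
  have b1 := bnd (b - i)%N ltac:(clear -ib; lia) ltac:(rewrite /b; clear; lia).
  have b2 := bnd (i.+1 - a)%N ltac:(clear -ai; lia) ltac:(rewrite /a; clear; lia).
  have e1 : (b - i).-1 = (b - i.+1)%N by clear; lia.
  have e2 : (i.+1 - a).-1 = (i - a)%N by clear -ai; lia.
  rewrite e1 in b1; rewrite e2 in b2.
  have -> : 2 * q * (4 * G) `^ (q - 1) = q * (4 * G) `^ (q - 1) + q * (4 * G) `^ (q - 1) by ring.
  exact: lerD.
apply: (@le_trans _ _ (h `^ q * (8 * (4 * G) `^ (q - 1)))).
  apply: (le_trans (ler_normD _ _)).
  apply: (le_trans (lerD (lexx _) (ler_normD _ _))).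
  apply: (le_trans (lerD left_part (lerD mid_part right_part))).
  rewrite -!mulrDr ler_wpM2l//.
  have -> : q * (4 * G) `^ (q - 1) + (2 * q * (4 * G) `^ (q - 1) + q * (4 * G) `^ (q - 1)) =
    (4 * q) * (4 * G) `^ (q - 1) by ring.
  by apply: ler_wpM2r => //; lra.
rewrite powRM// /G powRM ?invr_ge0 ?(ltW h0)//; last by lra.
have -> : h^-1 `^ (q - 1) = h / h `^ q.
  rewrite -[h^-1]powR_inv1 ?(ltW h0)// -powRrM -{2}(powRr1 (ltW h0)) -powRB; last first.
    by rewrite (gt_eqF h0) implybT.
  by congr powR; ring.
have -> : h `^ q * (8 * (4 `^ (q - 1) * (A `^ (q - 1) * (h / h `^ q)))) =
  8 * 4 `^ (q - 1) * h * A `^ (q - 1).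
  by field; rewrite gt_eqF// powR_gt0.
rewrite ler_wpM2r ?powR_ge0// ler_wpM2r ?(ltW h0)//.
have : 4 `^ (q - 1) <= 4 `^ 1 :> R by apply: ler_powR; lra.
by rewrite powRr1; lra.
Qed.

(** One of the two sequences goes through the row bound, the other one is left
    with its L1 norm. *)
Lemma uniform_form_bound H h N (g : nat -> R) (A L : R) :
  2^-1 <= H <= 1 -> 0 < h -> h <= A ->
  (forall j, (j < N)%N -> `|g j| <= 1) ->
  (forall a b, (a <= b)%N -> (b <= N)%N -> h * `|\sum_(a <= j < b) g j| <= A) ->
  h * \sum_(i < N) `|g i| <= L ->
  `|\sum_(i < N) \sum_(j < N) g i * g j * cell (grid_cov H (ugrid h)) i j| <=
    32 * A `^ (2 * H - 1) * L.
Proof.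
move=> H12 h0 hA g1 gA gL.
apply: (@le_trans _ _ (\sum_(i < N) `|g i| * (32 * h * A `^ (2 * H - 1)))).
  apply: (le_trans (ler_norm_sum _ _ _)); apply: ler_sum => i _.
  have -> : \sum_(j < N) g i * g j * cell (grid_cov H (ugrid h)) i j =
      g i * \sum_(0 <= j < N) cell (grid_cov H (ugrid h)) i j * g j.
    by rewrite big_mkord mulr_sumr; apply: eq_bigr => j _; ring.
  by rewrite normrM ler_wpM2l// uniform_row_bound.
rewrite -mulr_suml.
have -> : (\sum_(i < N) `|g i|) * (32 * h * A `^ (2 * H - 1)) =
  32 * A `^ (2 * H - 1) * (h * \sum_(i < N) `|g i|) by ring.
by rewrite ler_wpM2l// mulr_ge0// powR_ge0.
Qed.

End uniform_grid.

(** * Integration and mean square convergence *)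

Section measure_toolkit.
Context d (S : measurableType d) (R : realType) (mu : {measure set S -> \bar R}).

(** The integral of a nonnegative function is a supremum over the simple
    functions below it, whether or not the function is measurable. A supremum over
    an uncountable set of times need not be. *)
Lemma ge0_le_integral_nonmeas (f g : S -> \bar R) :
  (forall x, 0 <= f x)%E -> (forall x, f x <= g x)%E ->
  (\int[mu]_x f x <= \int[mu]_x g x)%E.
Proof.
move=> f0 fg; have g0 x : (0 <= g x)%E by exact: le_trans (f0 x) (fg x).
rewrite (ge0_integralTE _ f0) (ge0_integralTE _ g0).
apply: le_ereal_sup => _ [h hf <-]; exists h => //= x.
exact: le_trans (hf x) (fg x).
Qed.

(** Raising g to +oo on a null set makes the comparison pointwise. *)
Lemma ae_le_integral_nonmeas (f g : S -> \bar R) :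
  (forall x, 0 <= f x)%E -> (forall x, 0 <= g x)%E -> measurable_fun setT g ->
  {ae mu, forall x, (f x <= g x)%E} ->
  (\int[mu]_x f x <= \int[mu]_x g x)%E.
Proof.
move=> f0 g0 mg [N [mN N0 Nfg]].
pose g' x := if x \in N then +oo%E else g x.
have mg' : measurable_fun setT g'.
  apply: measurable_fun_ifT => //; apply: (@measurable_fun_bool _ _ _ _ true).
  rewrite setTI (_ : _ @^-1` _ = N)//.
  by apply/seteqP; split => [x /= /set_mem//|x Nx /=]; apply/mem_set.
apply: (@le_trans _ _ (\int[mu]_x g' x)%E).
  apply: ge0_le_integral_nonmeas => // x; rewrite /g'; case: ifPn => [_|xN].
    exact: leey.
  by apply: contrapT => /Nfg; rewrite notin_setE in xN.
rewrite le_eqVlt; apply/orP; left; apply/eqP.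
apply: ge0_ae_eq_integral => //.
  by move=> x _; rewrite /g'; case: ifP.
exists N; split => // x /= /not_implyP[_]; rewrite /g'.
by case: ifPn => //; rewrite inE.
Qed.

Lemma measurable_sqr D (X : S -> R) : measurable_fun D X ->
  measurable_fun D (fun x => (X x ^+ 2)%:E).
Proof. by move=> mX; apply/measurable_EFinP; exact: measurable_funX. Qed.

Lemma integral_sqrD D (mD : measurable D) (X Y : S -> R) :
  measurable_fun D X -> measurable_fun D Y ->
  (\int[mu]_(x in D) ((X x + Y x) ^+ 2)%:E <=
   2%:E * \int[mu]_(x in D) (X x ^+ 2)%:E + 2%:E * \int[mu]_(x in D) (Y x ^+ 2)%:E)%E.
Proof.
move=> mX mY.
have mX2 := measurable_sqr mX; have mY2 := measurable_sqr mY.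
rewrite -!ge0_integralZl//; try by move=> x _; rewrite lee_fin sqr_ge0.
rewrite -ge0_integralD//; last 4 first.
- by move=> x _; rewrite mule_ge0// lee_fin sqr_ge0.
- exact: measurable_funeM.
- by move=> x _; rewrite mule_ge0// lee_fin sqr_ge0.
- exact: measurable_funeM.
apply: ge0_le_integral => //.
- by move=> x _; rewrite lee_fin sqr_ge0.
- by apply: measurable_sqr; exact: measurable_funD.
- by apply: emeasurable_funD; exact: measurable_funeM.
- move=> x _; rewrite -!EFinM -EFinD lee_fin.
  by have := sqr_ge0 (X x - Y x); rewrite sqrrB sqrrD; nra.
Qed.

Lemma integral_sqrB D (mD : measurable D) (X Y : S -> R) :
  measurable_fun D X -> measurable_fun D Y ->
  (\int[mu]_(x in D) ((X x - Y x) ^+ 2)%:E <=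
   2%:E * \int[mu]_(x in D) (X x ^+ 2)%:E + 2%:E * \int[mu]_(x in D) (Y x ^+ 2)%:E)%E.
Proof.
move=> mX mY; have := integral_sqrD mD mX (measurable_funN mY).
by under [X in (_ <= _ + _ * X)%E -> _]eq_integral do rewrite /= sqrrN.
Qed.

Lemma integral_sqrZ D (mD : measurable D) (X : S -> R) (a : R) :
  measurable_fun D X ->
  (\int[mu]_(x in D) ((a * X x) ^+ 2)%:E =
   (a ^+ 2)%:E * \int[mu]_(x in D) (X x ^+ 2)%:E)%E.
Proof.
move=> mX; rewrite -ge0_integralZl//.
- by apply: eq_integral => x _; rewrite exprMn EFinM.
- exact: measurable_sqr.
- by move=> x _; rewrite lee_fin sqr_ge0.
- by rewrite lee_fin sqr_ge0.
Qed.

Lemma integral_gram D (mD : measurable D) n (a : 'I_n -> R) (X : 'I_n -> S -> R)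
    (g : 'I_n -> 'I_n -> R) :
  (forall i j, mu.-integrable D (fun x => (X i x * X j x)%:E)) ->
  (forall i j, \int[mu]_(x in D) (X i x * X j x)%:E = (g i j)%:E)%E ->
  (\int[mu]_(x in D) ((\sum_i a i * X i x) ^+ 2)%:E =
   (\sum_i \sum_j a i * a j * g i j)%:E)%E.
Proof.
move=> iX gX.
rewrite (eq_integral (fun x => \sum_(p : 'I_n * 'I_n)
    ((a p.1 * a p.2)%:E * (X p.1 x * X p.2 x)%:E)%E)); last first.
  move=> x _; rewrite expr2 big_distrlr/= pair_big/= -sumEFin.
  by apply: eq_bigr => p _; rewrite -EFinM; congr EFin; ring.
rewrite integral_sum//=; last by move=> p; exact: integrableZl.
rewrite pair_big/= -sumEFin; apply: eq_bigr => p _.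
by rewrite integralZl// gX -EFinM.
Qed.

Lemma nneseries_lty_cvg (y : nat -> R) : (forall n, 0 <= y n) ->
  (\sum_(0 <= n <oo) (y n)%:E < +oo)%E -> cvgn (series y).
Proof.
move=> y0 sy.
have s0 : (0 <= \sum_(0 <= n <oo) (y n)%:E)%E.
  by apply: nneseries_ge0 => n _ _; rewrite lee_fin.
have fs : (\sum_(0 <= n <oo) (y n)%:E)%E \is a fin_num by rewrite ge0_fin_numE.
apply: nondecreasing_is_cvgn.
  by apply: nondecreasing_series => n _ _.
exists (fine (\sum_(0 <= n <oo) (y n)%:E)%E) => _ [n _ <-].
rewrite -lee_fin fineK// /series/= -sumEFin.
by apply: nneseries_lim_ge => k _ _; rewrite lee_fin.
Qed.

Lemma ae_summable (Y : nat -> S -> R) :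
  (forall n, measurable_fun setT (Y n)) -> (forall n x, 0 <= Y n x) ->
  (\sum_(0 <= n <oo) \int[mu]_x (Y n x)%:E < +oo)%E ->
  {ae mu, forall x, cvgn (series (fun n => Y n x))}.
Proof.
move=> mY Y0; rewrite -integral_nneseries//; last 2 first.
- by move=> n; apply/measurable_EFinP.
- by move=> n x _; rewrite lee_fin.
move=> fin.
have mS : measurable_fun setT (fun x => (\sum_(0 <= n <oo) (Y n x)%:E)%E).
  apply: (@ge0_emeasurable_sum _ _ _ _ (fun n x => (Y n x)%:E) xpredT) => n.
    by move=> x _ _; rewrite lee_fin.
  by move=> _; exact/measurable_EFinP.
have S0 x : (0 <= \sum_(0 <= n <oo) (Y n x)%:E)%E.
  by apply: nneseries_ge0 => n _ _; rewrite lee_fin.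
have iS : mu.-integrable setT (fun x => (\sum_(0 <= n <oo) (Y n x)%:E)%E).
  apply/integrableP; split => //.
  by under eq_integral do rewrite gee0_abs//.
have := integrable_ae measurableT iS.
apply: filterS => x /(_ I) fx; apply: nneseries_lty_cvg => //.
by rewrite -ge0_fin_numE.
Qed.

Lemma ae_cvg0_of_sqr_summable (X : nat -> S -> R) :
  (forall n, measurable_fun setT (X n)) ->
  (\sum_(0 <= n <oo) \int[mu]_x (X n x ^+ 2)%:E < +oo)%E ->
  {ae mu, forall x, X n x @[n --> \oo] --> 0}.
Proof.
move=> mX fin.
have := @ae_summable (fun n x => X n x ^+ 2) (fun n => measurable_funX 2 (mX n))
  (fun n x => sqr_ge0 (X n x)) fin.
apply: filterS => x /cvg_series_cvg_0 h.
have h2 : Num.sqrt (X n x ^+ 2) @[n --> \oo] --> (0 : R).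
  rewrite -sqrtr0; apply: continuous_cvg => //; exact: sqrt_continuous.
apply/norm_cvg0P.
by under eq_fun do rewrite -sqrtr_sqr.
Qed.

Lemma fatou_le (f : nat -> S -> R) (g : S -> R) (c : \bar R) :
  (forall n, measurable_fun setT (f n)) -> measurable_fun setT g ->
  (forall n x, 0 <= f n x) -> (forall x, 0 <= g x) ->
  {ae mu, forall x, f n x @[n --> \oo] --> g x} ->
  (forall n, \int[mu]_x (f n x)%:E <= c)%E ->
  (\int[mu]_x (g x)%:E <= c)%E.
Proof.
move=> mf mg f0 g0 fg fc.
have mf' n : measurable_fun setT (fun x => (f n x)%:E) by exact/measurable_EFinP.
have f0' n x : (setT x -> 0 <= (f n x)%:E)%E by rewrite lee_fin.
have := fatou mu measurableT mf' f0'.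
set I1 := (\int[mu]_x limn_einf _)%E; set I2 := limn_einf _ => h.
apply: (@le_trans _ _ I1).
  rewrite /I1; apply: ae_le_integral_nonmeas.
  - by move=> x; rewrite lee_fin.
  - move=> x; rewrite limn_einf_lim; apply: lime_ge; first exact: is_cvg_einfs.
    by apply: nearW => n; apply: le_ereal_inf_tmp => _ [k _ <-]; rewrite lee_fin.
  - have -> : (fun x => limn_einf (fun n => (f n x)%:E)) =
        (fun x => - limn_esup (fun n => - (f n x)%:E))%E.
      apply/funext => x; have := limn_esupN (fun n => (f n x)%:E) => /= ->.
      by rewrite oppeK.
    apply: measurableT_comp => //; apply: measurable_fun_limn_esup => n.
    exact: measurableT_comp.
  - apply: filterS fg => x fgx.
    have cv : (f n x)%:E @[n --> \oo] --> (g x)%:E.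
      by apply/fine_cvgP; split; [exact: nearW|exact: fgx].
    by have [-> _] := cvg_limn_einf_sup cv.
apply: (le_trans h); rewrite /I2 limn_einf_lim; apply: lime_le.
  exact: is_cvg_einfs.
apply: nearW => n; apply: le_trans (fc n).
by apply: ereal_inf_lbound; exists n => /=.
Qed.

Lemma cvge0_lt (u : nat -> \bar R) : u n @[n --> \oo] --> 0%E ->
  forall e : R, 0 < e -> exists N, forall n, (N <= n)%N -> (u n < e%:E)%E.
Proof.
move=> u0 e e0.
have /fine_cvgP[[N1 _ fN] /cvgrPdist_lt/(_ _ e0)[N2 _ hN]] := u0.
exists (maxn N1 N2) => n; rewrite geq_max => /andP[n1 n2].
have := hN n n2; rewrite /= sub0r normrN => h.
rewrite -(fineK (fN n n1)) lte_fin; exact: le_lt_trans (ler_norm _) h.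
Qed.

Lemma cvge0P (u : nat -> \bar R) : (forall n, 0 <= u n)%E ->
  (forall e : R, 0 < e -> exists N, forall n, (N <= n)%N -> (u n <= e%:E)%E) ->
  u n @[n --> \oo] --> 0%E.
Proof.
move=> u0 h; apply/fine_cvgP; split.
  have [N hN] := h 1 ltr01; exists N => // n /= Nn.
  by rewrite ge0_fin_numE// (le_lt_trans (hN n Nn))// ltry.
apply/cvgrPdist_le => e e0; have [N hN] := h e e0.
exists N => // n /= Nn; rewrite sub0r normrN.
have un : u n \is a fin_num by rewrite ge0_fin_numE// (le_lt_trans (hN n Nn))// ltry.
by rewrite ger0_norm ?fine_ge0// -lee_fin fineK// hN.
Qed.

(** A subsequence with summable mean squares converges almost everywhere. *)
Lemma ae_cvg_subseq (X : nat -> S -> R) (W : S -> R) :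
  (forall n, measurable_fun setT (X n)) -> measurable_fun setT W ->
  (\int[mu]_x ((X n x - W x) ^+ 2)%:E)%E @[n --> \oo] --> 0%E ->
  exists phi : nat -> nat, (forall k, (k <= phi k)%N) /\
    {ae mu, forall x, X (phi k) x @[k --> \oo] --> W x}.
Proof.
move=> mX mW h.
have ch k : {N | forall n, (N <= n)%N ->
    (\int[mu]_x ((X n x - W x) ^+ 2)%:E < (2^-1 ^+ k)%:E)%E}.
  by apply/cid/(cvge0_lt h); rewrite exprn_gt0// invr_gt0.
pose phi k := (k + sval (ch k))%N; exists phi; split=> [k|]; first exact: leq_addr.
have := @ae_cvg0_of_sqr_summable (fun k x => X (phi k) x - W x)
  (fun k => measurable_funB (mX _) mW).
have fin : (\sum_(0 <= n <oo) \int[mu]_x ((X (phi n) x - W x) ^+ 2)%:E < +oo)%E.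
  apply: (@le_lt_trans _ _ (\sum_(0 <= n <oo) (2^-1 ^+ n)%:E)%E).
    apply: lee_nneseries => [n _ _|n _].
      by apply: integral_ge0 => x _; rewrite lee_fin sqr_ge0.
    by apply: ltW; apply: (svalP (ch n)); exact: leq_addl.
  apply: (@le_lt_trans _ _ 2%:E); last exact: ltry.
  apply: lime_le; first by apply: is_cvg_nneseries => n _ _; rewrite lee_fin exprn_ge0// invr_ge0.
  apply: nearW => n; rewrite sumEFin lee_fin.
  have -> : \sum_(0 <= i < n) 2^-1 ^+ i = 2 * (1 - 2^-1 ^+ n) :> R.
    elim: n => [|n IH]; first by rewrite big_geq// expr0 subrr mulr0.
    by rewrite big_nat_recr//= IH exprS; lra.
  have : 0 <= 2^-1 ^+ n :> R by rewrite exprn_ge0// invr_ge0.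
  lra.
move=> /(_ fin); apply: filterS => x hx.
have -> : (fun k => X (phi k) x) = (fun k => (X (phi k) x - W x) + W x).
  by apply/funext => k; rewrite subrK.
by rewrite -[X in _ --> X]add0r; apply: cvgD => //; exact: cvg_cst.
Qed.

Lemma sum_half_pow n : \sum_(0 <= i < n) 2^-1 ^+ i <= 2 :> R.
Proof.
have -> : \sum_(0 <= i < n) 2^-1 ^+ i = 2 * (1 - 2^-1 ^+ n) :> R.
  elim: n => [|n IH]; first by rewrite big_geq// expr0 subrr mulr0.
  by rewrite big_nat_recr//= IH exprS; lra.
have : 0 <= 2^-1 ^+ n :> R by rewrite exprn_ge0// invr_ge0.
lra.
Qed.

Lemma series_half_pow_lty : (\sum_(0 <= n <oo) (2^-1 ^+ n : R)%:E < +oo)%E.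
Proof.
apply: (@le_lt_trans _ _ 2%:E); last exact: ltry.
apply: lime_le; first by apply: is_cvg_nneseries => n _ _; rewrite lee_fin exprn_ge0// invr_ge0.
by apply: nearW => n; rewrite sumEFin lee_fin sum_half_pow.
Qed.

Lemma cvg_of_summable_increments (z y : nat -> R) :
  (forall n, `|z n.+1 - z n| <= y n) -> cvgn (series y) -> cvgn z.
Proof.
move=> zy cy.
have : cvgn (series (fun n => z n.+1 - z n)).
  have y0 n : 0 <= y n by exact: le_trans (normr_ge0 _) (zy n).
  apply: normed_cvg; exact: (series_le_cvg _ y0 zy cy).
have -> : series (fun n => z n.+1 - z n) = (fun n => z n - z 0%N).
  by apply/funext => n; rewrite /series/= telescope_sumr.
move=> /(is_cvgD (is_cvg_cst (z 0%N))).
have -> // : (fun=> z 0%N) + (fun n : nat => z n - z 0%N) = z.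
by apply/funext => n /=; rewrite addrC subrK.
Qed.

(** Along a subsequence whose successive squared distances are at most 4^(-k) the
    increments are almost everywhere summable, because |a| <= 2^(-k) + 2^k a^2.
    Fatou's lemma shows that the limit is also the mean square limit. *)
Lemma L2_complete (X : nat -> S -> R) :
  (forall n, measurable_fun setT (X n)) ->
  (forall e : R, 0 < e -> exists N, forall n m, (N <= n)%N -> (N <= m)%N ->
     (\int[mu]_x ((X n x - X m x) ^+ 2)%:E <= e%:E)%E) ->
  exists W : S -> R, measurable_fun setT W /\
    (\int[mu]_x ((X n x - W x) ^+ 2)%:E)%E @[n --> \oo] --> 0%E.
Proof.
move=> mX cauchy.
have h4 k : 0 < (4^-1 : R) ^+ k by rewrite exprn_gt0// invr_gt0.
have ch k := cid (cauchy _ (h4 k)).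
pose phi k := (\sum_(i < k.+1) (sval (ch i)).+1)%N.
have phim k : (sval (ch k) <= phi k)%N by rewrite /phi big_ord_recr/= addnS leqW// leq_addl.
have phiS k : (phi k <= phi k.+1)%N by rewrite /phi [leqRHS]big_ord_recr/= leq_addr.
pose Z k := X (phi k).
pose Y k x := 2^-1 ^+ k + 2 ^+ k * (Z k.+1 x - Z k x) ^+ 2.
have mZ k : measurable_fun setT (Z k) by exact: mX.
have mD k : measurable_fun setT (fun x => (Z k.+1 x - Z k x) ^+ 2).
  by apply: measurable_funX; exact: measurable_funB.
have cv1 : {ae mu, forall x, cvgn (series (fun k => 2 ^+ k * (Z k.+1 x - Z k x) ^+ 2))}.
  apply: (@ae_summable (fun k x => 2 ^+ k * (Z k.+1 x - Z k x) ^+ 2)).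
  - by move=> k; apply: measurable_funM => //; exact: measurable_cst.
  - by move=> k x; rewrite mulr_ge0 ?sqr_ge0// exprn_ge0.
  - apply: le_lt_trans series_half_pow_lty; apply: lee_nneseries => [k _ _|k _].
      by apply: integral_ge0 => x _; rewrite lee_fin mulr_ge0 ?sqr_ge0// exprn_ge0.
    under eq_integral do rewrite EFinM.
    have p1 x : (setT x -> 0 <= ((Z k.+1 x - Z k x) ^+ 2)%:E)%E.
      by rewrite lee_fin sqr_ge0.
    have p2 : (0 <= (2 ^+ k : R)%:E)%E by rewrite lee_fin exprn_ge0.
    have m1 : measurable_fun setT (fun x => ((Z k.+1 x - Z k x) ^+ 2)%:E).
      exact/measurable_EFinP.
    rewrite (ge0_integralZl mu measurableT m1 p1 p2).
    apply: (@le_trans _ _ ((2 ^+ k)%:E * (4^-1 ^+ k)%:E)%E).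
      apply: lee_wpmul2l; first by rewrite lee_fin exprn_ge0.
      by apply: (svalP (ch k)); rewrite ?phim// (leq_trans (phim k)).
    rewrite -EFinM lee_fin -exprMn (_ : 2 * 4^-1 = 2^-1)//; lra.
have cZ : {ae mu, forall x, cvgn (fun k => Z k x)}.
  apply: filterS cv1 => x c1.
  have c2 : cvgn (series (fun k => (2^-1 : R) ^+ k)).
    by apply: nneseries_lty_cvg series_half_pow_lty => k; rewrite exprn_ge0// invr_ge0.
  apply: (@cvg_of_summable_increments _ (fun k => Y k x)).
    move=> k; rewrite /Y; set a := Z k.+1 x - Z k x.
    have b0 : 0 < (2 : R) ^+ k by rewrite exprn_gt0.
    rewrite exprVn; set b := 2 ^+ k in b0 *.
    have : 0 <= b^-1 * (1 - b * `|a|) ^+ 2 by rewrite mulr_ge0 ?sqr_ge0// invr_ge0 ltW.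
    have -> : b^-1 * (1 - b * `|a|) ^+ 2 = b^-1 - 2 * `|a| + b * `|a| ^+ 2.
      by field; rewrite gt_eqF.
    rewrite real_normK ?num_real//; have := normr_ge0 a.
    have : 0 <= b^-1 by rewrite invr_ge0 ltW.
    have : 0 <= b * a ^+ 2 by rewrite mulr_ge0 ?sqr_ge0// ltW.
    lra.
  have -> : series (Y^~ x) = series (fun k => (2^-1 : R) ^+ k) +
      series (fun k => 2 ^+ k * (Z k.+1 x - Z k x) ^+ 2).
    by apply/funext => n; rewrite /series/= /Y big_split.
  exact: is_cvgD.
pose W x := fine (limn_esup (fun k => (Z k x)%:E)).
have mW : measurable_fun setT W.
  apply: measurableT_comp => //; apply: measurable_fun_limn_esup => k.
  exact/measurable_EFinP.
have ZW : {ae mu, forall x, Z k x @[k --> \oo] --> W x}.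
  apply: filterS cZ => x cx; rewrite /W.
  have cv : (Z k x)%:E @[k --> \oo] --> (limn (fun k => Z k x))%:E.
    by apply/fine_cvgP; split; [exact: nearW|exact: cx].
  by have [_ ->] := cvg_limn_einf_sup cv.
exists W; split => //.
apply: cvge0P => [n|e e0]; first by apply: integral_ge0 => x _; rewrite lee_fin sqr_ge0.
have [N hN] := cauchy e e0; exists N => n Nn.
apply: (@fatou_le (fun k x => (X n x - Z (N + k)%N x) ^+ 2)).
- by move=> k; apply: measurable_funX; exact: measurable_funB.
- by apply: measurable_funX; exact: measurable_funB.
- by move=> k x; exact: sqr_ge0.
- by move=> x; exact: sqr_ge0.
- apply: filterS ZW => x zx.
  have c : X n x - Z (N + k)%N x @[k --> \oo] --> X n x - W x.
    apply: cvgB; first exact: cvg_cst.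
    under eq_fun do rewrite addnC.
    by have := zx; rewrite -(cvg_shiftn N).
  under eq_fun do rewrite expr2.
  rewrite expr2; exact: (cvgM c c).
- move=> k; apply: hN => //.
  suff : (N + k <= phi (N + k))%N by apply: leq_trans; exact: leq_addr.
  elim: (N + k)%N => [//|j IH]; rewrite /phi big_ord_recr/= -/(phi j) addnS ltnS.
  exact: leq_trans (leq_addr _ _).
Qed.

End measure_toolkit.

(** * Moments of Gaussian variables *)

Section gaussian_moments.
Context {R : realType}.
Local Notation leb := (@lebesgue_measure R).

Lemma integral_normal_prob (m s : R) (f : R -> \bar R) : s != 0 ->
  measurable_fun setT f -> (forall x, 0 <= f x)%E ->
  (\int[normal_prob m s]_x f x = \int[leb]_x (f x * (normal_pdf m s x)%:E))%E.
Proof.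
move=> s0 mf f0.
have dom := normal_prob_dominates m s.
rewrite -(Radon_Nikodym_SigmaFinite.change_of_variables dom f0 measurableT mf).
have mp : measurable_fun setT (fun x => (normal_pdf m s x)%:E).
  by apply/measurable_EFinP; exact: measurable_normal_pdf.
have ig := Radon_Nikodym_SigmaFinite.f_integrable dom.
apply: ae_eq_integral => //.
- apply: emeasurable_funM => //; exact: (measurable_int _ ig).
- exact: emeasurable_funM.
- apply: ae_eqe_mul2l; apply: integral_ae_eq => //.
  by move=> E _ mE; rewrite -Radon_Nikodym_SigmaFinite.f_integral.
Qed.

(** From 1 + x / k <= exp (x / k). *)
Lemma expR_ge_pow k (x : R) : 0 <= x -> (0 < k)%N -> x ^+ k <= k%:R ^+ k * expR x.
Proof.
move=> x0 k0; have k0' : 0 < k%:R :> R by rewrite ltr0n.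
have -> : expR x = expR (x / k%:R) ^+ k.
  by rewrite -expRM_natl mulr_natl -mulr_natr divfK// gt_eqF.
rewrite -exprMn; apply: lerXn2r; rewrite ?nnegrE//.
rewrite -ler_pdivrMl// mulrC.
by apply: le_trans (expR_ge1Dx _); lra.
Qed.

Lemma normal_peak_scale (s : R) : normal_peak (2 * s) = normal_peak s / 2.
Proof.
rewrite /normal_peak -invfM; congr (_^-1).
have -> : (2 * s) ^+ 2 * pi *+ 2 = 2 ^+ 2 * (s ^+ 2 * pi *+ 2).
  by rewrite exprMn; move: (@pi R) => p; ring.
by rewrite sqrtrM ?sqr_ge0// sqrtr_sqr ger0_norm// mulrC.
Qed.

(** With y = (x - m)^2 / s^2, doubling the deviation leaves a factor exp (3 y / 8)
    of room, which absorbs the polynomial. *)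
Lemma normal_pdf_moment_le k (m s x : R) : s != 0 -> (0 < k)%N ->
  (x - m) ^+ (k.*2) * normal_pdf m s x <=
    (2 * (4 * k%:R) ^+ k * s ^+ k.*2) * normal_pdf m (2 * s) x.
Proof.
move=> s0 k0; have s2 : 0 < s ^+ 2 by rewrite exprn_even_gt0.
rewrite !normal_pdfE ?mulf_neq0// normal_peak_scale.
set p := normal_peak s; have p0 : 0 <= p by exact: normal_peak_ge0.
rewrite /normal_fun; set y := (x - m) ^+ 2 / s ^+ 2.
have y0 : 0 <= y by rewrite divr_ge0 ?sqr_ge0.
have -> : - (x - m) ^+ 2 / (s ^+ 2 *+ 2) = - (y / 2).
  by rewrite /y -mulr_natr; field.
have -> : - (x - m) ^+ 2 / ((2 * s) ^+ 2 *+ 2) = - (y / 8).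
  by rewrite /y -mulr_natr; field.
have xm : (x - m) ^+ k.*2 = y ^+ k * s ^+ k.*2.
  by rewrite -!mul2n !exprM /y expr_div_n divfK// expf_neq0// gt_eqF.
rewrite xm.
have h := @expR_ge_pow k (y / 4) (divr_ge0 y0 (ler0n R 4)) k0.
have {}h : y ^+ k <= (4 * k%:R) ^+ k * expR (y / 4).
  rewrite expr_div_n ler_pdivrMr ?exprn_gt0// in h.
  by apply: (le_trans h); rewrite exprMn; lra.
have -> : expR (- (y / 8)) = expR (- (y / 2)) * expR (y / 4) * expR (y / 8).
  by rewrite -!expRD; congr expR; lra.
have e1 : 1 <= expR (y / 8) by apply: le_trans (expR_ge1Dx _); lra.
have sk : 0 <= s ^+ k.*2 by rewrite exprn_even_ge0// odd_double.
have e2 := expR_ge0 (- (y / 2)).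
have -> : 2 * (4 * k%:R) ^+ k * s ^+ k.*2 *
    (p / 2 * (expR (- (y / 2)) * expR (y / 4) * expR (y / 8))) =
  (s ^+ k.*2 * (p * expR (- (y / 2)))) *
  (((4 * k%:R) ^+ k * expR (y / 4)) * expR (y / 8)) by lra.
have -> : y ^+ k * s ^+ k.*2 * (p * expR (- (y / 2))) =
  (s ^+ k.*2 * (p * expR (- (y / 2)))) * y ^+ k by lra.
apply: ler_wpM2l; first by rewrite !mulr_ge0.
by apply: (le_trans h); rewrite ler_peMr// mulr_ge0 ?expR_ge0.
Qed.

Lemma normal_central_moment k (m s : R) : s != 0 -> (0 < k)%N ->
  (\int[normal_prob m s]_x ((x - m) ^+ k.*2)%:E <=
    (2 * (4 * k%:R) ^+ k * s ^+ k.*2)%:E)%E.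
Proof.
move=> s0 k0.
have mX : measurable_fun setT (fun x : R => ((x - m) ^+ k.*2)%:E).
  by apply/measurable_EFinP; apply: measurable_funX; exact: measurable_funB.
rewrite integral_normal_prob//; last first.
  by move=> x; rewrite lee_fin exprn_even_ge0// odd_double.
have C0 : 0 <= 2 * (4 * k%:R) ^+ k * s ^+ k.*2.
  by rewrite mulr_ge0// exprn_even_ge0// odd_double.
apply: (@le_trans _ _ (\int[leb]_x ((2 * (4 * k%:R) ^+ k * s ^+ k.*2)%:E *
    (normal_pdf m (2 * s) x)%:E))%E).
  apply: ge0_le_integral => //.
  - move=> x _; rewrite -EFinM lee_fin mulr_ge0 ?normal_pdf_ge0//.
    by rewrite exprn_even_ge0// odd_double.
  - apply: emeasurable_funM => //; apply/measurable_EFinP; exact: measurable_normal_pdf.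
  - by apply: measurable_funeM; apply/measurable_EFinP; exact: measurable_normal_pdf.
  - by move=> x _; rewrite -!EFinM lee_fin normal_pdf_moment_le.
rewrite ge0_integralZl//; last 2 first.
- by apply/measurable_EFinP; exact: measurable_normal_pdf.
- by move=> x _; rewrite lee_fin normal_pdf_ge0.
by rewrite integral_normal_pdf mule1.
Qed.

(** A lower bound for the mass of an interval of half a deviation on which the
    density is at least its peak divided by e. *)
Definition normal_mass : R := (Num.sqrt (pi *+ 2))^-1 * expR (- 1) / 2.

Lemma normal_mass_gt0 : 0 < normal_mass.
Proof.
rewrite /normal_mass divr_gt0// mulr_gt0 ?expR_gt0// invr_gt0 sqrtr_gt0.
by rewrite pmulrn_lgt0// pi_gt0.
Qed.

(** An interval of half a deviation on the side of the mean away from 0 is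
    enough: there x^2 is at least m^2 + s^2 / 4. The point is that the second
    moment controls the mean as well as the deviation. *)
Lemma normal_second_moment_ge (m s : R) : s != 0 ->
  ((normal_mass * (m ^+ 2 + s ^+ 2 / 4))%:E <=
    \int[normal_prob m s]_x (x ^+ 2)%:E)%E.
Proof.
move=> s0.
have mX : measurable_fun setT (fun x : R => (x ^+ 2)%:E).
  by apply/measurable_EFinP; exact: measurable_funX.
rewrite integral_normal_prob//; last by move=> x; rewrite lee_fin sqr_ge0.
pose r := `|s|; have r0 : 0 < r by rewrite normr_gt0.
have rs : r ^+ 2 = s ^+ 2 by rewrite real_normK// num_real.
pose a := if 0 <= m then m + r / 2 else m - r.
pose A := `[a, a + r / 2]%classic : set R.
have mA : measurable A by exact: measurable_itv.
have inA x : A x -> m ^+ 2 + s ^+ 2 / 4 <= x ^+ 2 /\ (x - m) ^+ 2 <= s ^+ 2.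
  rewrite /A /= in_itv/= /a -rs => /andP[].
  by case: ifPn => m0 h1 h2; [|rewrite -ltNge in m0]; split; nra.
pose c := (m ^+ 2 + s ^+ 2 / 4) * (normal_peak s * expR (- 1)).
have c0 : 0 <= c.
  rewrite mulr_ge0 ?addr_ge0 ?sqr_ge0 ?divr_ge0 ?sqr_ge0//.
  by rewrite mulr_ge0 ?normal_peak_ge0 ?expR_ge0.
apply: (@le_trans _ _ (\int[leb]_(x in A) c%:E)%E).
  rewrite integral_cst//= /A lebesgue_measure_itv/= lte_fin ltrDl.
  rewrite divr_gt0// -EFinD -EFinM lee_fin.
  have -> : a + r / 2 - a = r / 2 by ring.
  rewrite /c /normal_mass /normal_peak.
  have -> : s ^+ 2 * pi *+ 2 = r ^+ 2 * (pi *+ 2) by rewrite rs -mulrnAr.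
  rewrite sqrtrM ?sqr_ge0// sqrtr_sqr ger0_norm ?(ltW r0)//.
  have q0 : Num.sqrt (pi *+ 2) != 0 :> R.
    by rewrite gt_eqF// sqrtr_gt0 pmulrn_lgt0// pi_gt0.
  rewrite le_eqVlt; apply/orP; left; apply/eqP; field.
  by rewrite q0 gt_eqF.
have mp : measurable_fun setT (fun x => (normal_pdf m s x)%:E).
  by apply/measurable_EFinP; exact: measurable_normal_pdf.
apply: (@le_trans _ _ (\int[leb]_(x in A) ((x ^+ 2)%:E * (normal_pdf m s x)%:E))%E).
  apply: ge0_le_integral => //.
  - by apply: measurable_funTS; exact: emeasurable_funM.
  - move=> x Ax; rewrite -EFinM lee_fin /c.
    have [h1 h2] := inA x Ax.
    apply: ler_pM => //.
    + by rewrite addr_ge0 ?sqr_ge0 ?divr_ge0 ?sqr_ge0.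
    + by rewrite mulr_ge0 ?normal_peak_ge0 ?expR_ge0.
    rewrite normal_pdfE//; apply: ler_wpM2l; first exact: normal_peak_ge0.
    rewrite /normal_fun ler_expR mulNr lerN2 ler_pdivrMr.
      by rewrite mul1r (le_trans h2)// mulr2n lerDl sqr_ge0.
    by rewrite pmulrn_lgt0// exprn_even_gt0.
apply: ge0_subset_integral => //.
- exact: emeasurable_funM.
- by move=> x _; rewrite -EFinM lee_fin mulr_ge0 ?sqr_ge0 ?normal_pdf_ge0.
Qed.

End gaussian_moments.

Section gaussian_rv.
Context d (Omega : measurableType d) (R : realType) (P : probability Omega R).

Lemma integral_law (X : Omega -> R) (nu : {measure set (measurableTypeR R) -> \bar R})
    (f : R -> R) :
  measurable_fun setT X -> (forall A : set R, measurable A -> P (X @^-1` A) = nu A) ->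
  measurable_fun setT f -> (forall x, 0 <= f x) ->
  (\int[P]_w (f (X w))%:E = \int[nu]_x (f x)%:E)%E.
Proof.
move=> mX law mf f0.
have mX' : measurable_fun setT (X : Omega -> measurableTypeR R) by exact: mX.
have mf' : measurable_fun setT (f : measurableTypeR R -> R) by exact: mf.
have := @ge0_integral_pushforward _ _ _ _ R _ mX' P setT (fun x => (f x)%:E) measurableT.
rewrite preimage_setT => <-.
- by apply: eq_measure_integral => A mA _; rewrite /pushforward -law.
- exact/measurable_EFinP.
- by move=> x _; rewrite lee_fin.
Qed.

Lemma expr_addr_le k (a b : R) : (a + b) ^+ k.*2 <= 4 ^+ k * (a ^+ k.*2 + b ^+ k.*2).
Proof.
have h : (a + b) ^+ 2 <= 4 * Num.max (a ^+ 2) (b ^+ 2).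
  have ab : (a + b) ^+ 2 <= 2 * (a ^+ 2 + b ^+ 2).
    by have := sqr_ge0 (a - b); rewrite sqrrB sqrrD; lra.
  have : a ^+ 2 <= Num.max (a ^+ 2) (b ^+ 2) by rewrite le_max lexx.
  have : b ^+ 2 <= Num.max (a ^+ 2) (b ^+ 2) by rewrite le_max lexx orbT.
  lra.
rewrite -!mul2n !exprM; apply: (@le_trans _ _ ((4 * Num.max (a ^+ 2) (b ^+ 2)) ^+ k)).
  by apply: lerXn2r; rewrite ?nnegrE ?sqr_ge0// mulr_ge0// le_max sqr_ge0.
rewrite exprMn ler_wpM2l ?exprn_ge0//.
by have [_|_] := leP (a ^+ 2) (b ^+ 2); [rewrite lerDr|rewrite lerDl]; rewrite exprn_ge0// sqr_ge0.
Qed.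

(** The law may have a mean: the second moment bounds both the mean and the
    deviation, and these bound every even moment. *)
Lemma gaussian_moment k : (0 < k)%N -> exists C : R, 0 < C /\
  forall (X : Omega -> R) (v : R), measurable_fun setT X -> gaussian P X ->
  (\int[P]_w (X w ^+ 2)%:E <= v%:E)%E ->
  (\int[P]_w (X w ^+ k.*2)%:E <= (C * v ^+ k)%:E)%E.
Proof.
move=> k0; pose q : R := @normal_mass R; have q0 : 0 < q by exact: normal_mass_gt0.
pose Ck : R := 2 * (4 * k%:R) ^+ k.
have Ck0 : 0 <= Ck by rewrite mulr_ge0// exprn_ge0// mulr_ge0.
exists (1 + 4 ^+ k * ((1 + Ck) * (4 / q) ^+ k)); split.
  by rewrite ltr_wpDr// !mulr_ge0 ?exprn_ge0 ?addr_ge0 ?divr_ge0 ?(ltW q0).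
move=> X v mX [m [s law]] hv.
have mk n : measurable_fun setT (fun x : R => x ^+ n) by exact: measurable_funX.
have ek (x : R) : 0 <= x ^+ k.*2 by rewrite exprn_even_ge0// odd_double.
have [s0|s0] := eqVneq s 0.
  rewrite s0 eqxx in law.
  have iE (f : R -> R) : measurable_fun setT f -> (forall x : R, 0 <= f x) ->
      (\int[P]_w (f (X w))%:E = (f m)%:E)%E.
    move=> mf f0; rewrite (@integral_law X (@dirac _ (measurableTypeR R) m R) _ mX law mf f0) integral_dirac//.
      by rewrite diracT mul1e.
    exact/measurable_EFinP.
  rewrite (iE _ (mk 2%N)) in hv; last by move=> x; exact: sqr_ge0.
  rewrite (iE _ (mk k.*2))// lee_fin.
  rewrite lee_fin in hv; rewrite -mul2n exprM.
  have h : (m ^+ 2) ^+ k <= v ^+ k.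
    by apply: lerXn2r; rewrite ?nnegrE ?sqr_ge0// (le_trans (sqr_ge0 m)).
  have v0 : 0 <= v ^+ k by apply: le_trans h; rewrite exprn_ge0// sqr_ge0.
  apply: (le_trans h); rewrite ler_peMl// lerDl.
  by rewrite !mulr_ge0 ?exprn_ge0 ?addr_ge0 ?divr_ge0 ?(ltW q0).
rewrite (negbTE s0) in law.
pose nu0 : {measure set (measurableTypeR R) -> \bar R} := normal_prob m s.
have law' (A : set R) : measurable A -> P (X @^-1` A) = nu0 A by exact: law.
rewrite (integral_law mX law' (mk 2%N)) in hv; last by move=> x; exact: sqr_ge0.
rewrite (integral_law mX law' (mk k.*2))//.
have := le_trans (normal_second_moment_ge m s0) hv.
rewrite lee_fin -/q => hq.
have hq' : m ^+ 2 + s ^+ 2 / 4 <= v / q by rewrite ler_pdivlMr// mulrC.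
have m2 := sqr_ge0 m; have s2 := sqr_ge0 s.
have mb : m ^+ k.*2 <= (4 / q) ^+ k * v ^+ k.
  rewrite -exprMn -mul2n exprM; apply: lerXn2r; rewrite ?nnegrE//.
    by rewrite mulrAC -mulrA mulr_ge0//; lra.
  rewrite mulrAC -mulrA; lra.
have sb : s ^+ k.*2 <= (4 / q) ^+ k * v ^+ k.
  rewrite -exprMn -mul2n exprM; apply: lerXn2r; rewrite ?nnegrE//.
    by rewrite mulrAC -mulrA mulr_ge0//; lra.
  rewrite mulrAC -mulrA; lra.
have mm : measurable_fun setT (fun x : R => ((x - m) ^+ k.*2)%:E).
  by apply/measurable_EFinP; apply: measurable_funX; exact: measurable_funB.
apply: (@le_trans _ _ (\int[normal_prob m s]_x
   ((4 ^+ k)%:E * ((x - m) ^+ k.*2)%:E + (4 ^+ k * m ^+ k.*2)%:E))%E).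
  apply: ge0_le_integral => //.
  - by move=> x _; rewrite lee_fin.
  - exact/measurable_EFinP.
  - by apply: emeasurable_funD => //; exact: measurable_funeM.
  - move=> x _; rewrite -EFinM -EFinD lee_fin -mulrDr.
    by have := expr_addr_le k (x - m) m; rewrite subrK.
rewrite ge0_integralD//; last 3 first.
- by move=> x _; rewrite -EFinM lee_fin mulr_ge0// exprn_ge0.
- exact: measurable_funeM.
- by move=> x _; rewrite lee_fin mulr_ge0// exprn_ge0.
rewrite ge0_integralZl//; last by move=> x _; rewrite lee_fin.
have nT : normal_prob m s setT = 1%E by exact: integral_normal_pdf.
rewrite integral_cst//= nT mule1.
apply: (@le_trans _ _ ((4 ^+ k)%:E * (Ck * s ^+ k.*2)%:E + (4 ^+ k * m ^+ k.*2)%:E)%E).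
  apply: leeD => //; apply: lee_wpmul2l; first by rewrite lee_fin exprn_ge0.
  exact: normal_central_moment.
rewrite -EFinM -EFinD lee_fin -mulrDr mulrDl mul1r -!mulrA.
have p4 : 0 <= 4 ^+ k :> R by rewrite exprn_ge0.
have vq : 0 <= v ^+ k.
  rewrite exprn_ge0//; rewrite ler_pdivlMr// in hq'; apply: le_trans hq'.
  by rewrite mulr_ge0 ?(ltW q0)//; lra.
apply: (@le_trans _ _ (4 ^+ k * ((1 + Ck) * ((4 / q) ^+ k * v ^+ k)))); last by rewrite lerDr.
apply: ler_wpM2l => //; have := ler_wpM2l Ck0 sb; move: mb; rewrite /Ck.
move: ((4 * k%:R) ^+ k) (s ^+ k.*2) (m ^+ k.*2) ((4 / q) ^+ k) (v ^+ k) => *; lra.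
Qed.

End gaussian_rv.

(** * Elementary functions *)

Section elementary.
Context {R : realType}.
Local Notation leb := (@lebesgue_measure R).
Local Notation leb2 := (leb \x leb)%E.

Definition tdom (T : R) : set (R * R) := `[0, T]%classic `*` dom.

Lemma measurable_dom : measurable (dom : set (measurableTypeR R)).
Proof. exact: measurable_itv. Qed.

Lemma measurable_tdom (T : R) :
  measurable (tdom T : set (measurableTypeR R * measurableTypeR R)).
Proof. by apply: measurableX; [exact: measurable_itv|exact: measurable_dom]. Qed.

Definition L2sq (T : R) (f : R * R -> R) : \bar R :=
  (\int[leb2]_(u in tdom T) (f u ^+ 2)%:E)%E.

Lemma L2sq_ge0 T f : (0 <= L2sq T f)%E.
Proof. by apply: integral_ge0 => u _; rewrite lee_fin sqr_ge0. Qed.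

Lemma leb2_tdom (T : R) : 0 <= T -> leb2 (tdom T) = (T * pi)%:E.
Proof.
move=> T0; rewrite /tdom product_measure1E; last 2 first.
- exact: measurable_itv.
- exact: measurable_dom.
rewrite /dom /= !lebesgue_measure_itv/= !lte_fin pi_gt0 -EFinB subr0.
have [T0'|T0'] := ltP 0 T; first by rewrite -EFinB subr0.
by have -> : T = 0 by [apply/eqP; rewrite eq_le T0 T0']; rewrite mul0e mul0r.
Qed.

Definition rect (p : R * R) : set (R * R) := `[0, p.1] `*` `[0, p.2].

Lemma measurable_rect p :
  measurable (rect p : set (measurableTypeR R * measurableTypeR R)).
Proof. by apply: measurableX; exact: measurable_itv. Qed.

Lemma leb2_rectI (T : R) (p q : R * R) :
  0 <= p.1 <= T -> 0 < p.2 < pi -> 0 <= q.1 <= T -> 0 < q.2 < pi ->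
  leb2 (rect p `&` rect q `&` tdom T) = (Num.min p.1 q.1 * Num.min p.2 q.2)%:E.
Proof.
move=> /andP[p1 p1T] /andP[p2 p2pi] /andP[q1 q1T] /andP[q2 q2pi].
have -> : rect p `&` rect q `&` tdom T =
    `[0, Num.min p.1 q.1]%classic `*` `]0, Num.min p.2 q.2]%classic.
  apply/seteqP; split => -[s y]; rewrite /rect /tdom /dom /= !in_itv/= !le_min.
    by move=> [[[/andP[-> ->] /andP[_ ->]] [/andP[_ ->] /andP[_ ->]]] [_ /andP[-> _]]].
  move=> [/andP[s0 /andP[s1 s2]] /andP[y0 /andP[y1 y2]]].
  rewrite s0 s1 s2 y0 y1 y2 (ltW y0) (le_trans s1 p1T)//; do ?split => //.
  exact: le_lt_trans y1 p2pi.
rewrite product_measure1E; [|exact: measurable_itv|exact: measurable_itv].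
rewrite /= !lebesgue_measure_itv/= !lte_fin -!EFinB !subr0.
have m2 : 0 < Num.min p.2 q.2 by rewrite lt_min p2 q2.
rewrite m2; have [m1|m1] := ltP 0 (Num.min p.1 q.1); first by rewrite -EFinM.
have -> : Num.min p.1 q.1 = 0.
  by apply/eqP; rewrite eq_le m1 le_min p1 q1.
by rewrite mul0e mul0r.
Qed.

Definition enth (e : elem R) (i : nat) : R * (R * R) := nth (0, (0, 0)) e i.

Lemma enth_in (T : R) (e : elem R) (i : 'I_(size e)) : elem_in T e ->
  0 <= (enth e i).2.1 <= T /\ 0 < (enth e i).2.2 < pi.
Proof. by move=> eT; apply: eT; exact: mem_nth. Qed.

Lemma elem_funE (e : elem R) u :
  elem_fun e u = \sum_(i < size e) (enth e i).1 * \1_(rect (enth e i).2) u.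
Proof. by rewrite /elem_fun (big_nth (0, (0, 0))) big_mkord. Qed.

Lemma measurable_elem_fun (e : elem R) D :
  measurable_fun D (elem_fun e : measurableTypeR R * measurableTypeR R -> R).
Proof.
have -> : elem_fun e = (fun u => \sum_(c <- e) c.1 * \1_(rect c.2) u) by [].
apply: measurable_sum => c; apply: measurable_funM; first exact: measurable_cst.
by apply: measurable_indic; exact: measurable_rect.
Qed.

Lemma L2sq_elem_fun (T : R) (e : elem R) : elem_in T e ->
  L2sq T (elem_fun e) = (\sum_(c <- e) \sum_(c' <- e) c.1 * c'.1 *
    (Num.min c.2.1 c'.2.1 * Num.min c.2.2 c'.2.2))%:E.
Proof.
move=> eT; rewrite /L2sq.
under eq_integral do rewrite elem_funE.
have mrI i j : measurable (rect (enth e i).2 `&` rect (enth e j).2 :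
    set (measurableTypeR R * measurableTypeR R)).
  by apply: measurableI; exact: measurable_rect.
rewrite (@integral_gram _ _ _ leb2 (tdom T) (measurable_tdom T) (size e)
  (fun i => (enth e i).1) (fun i => \1_(rect (enth e i).2))
  (fun i j => Num.min (enth e i).2.1 (enth e j).2.1 *
              Num.min (enth e i).2.2 (enth e j).2.2)).
- rewrite [in RHS](big_nth (0, (0, 0))) big_mkord; congr EFin.
  apply: eq_bigr => i _; rewrite (big_nth (0, (0, 0))) big_mkord.
  by apply: eq_bigr => j _.
- move=> i j.
  have [i1 i2] := enth_in i eT; have [j1 j2] := enth_in j eT.
  have -> : (fun x => (\1_(rect (enth e i).2) x * \1_(rect (enth e j).2) x : R)%:E) =
      (fun x => (\1_(rect (enth e i).2 `&` rect (enth e j).2) x : R)%:E).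
    by apply/funext => x; rewrite indicI.
  apply/integrableP; split.
    by apply/measurable_EFinP; apply: measurable_indic; exact: mrI.
  under eq_integral do rewrite gee0_abs ?lee_fin//.
  rewrite integral_indic//; last exact: measurable_tdom.
  apply: (@le_lt_trans _ _ (Num.min (enth e i).2.1 (enth e j).2.1 *
    Num.min (enth e i).2.2 (enth e j).2.2)%:E); last exact: ltry.
  by rewrite -(leb2_rectI i1 i2 j1 j2).
- move=> i j.
  have [i1 i2] := enth_in i eT; have [j1 j2] := enth_in j eT.
  transitivity (\int[leb2]_(u in tdom T)
      (\1_(rect (enth e i).2 `&` rect (enth e j).2) u)%:E)%E.
    by apply: eq_integral => u _; rewrite indicI.
  rewrite integral_indic//; [exact: leb2_rectI|exact: measurable_tdom].
Qed.

Definition elem_scale (a : R) (e : elem R) : elem R := [seq (a * c.1, c.2) | c <- e].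

Lemma elem_in_scale (T a : R) e : elem_in T e -> elem_in T (elem_scale a e).
Proof. by move=> eT _ /mapP[c ce ->] /=; exact: eT. Qed.

Lemma elem_in_cat (T : R) (e1 e2 : elem R) : elem_in T e1 -> elem_in T e2 -> elem_in T (e1 ++ e2).
Proof. by move=> h1 h2 c; rewrite mem_cat => /orP[/h1|/h2]. Qed.

Lemma elem_fun_scale a e u : elem_fun (elem_scale a e) u = a * elem_fun e u.
Proof.
rewrite /elem_fun /elem_scale big_map mulr_sumr.
by apply: eq_bigr => c _; rewrite mulrA.
Qed.

Lemma elem_fun_cat (e1 e2 : elem R) u : elem_fun (e1 ++ e2) u = elem_fun e1 u + elem_fun e2 u.
Proof. by rewrite /elem_fun big_cat. Qed.

Lemma elem_int_scale (Omega : Type) (B : R -> R -> Omega -> R) a e w :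
  elem_int B (elem_scale a e) w = a * elem_int B e w.
Proof.
rewrite /elem_int /elem_scale big_map mulr_sumr.
by apply: eq_bigr => c _; rewrite mulrA.
Qed.

Lemma elem_int_cat (Omega : Type) (B : R -> R -> Omega -> R) e1 e2 w :
  elem_int B (e1 ++ e2) w = elem_int B e1 w + elem_int B e2 w.
Proof. by rewrite /elem_int big_cat. Qed.

End elementary.

(** * The Wiener integral *)

Section sheet.
Context d (Omega : measurableType d) (R : realType) (P : probability Omega R)
  (T H1 H2 : R) (B : R -> R -> {RV P >-> R}).
Hypotheses (hT : 0 < T) (hH1 : 2^-1 <= H1 < 1) (hH2 : 2^-1 <= H2 < 1)
  (hB : fractional_brownian_sheet T H1 H2 B).
Local Notation leb2 := ((@lebesgue_measure R) \x (@lebesgue_measure R))%E.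
Local Notation eint := (elem_int (fun t x w => B t x w)).
Local Notation wint := (wiener_integral P T (fun t x w => B t x w)).

Lemma measurable_elem_int (e : elem R) : measurable_fun setT (eint e).
Proof.
rewrite /elem_int; apply: measurable_sum => c.
by apply: measurable_funM => //; exact: measurable_cst.
Qed.

Lemma integrable_of_finite_integral (f : Omega -> R) (r : R) :
  measurable_fun setT f -> (\int[P]_w (f w)%:E = r%:E)%E ->
  P.-integrable setT (fun w => (f w)%:E).
Proof.
move=> mf fr; have mf' : measurable_fun setT (fun w => (f w)%:E) by exact/measurable_EFinP.
apply/integrableP; split => //.
by apply/abse_integralP => //; rewrite fr/= ltry.
Qed.

Lemma elem_int_msq (e : elem R) : elem_in T e ->
  (\int[P]_w (eint e w ^+ 2)%:E = (\sum_(c <- e) \sum_(c' <- e) c.1 * c'.1 *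
    (4^-1 * (fbm_cov H1 c.2.1 c'.2.1 * fbm_cov H2 c.2.2 c'.2.2)))%:E)%E.
Proof.
move=> eT; have [_ _ cov _] := hB.
have eE w : eint e w = \sum_(i < size e) (enth e i).1 * B (enth e i).2.1 (enth e i).2.2 w.
  by rewrite /elem_int (big_nth (0, (0, 0))) big_mkord.
under eq_integral do rewrite eE.
have covE (i j : 'I_(size e)) : (\int[P]_w (B (enth e i).2.1 (enth e i).2.2 w *
    B (enth e j).2.1 (enth e j).2.2 w)%:E = (4^-1 *
    (fbm_cov H1 (enth e i).2.1 (enth e j).2.1 *
     fbm_cov H2 (enth e i).2.2 (enth e j).2.2))%:E)%E.
  have [i1 i2] := enth_in i eT; have [j1 j2] := enth_in j eT.
  by have := cov _ _ _ _ i1 j1 i2 j2; rewrite unlock => ->; rewrite mulrA.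
rewrite (@integral_gram _ _ _ P setT measurableT (size e)
  (fun i => (enth e i).1) (fun i => B (enth e i).2.1 (enth e i).2.2) _ _ covE).
- rewrite [in RHS](big_nth (0, (0, 0))) big_mkord; congr EFin.
  apply: eq_bigr => i _; rewrite (big_nth (0, (0, 0))) big_mkord.
  by apply: eq_bigr => j _.
- move=> i j; apply: integrable_of_finite_integral (covE i j).
  exact: measurable_funM.
Qed.

(** The factor 4^-1 normalizes the covariance of the sheet; the two others bound
    the row sums in time and in space. *)
Definition wiener_const : R :=
  4^-1 * ((4 * H1 * T `^ (2 * H1 - 1)) * (4 * H2 * pi `^ (2 * H2 - 1))).

Lemma wiener_const_ge0 : 0 <= wiener_const.
Proof.
rewrite /wiener_const; have := powR_ge0 T (2 * H1 - 1).
have := powR_ge0 (@pi R) (2 * H2 - 1) => h1 h2.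
have /andP[a1 _] := hH1; have /andP[a2 _] := hH2.
by apply: mulr_ge0; [lra|apply: mulr_ge0; apply: mulr_ge0 => //; lra].
Qed.

Lemma elem_int_le (e : elem R) : elem_in T e ->
  (\int[P]_w (eint e w ^+ 2)%:E <= wiener_const%:E * L2sq T (elem_fun e))%E.
Proof.
move=> eT; rewrite elem_int_msq// L2sq_elem_fun// -EFinM lee_fin.
have [h1 _] := andP hH1; have [h2 _] := andP hH2.
have := fbm_form_le_min h1 h2 (ltW hT) eT.
rewrite /wiener_const -[leRHS]mulrA => /(ler_wpM2l (_ : 0 <= 4^-1)) => /(_ ltac:(lra)).
rewrite -!mulrA; congr (_ <= _).
rewrite mulr_sumr; apply: eq_bigr => c _; rewrite mulr_sumr; apply: eq_bigr => c' _; ring.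
Qed.

Lemma measurable_wint_integrand f W : wint f W ->
  measurable_fun (tdom T) (f : measurableTypeR R * measurableTypeR R -> R).
Proof. by case. Qed.

Lemma wint_elem (e : elem R) : elem_in T e -> wint (elem_fun e) (eint e).
Proof.
move=> eT; split.
- exact: (@measurable_elem_fun R e (tdom T)).
- exact: measurable_elem_int.
- exists (fun=> e); split => //.
  + under eq_fun do under eq_integral do rewrite subrr expr0n/=.
    by under eq_fun do rewrite integral0; exact: cvg_cst.
  + under eq_fun do under eq_integral do rewrite subrr expr0n/=.
    by under eq_fun do rewrite integral0; exact: cvg_cst.
Qed.

(** The factor 4 comes from (a + b)^2 <= 2 a^2 + 2 b^2, used once for the
    variables and once for the integrands. *)
Lemma wint_bound f W : wint f W ->
  (\int[P]_w (W w ^+ 2)%:E <= (4 * wiener_const)%:E * L2sq T f)%E.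
Proof.
move=> hW; have mf := measurable_wint_integrand hW.
case: hW => _ mW [e [eT ef eW]].
have C0 := wiener_const_ge0.
have bnd n : (\int[P]_w (W w ^+ 2)%:E <= 2%:E * \int[P]_w ((eint (e n) w - W w) ^+ 2)%:E +
    2%:E * (wiener_const%:E * (2%:E * L2sq T (fun u => elem_fun (e n) u - f u)%R + 2%:E * L2sq T f)))%E.
  have mE := measurable_elem_int (e n).
  apply: (@le_trans _ _ (2%:E * \int[P]_w ((eint (e n) w - W w) ^+ 2)%:E +
      2%:E * \int[P]_w (eint (e n) w ^+ 2)%:E)%E).
    have := @integral_sqrB _ _ _ P setT measurableT
      (fun w => eint (e n) w - W w) (eint (e n)) (measurable_funB mE mW) mE.
    apply: le_trans; rewrite le_eqVlt; apply/orP; left; apply/eqP.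
    by apply: eq_integral => w _; congr EFin; ring.
  apply: leeD => //; apply: lee_wpmul2l => //.
  apply: (le_trans (elem_int_le (eT n))); apply: lee_wpmul2l; first by rewrite lee_fin.
  have mF := @measurable_elem_fun R (e n) (tdom T).
  have := @integral_sqrD _ _ _ leb2 (tdom T) (measurable_tdom T)
      (fun u => elem_fun (e n) u - f u) f (measurable_funB mF mf) mf.
  by apply: le_trans; rewrite le_eqVlt; apply/orP; left; apply/eqP;
    apply: eq_integral => u _; rewrite subrK.
have [finf|] := boolP (L2sq T f \is a fin_num); last first.
  rewrite ge0_fin_numE ?L2sq_ge0// -leNgt leye_eq => /eqP fy.
  have [C0'|C0'] := eqVneq wiener_const 0.
    rewrite C0' mulr0 mul0e; rewrite C0' in bnd.
    apply/lee_addgt0Pr => r r0; rewrite add0e.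
    have [N hN] := cvge0_lt eW (divr_gt0 r0 (ltr0n R 2)).
    apply: (le_trans (bnd N)); rewrite mul0e mule0 adde0.
    apply: (@le_trans _ _ (2%:E * (r / 2)%:E)%E).
      by apply: lee_wpmul2l => //; apply: ltW; exact: hN.
    by rewrite -EFinM lee_fin; lra.
  rewrite fy gt0_muley ?leey// lte_fin.
  by rewrite mulr_gt0// lt_neqAle eq_sym C0'.
rewrite -(fineK finf) -EFinM; set v := fine _.
apply/lee_addgt0Pr => r r0.
pose r' := r / (2 + 4 * wiener_const).
have D0 : 0 < 2 + 4 * wiener_const by lra.
have r'0 : 0 < r' by rewrite divr_gt0.
have [N1 hN1] := cvge0_lt eW r'0; have [N2 hN2] := cvge0_lt ef r'0.
pose n := maxn N1 N2.
apply: (le_trans (bnd n)).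
have h1 := hN1 n (leq_maxl _ _); have h2 := hN2 n (leq_maxr _ _).
apply: (@le_trans _ _ (2%:E * r'%:E +
   2%:E * (wiener_const%:E * (2%:E * r'%:E + 2%:E * L2sq T f)))%E).
  apply: leeD; first by apply: lee_wpmul2l => //; exact: ltW.
  apply: lee_wpmul2l => //; apply: lee_wpmul2l; first by rewrite lee_fin.
  by apply: leeD => //; apply: lee_wpmul2l => //; exact: ltW.
rewrite -(fineK finf) -/v !(=^~ EFinM, =^~ EFinD) lee_fin.
have <- : r' * (2 + 4 * wiener_const) = r by rewrite divfK// gt_eqF.
lra.
Qed.

Lemma wint_lin f W g V a b : wint f W -> wint g V ->
  wint (fun u => a * f u + b * g u) (fun w => a * W w + b * V w).
Proof.
move=> hf hg; have mf := measurable_wint_integrand hf.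
have mg := measurable_wint_integrand hg.
case: hf => mf' mW [e [eT ef eW]]; case: hg => mg' mV [e' [eT' eg eV]].
have lin_le d' (S : measurableType d') (mu : {measure set S -> \bar R}) D
    (F G F' G' : S -> R) : measurable D ->
    measurable_fun D F -> measurable_fun D G ->
    measurable_fun D F' -> measurable_fun D G' ->
    (\int[mu]_(x in D) ((a * F' x + b * G' x - (a * F x + b * G x)) ^+ 2)%:E <=
     (2 * a ^+ 2)%:E * \int[mu]_(x in D) ((F' x - F x) ^+ 2)%:E +
     (2 * b ^+ 2)%:E * \int[mu]_(x in D) ((G' x - G x) ^+ 2)%:E)%E.
  move=> mD mF mG mF' mG'.
  have mdF := measurable_funB mF' mF; have mdG := measurable_funB mG' mG.
  have := @integral_sqrD _ _ _ mu D mD (fun x => a * (F' x - F x)) (fun x => b * (G' x - G x))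
    (measurable_funM (measurable_cst a) mdF) (measurable_funM (measurable_cst b) mdG).
  rewrite (integral_sqrZ mu mD a mdF) (integral_sqrZ mu mD b mdG) !muleA -!EFinM.
  by apply: le_trans; rewrite le_eqVlt; apply/orP; left; apply/eqP;
    apply: eq_integral => x _; congr EFin; ring.
have sq0 d' (S : measurableType d') (mu : {measure set S -> \bar R}) D (u v : nat -> \bar R)
    (F : nat -> S -> R) :
    u n @[n --> \oo] --> 0%E -> v n @[n --> \oo] --> 0%E ->
    (forall n, \int[mu]_(x in D) (F n x ^+ 2)%:E <=
       (2 * a ^+ 2)%:E * u n + (2 * b ^+ 2)%:E * v n)%E ->
    (\int[mu]_(x in D) (F n x ^+ 2)%:E)%E @[n --> \oo] --> 0%E.
  move=> u0 v0 hF; apply: cvge0P => [n|r r0].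
    by apply: integral_ge0 => x _; rewrite lee_fin sqr_ge0.
  have D0 : 0 < 2 * a ^+ 2 + 2 * b ^+ 2 + 1.
    by have := sqr_ge0 a; have := sqr_ge0 b; lra.
  pose r' := r / (2 * a ^+ 2 + 2 * b ^+ 2 + 1).
  have r'0 : 0 < r' by rewrite divr_gt0.
  have [N1 hN1] := cvge0_lt u0 r'0; have [N2 hN2] := cvge0_lt v0 r'0.
  exists (maxn N1 N2) => n; rewrite geq_max => /andP[n1 n2].
  apply: (le_trans (hF n)).
  apply: (@le_trans _ _ ((2 * a ^+ 2)%:E * r'%:E + (2 * b ^+ 2)%:E * r'%:E)%E).
    apply: leeD.
      by apply: lee_wpmul2l; [rewrite lee_fin mulr_ge0 ?sqr_ge0|apply: ltW; exact: hN1].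
    by apply: lee_wpmul2l; [rewrite lee_fin mulr_ge0 ?sqr_ge0|apply: ltW; exact: hN2].
  rewrite -!EFinM -EFinD lee_fin.
  have <- : r' * (2 * a ^+ 2 + 2 * b ^+ 2 + 1) = r by rewrite divfK// gt_eqF.
  lra.
split.
- have m := measurable_funD (measurable_funM (measurable_cst a) mf)
              (measurable_funM (measurable_cst b) mg).
  exact: m.
- by apply: measurable_funD; apply: measurable_funM => //; exact: measurable_cst.
- exists (fun n => elem_scale a (e n) ++ elem_scale b (e' n)); split.
  + by move=> n; apply: elem_in_cat; exact: elem_in_scale.
  + apply: (sq0 _ _ _ _ _ _ _ ef eg) => n.
    under eq_integral do rewrite elem_fun_cat !elem_fun_scale.
    apply: lin_le => //; first exact: measurable_tdom.
    * exact: measurable_elem_fun.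
    * exact: measurable_elem_fun.
  + apply: (sq0 _ _ _ _ _ _ _ eW eV) => n.
    under eq_integral do rewrite elem_int_cat !elem_int_scale.
    by apply: lin_le => //; exact: measurable_elem_int.
Qed.

Lemma wint_sub f W g V : wint f W -> wint g V ->
  wint (fun u => f u - g u) (fun w => W w - V w).
Proof.
move=> hf hg; have := wint_lin 1 (-1) hf hg.
have -> : (fun u => 1 * f u + -1 * g u) = (fun u => f u - g u).
  by apply/funext => u; ring.
by have -> : (fun w => 1 * W w + -1 * V w) = (fun w => W w - V w)
  by apply/funext => u; ring.
Qed.

Lemma wint_sum n (c : 'I_n -> R) (f : 'I_n -> R * R -> R) (W : 'I_n -> Omega -> R) :
  (forall i, wint (f i) (W i)) ->
  wint (fun u => \sum_i c i * f i u) (fun w => \sum_i c i * W i w).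
Proof.
elim: n c f W => [|n IH] c f W h.
  have e0 : elem_in T [::] by [].
  have := wint_elem e0.
  have -> : elem_fun [::] = (fun u : R * R => \sum_(i < 0) c i * f i u).
    by apply/funext => u; rewrite /elem_fun big_nil big_ord0.
  by have -> : eint [::] = (fun w => \sum_(i < 0) c i * W i w)
    by apply/funext => u; rewrite /elem_int big_nil big_ord0.
have := wint_lin 1 (c ord_max) (IH (fun i => c (widen_ord (leqnSn n) i))
  (fun i => f (widen_ord (leqnSn n) i)) (fun i => W (widen_ord (leqnSn n) i))
  (fun i => h _)) (h ord_max).
have -> : (fun u => 1 * (\sum_(i < n) c (widen_ord (leqnSn n) i) *
   f (widen_ord (leqnSn n) i) u) + c ord_max * f ord_max u) =
   (fun u => \sum_(i < n.+1) c i * f i u).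
  by apply/funext => u; rewrite big_ord_recr/= mul1r.
by have -> : (fun u => 1 * (\sum_(i < n) c (widen_ord (leqnSn n) i) *
   W (widen_ord (leqnSn n) i) u) + c ord_max * W ord_max u) =
   (fun u => \sum_(i < n.+1) c i * W i u)
  by apply/funext => u; rewrite big_ord_recr/= mul1r.
Qed.

(** Boundedness turns an L2 approximation of f into a Cauchy sequence of
    elementary integrals. *)
Lemma wint_exists (f : R * R -> R) (e : nat -> elem R) :
  measurable_fun (tdom T) (f : measurableTypeR R * measurableTypeR R -> R) ->
  (forall n, elem_in T (e n)) ->
  L2sq T (fun u => elem_fun (e n) u - f u) @[n --> \oo] --> 0%E ->
  exists W, wint f W.
Proof.
move=> mf eT ef.
have C0 := wiener_const_ge0.
have [||W [mW XW]] := @L2_complete _ _ _ P (fun n => eint (e n)).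
- by move=> n; exact: measurable_elem_int.
- move=> r r0; pose r' := r / (4 * wiener_const + 1).
  have D0 : 0 < 4 * wiener_const + 1 by lra.
  have r'0 : 0 < r' by rewrite divr_gt0.
  have [N hN] := cvge0_lt ef r'0; exists N => n m Nn Nm.
  apply: (@le_trans _ _ (\int[P]_w (eint (e n ++ elem_scale (-1) (e m)) w ^+ 2)%:E)%E).
    rewrite le_eqVlt; apply/orP; left; apply/eqP.
    by apply: eq_integral => w _; rewrite elem_int_cat elem_int_scale mulN1r.
  apply: (le_trans (elem_int_le (elem_in_cat (eT n) (@elem_in_scale _ _ (-1) _ (eT m))))).
  have mF k := @measurable_elem_fun R (e k) (tdom T).
  apply: (@le_trans _ _ (wiener_const%:E *
     (2%:E * L2sq T (fun u => elem_fun (e n) u - f u)%R +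
      2%:E * L2sq T (fun u => elem_fun (e m) u - f u)%R))%E).
    apply: lee_wpmul2l; first by rewrite lee_fin.
    have := @integral_sqrB _ _ _ leb2 (tdom T) (measurable_tdom T)
      (fun u => elem_fun (e n) u - f u) (fun u => elem_fun (e m) u - f u)
      (measurable_funB (mF n) mf) (measurable_funB (mF m) mf).
    apply: le_trans; rewrite le_eqVlt; apply/orP; left; apply/eqP.
    apply: eq_integral => u _; rewrite elem_fun_cat elem_fun_scale.
    by congr EFin; ring.
  apply: (@le_trans _ _ (wiener_const%:E * (2%:E * r'%:E + 2%:E * r'%:E))%E).
    apply: lee_wpmul2l; first by rewrite lee_fin.
    by apply: leeD; apply: lee_wpmul2l => //; apply: ltW; exact: hN.
  rewrite !(=^~ EFinM, =^~ EFinD) lee_fin.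
  have <- : r' * (4 * wiener_const + 1) = r by rewrite divfK// gt_eqF.
  lra.
by exists W; split => //; exists e; split.
Qed.

(** Moments pass to the limit by Fatou's lemma along an almost surely convergent
    subsequence of elementary integrals. *)
Lemma wint_moment k : (0 < k)%N -> exists C : R, 0 < C /\
  forall f W (v : R), wint f W -> 0 < v ->
  (\int[P]_w (W w ^+ 2)%:E <= v%:E)%E ->
  (\int[P]_w (W w ^+ k.*2)%:E <= (C * v ^+ k)%:E)%E.
Proof.
move=> k0; have [C [C0 hC]] := @gaussian_moment _ _ _ P k k0.
exists (C * 4 ^+ k); split; first by rewrite mulr_gt0// exprn_gt0.
move=> f W v [mf mW [e [eT ef eW]]] v0 hv.
have mE n := measurable_elem_int (e n).
have [phi [phik cvW]] := ae_cvg_subseq mE mW eW.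
have [N hN] := cvge0_lt eW v0.
apply: (@fatou_le _ _ _ P (fun n w => eint (e (phi (n + N)%N)) w ^+ k.*2)).
- by move=> n; exact: measurable_funX.
- exact: measurable_funX.
- by move=> n w; rewrite exprn_even_ge0// odd_double.
- by move=> w; rewrite exprn_even_ge0// odd_double.
- apply: filterS cvW => w cw.
  have c' : eint (e (phi (n + N)%N)) w @[n --> \oo] --> W w.
    by have := cw; rewrite -(cvg_shiftn N).
  elim: (k.*2) => [|j IH].
    by under eq_fun do rewrite expr0; rewrite expr0; exact: cvg_cst.
  by under eq_fun do rewrite exprS; rewrite exprS; exact: cvgM.
- move=> n; rewrite -mulrA -exprMn; apply: hC => //.
  + by have [g _ _ _] := hB; exact: g.
  + have := @integral_sqrD _ _ _ P setT measurableT
      (fun w => eint (e (phi (n + N)%N)) w - W w) W (measurable_funB (mE _) mW) mW.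
    under eq_integral do rewrite subrK.
    move=> /le_trans; apply.
    have Nphi : (N <= phi (n + N))%N by apply: leq_trans (phik _); exact: leq_addl.
    apply: (@le_trans _ _ (2%:E * v%:E + 2%:E * v%:E)%E).
      by apply: leeD; apply: lee_wpmul2l => //; apply: ltW; exact: hN.
    by rewrite -!EFinM -EFinD lee_fin; lra.
Qed.

End sheet.

(** * Step functions on product grids *)

Section step_functions.
Context {R : realType}.

(** Cut off at N, so that the differences over [i, N) add up to g i. *)
Definition trunc_seq (N : nat) (g : nat -> R) i : R := if (i < N)%N then g i else 0.

Lemma sum_drop_diff N (g : nat -> R) p : (p <= N)%N ->
  \sum_(p <= i < N) (trunc_seq N g i - trunc_seq N g i.+1) = trunc_seq N g p.
Proof.
move=> pN; have := telescope_sumr (fun i => - trunc_seq N g i) pN.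
have -> : trunc_seq N g N = 0 by rewrite /trunc_seq ltnn.
rewrite oppr0 add0r opprK => <-.
by apply: eq_bigr => i _; ring.
Qed.

(** Written with the indicators of the intervals [0, (i+1) h], which are those of
    elementary functions; on the cell ]i h, (i+1) h] its value is g i. *)
Definition step_fun (N : nat) (h : R) (g : nat -> R) (s : R) : R :=
  \sum_(i < N) (trunc_seq N g i - trunc_seq N g i.+1) * \1_(`[0, i.+1%:R * h]) s.

Lemma step_fun_cell N h (g : nat -> R) s i : 0 < h -> 0 <= s ->
  (i < N)%N -> (i = 0%N \/ i%:R * h < s) -> s <= i.+1%:R * h ->
  step_fun N h g s = g i.
Proof.
move=> h0 s0 iN lo hi; rewrite /step_fun.
rewrite -(big_mkord xpredT (fun k => (trunc_seq N g k - trunc_seq N g k.+1) *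
  \1_(`[0, k.+1%:R * h]) s)).
rewrite (@big_cat_nat _ _ _ i)//=; last exact: ltnW.
rewrite big_nat big1 ?add0r => [|k /andP[_ ki]]; last first.
  rewrite indicE memNset ?mulr0//= in_itv/= => /andP[_ sk].
  case: lo => [i0|lo]; first by rewrite i0 in ki.
  have : k.+1%:R * h <= i%:R * h by rewrite ler_pM2r// ler_nat.
  by move=> ?; lra.
rewrite -[RHS](_ : trunc_seq N g i = _); last by rewrite /trunc_seq iN.
rewrite -(sum_drop_diff g (ltnW iN)) !big_nat; apply: eq_bigr => k /andP[ik _].
rewrite indicE mem_set ?mulr1//= in_itv/= s0/=.
by apply: (le_trans hi); rewrite ler_pM2r// ler_nat.
Qed.

Lemma step_fun_out N h (g : nat -> R) s : 0 < h -> N%:R * h < s ->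
  step_fun N h g s = 0.
Proof.
move=> h0 sN; rewrite /step_fun big1// => k _.
rewrite indicE memNset ?mulr0//= in_itv/= => /andP[_ sk].
have : k.+1%:R * h <= N%:R * h by rewrite ler_pM2r// ler_nat.
by move=> ?; lra.
Qed.

Lemma cell_index N (h s : R) : 0 < h -> 0 <= s -> s <= N%:R * h -> (0 < N)%N ->
  exists i, [/\ (i < N)%N, i = 0%N \/ i%:R * h < s & s <= i.+1%:R * h].
Proof.
move=> h0 s0 sN N0; have := s0; rewrite le_eqVlt => /predU1P[s0'|s0'].
  by exists 0%N; split=> //; [left|rewrite -s0' mulr_ge0// ltW].
have exn : exists n : nat, s <= n%:R * h by exists N.
pose m := ex_minn exn.
have [m1 m2] : s <= m%:R * h /\ forall n : nat, s <= n%:R * h -> (m <= n)%N.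
  by rewrite /m; case: ex_minnP => k k1 k2.
have mN : (m <= N)%N by exact: m2.
have m0 : (0 < m)%N.
  by rewrite lt0n; apply/eqP => m0; rewrite m0 mul0r in m1; lra.
have mE : m.-1.+1 = m by exact: prednK.
exists m.-1; rewrite mE; split => //.
right; rewrite ltNge; apply/negP => /m2; by rewrite -{1}mE ltnn.
Qed.

Lemma step_fun_val N h (G : R -> R) s : 0 < h -> 0 <= s -> s <= N%:R * h ->
  (0 < N)%N ->
  exists x, s <= x <= s + h /\ step_fun N h (fun i => G (i.+1%:R * h)) s = G x.
Proof.
move=> h0 s0 sN N0; have [i [iN lo hi]] := cell_index h0 s0 sN N0.
exists (i.+1%:R * h); split; last exact: step_fun_cell.
rewrite hi/= -natr1 mulrDl mul1r.
by case: lo => [->|lo]; [rewrite mul0r add0r; lra|lra].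
Qed.

Lemma step_fun_le1 N h (g : nat -> R) s : 0 < h -> 0 <= s ->
  (forall i, `|g i| <= 1) -> `|step_fun N h g s| <= 1.
Proof.
move=> h0 s0 g1; have [sN|sN] := leP s (N%:R * h); last first.
  by rewrite step_fun_out// normr0.
case: N sN => [|N] sN; first by rewrite /step_fun big_ord0 normr0.
have [i [iN lo hi]] := cell_index h0 s0 sN isT.
by rewrite (step_fun_cell g h0 s0 iN lo hi).
Qed.

(** The tensor product of two step functions, as an elementary function. *)
Definition grid_elem (N L : nat) (h k : R) (g c : nat -> R) : elem R :=
  [seq ((trunc_seq N g i - trunc_seq N g i.+1) * (trunc_seq L c l - trunc_seq L c l.+1),
        (i.+1%:R * h, l.+1%:R * k)) | i <- index_iota 0 N, l <- index_iota 0 L].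

Lemma sum_grid_elem N L h k g c (F : R * (R * R) -> R) :
  \sum_(x <- grid_elem N L h k g c) F x = \sum_(i < N) \sum_(l < L)
   F ((trunc_seq N g i - trunc_seq N g i.+1) * (trunc_seq L c l - trunc_seq L c l.+1),
        (i.+1%:R * h, l.+1%:R * k)).
Proof.
rewrite /grid_elem big_allpairs_dep/= big_mkord.
by apply: eq_bigr => i _; rewrite big_mkord.
Qed.

Lemma grid_elem_fun N L h k g c u :
  elem_fun (grid_elem N L h k g c) u = step_fun N h g u.1 * step_fun L k c u.2.
Proof.
rewrite /elem_fun sum_grid_elem /step_fun big_distrlr/=.
apply: eq_bigr => i _; apply: eq_bigr => l _ /=.
have -> : \1_(`[0, i.+1%:R * h] `*` `[0, l.+1%:R * k]) u =
    \1_(`[0, i.+1%:R * h]) u.1 * \1_(`[0, l.+1%:R * k]) u.2 :> R.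
  by rewrite !indicE in_setX; case: (_ \in _); case: (_ \in _); rewrite ?mulr1 ?mulr0.
ring.
Qed.

Lemma grid_elem_in (T : R) N L h k g c : 0 <= h -> 0 < k ->
  N%:R * h <= T -> L%:R * k < pi -> elem_in T (grid_elem N L h k g c).
Proof.
move=> h0 k0 NT Lpi x /allpairsP[[i l] [/= + + ->]] /=.
rewrite !mem_index_iota => /andP[_ iN] /andP[_ lL]; split.
  rewrite mulr_ge0//=; apply: le_trans NT; by rewrite ler_wpM2r// ler_nat.
rewrite mulr_gt0//=; apply: le_lt_trans Lpi; by rewrite ler_pM2r// ler_nat.
Qed.

(** Summation by parts in both variables: the differences of g against the kernel
    become the values of g against its cells. *)
Lemma quad_form_parts N (g : nat -> R) (K : nat -> nat -> R) :
  (forall i, K i 0%N = 0) -> (forall j, K 0%N j = 0) ->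
  \sum_(i < N) \sum_(j < N) (trunc_seq N g i - trunc_seq N g i.+1) *
     (trunc_seq N g j - trunc_seq N g j.+1) * K i.+1 j.+1 =
  \sum_(i < N) \sum_(j < N) g i * g j * cell K i j.
Proof.
move=> K0 K0'.
have E (i j : 'I_N) : K i.+1 j.+1 =
    \sum_(p < N) \sum_(p' < N) bef p i.+1 * bef p' j.+1 * cell K p p'.
  by rewrite (kernel_telescope_bef K0 K0' (ltn_ord i) (ltn_ord j)).
under eq_bigr do under eq_bigr do rewrite E.
rewrite (quad_form_change (index_enum 'I_N)
  (fun i : 'I_N => trunc_seq N g i - trunc_seq N g i.+1)
  (fun (i p : 'I_N) => bef p i.+1) (fun p p' : 'I_N => cell K p p')).
have S (p : 'I_N) : \sum_(i < N) (trunc_seq N g i - trunc_seq N g i.+1) * bef p i.+1 = g p.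
  rewrite -[RHS](_ : trunc_seq N g p = _); last by rewrite /trunc_seq ltn_ord.
  rewrite -(sum_drop_diff g (ltnW (ltn_ord p))).
  rewrite -(big_mkord xpredT (fun i => (trunc_seq N g i - trunc_seq N g i.+1) * bef p i.+1)).
  rewrite (@big_cat_nat _ _ _ p)//=; last exact/ltnW/ltn_ord.
  rewrite big_nat big1 ?add0r => [|k /andP[_ kp]]; last first.
    by rewrite /bef ltnS leqNgt kp mulr0.
  rewrite !big_nat; apply: eq_bigr => k /andP[pk _].
  by rewrite /bef ltnS pk mulr1.
by apply: eq_bigr => p _; apply: eq_bigr => p' _; rewrite !S.
Qed.

Lemma grid_elem_form (H1 H2 h k : R) N L (g c : nat -> R) : 0 < H1 -> 0 < H2 ->
  0 <= h -> 0 <= k ->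
  \sum_(x <- grid_elem N L h k g c) \sum_(x' <- grid_elem N L h k g c)
    x.1 * x'.1 * (4^-1 * (fbm_cov H1 x.2.1 x'.2.1 * fbm_cov H2 x.2.2 x'.2.2)) =
  4^-1 * (\sum_(i < N) \sum_(j < N) g i * g j * cell (grid_cov H1 (ugrid h)) i j)
       * (\sum_(i < L) \sum_(j < L) c i * c j * cell (grid_cov H2 (ugrid k)) i j).
Proof.
move=> H10 H20 h0 k0.
have z1 i : grid_cov H1 (ugrid h) 0 i = 0.
  by rewrite /grid_cov /ugrid mul0r fbm_cov0// mulr_ge0.
have z2 i : grid_cov H2 (ugrid k) 0 i = 0.
  by rewrite /grid_cov /ugrid mul0r fbm_cov0// mulr_ge0.
have z1' i : grid_cov H1 (ugrid h) i 0 = 0 by rewrite /grid_cov fbm_covC; exact: z1.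
have z2' i : grid_cov H2 (ugrid k) i 0 = 0 by rewrite /grid_cov fbm_covC; exact: z2.
rewrite -(quad_form_parts N g z1' z1) -(quad_form_parts L c z2' z2).
rewrite sum_grid_elem/=.
under eq_bigr do under eq_bigr do rewrite sum_grid_elem/=.
rewrite -mulrA big_distrlr/= mulr_sumr; apply: eq_bigr => i _.
rewrite mulr_sumr; apply: eq_bigr => l _.
rewrite big_distrlr/= mulr_sumr; apply: eq_bigr => i' _.
rewrite mulr_sumr; apply: eq_bigr => l' _.
rewrite /grid_cov /ugrid; ring.
Qed.

End step_functions.

(** * The exponential time kernel *)

Section time_kernel.
Context {R : realType}.

Definition decay (m t s : R) : R := if s < t then expR (- (m * (t - s))) else 0.

Lemma decay_ge0 (m t s : R) : 0 <= decay m t s.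
Proof. by rewrite /decay; case: ifP => // _; exact: expR_ge0. Qed.

Lemma decay_le1 (m t s : R) : 0 <= m -> decay m t s <= 1.
Proof.
move=> m0; rewrite /decay; case: ifPn => // st.
rewrite -[leRHS]expR0 ler_expR oppr_le0 mulr_ge0//; lra.
Qed.

(** A Riemann sum of m exp (- m (t - s)) over s < t, with a mesh of at most 1 / m.
    The induction carries a geometric bound by the last term. *)
Lemma decay_sum (m h t : R) n : 0 <= m -> 0 < h -> m * h <= 1 ->
  \sum_(i < n) m * h * decay m t (i.+1%:R * h) <= 2.
Proof.
move=> m0 h0 mh.
have : \sum_(i < n) m * h * decay m t (i.+1%:R * h) <= 2 /\
  (n%:R * h < t -> \sum_(i < n) m * h * decay m t (i.+1%:R * h) <=
     2 * expR (- (m * (t - n%:R * h)))).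
  elim: n => [|n [IH1 IH2]].
    by rewrite big_ord0; split => // _; rewrite mulr_ge0// expR_ge0.
  rewrite big_ord_recr/= {2 4}/decay.
  have [lt|ge] := ltP (n.+1%:R * h) t; last by rewrite mulr0 addr0.
  have lt' : n%:R * h < t by apply: le_lt_trans lt; rewrite ler_pM2r// ler_nat.
  have {}IH2 := IH2 lt'.
  set E := expR (- (m * (t - n.+1%:R * h))).
  have E0 : 0 <= E by exact: expR_ge0.
  have E1 : E <= 1.
    by rewrite -[leRHS]expR0 ler_expR oppr_le0 mulr_ge0//; lra.
  have eE : expR (- (m * (t - n%:R * h))) = E * expR (- (m * h)).
    by rewrite /E -expRD; congr expR; rewrite -natr1; ring.
  rewrite eE in IH2.
  have key : 2 * expR (- (m * h)) + m * h <= 2.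
    have mh0 : 0 <= m * h by rewrite mulr_ge0// ltW.
    have h1 : 1 + m * h <= expR (m * h) := expR_ge1Dx _.
    have h2 : expR (- (m * h)) * expR (m * h) = 1 by rewrite -expRD addNr expR0.
    have h3 := expR_ge0 (- (m * h)).
    have := ler_wpM2l h3 h1; rewrite h2.
    nra.
  have : E * (2 * expR (- (m * h)) + m * h) <= E * 2 by rewrite ler_wpM2l.
  by split => [|_]; lra.
by case.
Qed.

Lemma count_sum (h s t : R) n : 0 < h -> s < t ->
  \sum_(i < n) h * ((s <= i.+1%:R * h) && (i.+1%:R * h < t))%:R <= t - s + h.
Proof.
move=> h0 st.
have : \sum_(i < n) h * ((s <= i.+1%:R * h) && (i.+1%:R * h < t))%:R <= t - s + h /\
  (n%:R * h < t -> \sum_(i < n) h * ((s <= i.+1%:R * h) && (i.+1%:R * h < t))%:R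
    <= Num.max 0 (n%:R * h - s + h)).
  elim: n => [|n [IH1 IH2]].
    by rewrite big_ord0; split => [|_]; [lra|rewrite le_max lexx].
  rewrite big_ord_recr/=.
  have [lt|ge] := ltP (n.+1%:R * h) t; last by rewrite andbF mulr0 addr0.
  have lt' : n%:R * h < t by apply: le_lt_trans lt; rewrite ler_pM2r// ler_nat.
  have {}IH2 := IH2 lt'; rewrite andbT.
  have e : n.+1%:R * h = n%:R * h + h by rewrite -natr1; ring.
  have [le|gt] := leP s (n.+1%:R * h); rewrite ?mulr1 ?mulr0 ?addr0.
    rewrite max_r in IH2; last by lra.
    by split => [|_]; [lra|rewrite le_max; apply/orP; right; lra].
  rewrite max_l in IH2; last by lra.
  by split => [|_]; [lra|rewrite le_max IH2].
by case.
Qed.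

Lemma decay_diff_le1 (m s t x : R) : 0 <= m -> `|decay m t x - decay m s x| <= 1.
Proof.
move=> m0; have := decay_le1 t x m0; have := decay_le1 s x m0.
have := decay_ge0 m t x; have := decay_ge0 m s x.
by rewrite ler_norml; move=> *; apply/andP; split; lra.
Qed.

(** On [s, t) only the later kernel lives; before s the two kernels differ by the
    factor 1 - exp (- m (t - s)). *)
Lemma decay_diff_bound (m s t x : R) : 0 <= m -> s < t ->
  `|decay m t x - decay m s x| <=
  ((s <= x) && (x < t))%:R * decay m t x + Num.min 1 (m * (t - s)) * decay m s x.
Proof.
move=> m0 st; rewrite /decay.
have [xs|sx] := ltP x s.
  have xt : x < t by lra.
  rewrite xt/= mul0r add0r.
  have -> : expR (- (m * (t - x))) = expR (- (m * (t - s))) * expR (- (m * (s - x))).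
    by rewrite -expRD; congr expR; ring.
  set a := expR (- (m * (t - s))); set b := expR _.
  have -> : a * b - b = - ((1 - a) * b) by ring.
  have ms : 0 <= m * (t - s) by rewrite mulr_ge0//; lra.
  have a1 : a <= 1 by rewrite -[leRHS]expR0 ler_expR oppr_le0.
  have a2 : 1 - m * (t - s) <= a by apply: le_trans (expR_ge1Dx _); lra.
  have a0 : 0 <= a by exact: expR_ge0.
  have b0 : 0 <= b by exact: expR_ge0.
  rewrite normrN normrM (ger0_norm b0) (ger0_norm (_ : 0 <= 1 - a)); last lra.
  by apply: ler_wpM2r => //; rewrite le_min; apply/andP; split; lra.
rewrite mulr0 addr0 subr0 /=; case: ltP => _; last by rewrite normr0 mulr0.
by rewrite mul1r ger0_norm// expR_ge0.
Qed.

(** The same Riemann sum is bounded by the length t - s and by the life time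
    1 / m. *)
Lemma decay_diff_sum (m h s t : R) n : 0 <= m -> 0 < h -> m * h <= 1 ->
  s < t -> h <= t - s ->
  h * (\sum_(i < n) `|decay m t (i.+1%:R * h) - decay m s (i.+1%:R * h)|) <= 4 * (t - s)
  /\ m * (h * (\sum_(i < n) `|decay m t (i.+1%:R * h) - decay m s (i.+1%:R * h)|)) <= 4.
Proof.
move=> m0 h0 mh st hd.
have ms : 0 <= m * (t - s) by rewrite mulr_ge0//; lra.
have S1 := decay_sum t n m0 h0 mh; have S2 := decay_sum s n m0 h0 mh.
have S3 := count_sum n h0 st.
split.
- apply: (@le_trans _ _ (\sum_(i < n) (h * ((s <= i.+1%:R * h) && (i.+1%:R * h < t))%:R
     + (t - s) * (m * h * decay m s (i.+1%:R * h))))).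
    rewrite mulr_sumr; apply: ler_sum => i _; set x := i.+1%:R * h.
    have b := decay_diff_bound x m0 st.
    have d1 := decay_le1 t x m0; have d0 := decay_ge0 m s x.
    have : ((s <= x) && (x < t))%:R * decay m t x <= ((s <= x) && (x < t))%:R.
      by rewrite ler_piMr.
    have : Num.min 1 (m * (t - s)) * decay m s x <= m * (t - s) * decay m s x.
      by rewrite ler_wpM2r// ge_min lexx orbT.
    move=> e1 e2.
    have -> : h * ((s <= x) && (x < t))%:R + (t - s) * (m * h * decay m s x) =
      h * (((s <= x) && (x < t))%:R + m * (t - s) * decay m s x) by ring.
    by rewrite ler_pM2l//; lra.
  rewrite big_split/= -[X in _ + X <= _]mulr_sumr.
  have : (t - s) * (\sum_(i < n) m * h * decay m s (i.+1%:R * h)) <= (t - s) * 2.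
    by rewrite ler_wpM2l//; lra.
  lra.
- apply: (@le_trans _ _ (\sum_(i < n) (m * h * decay m t (i.+1%:R * h)
     + m * h * decay m s (i.+1%:R * h)))).
    rewrite mulrA mulr_sumr; apply: ler_sum => i _; rewrite -mulrDr.
    rewrite ler_wpM2l//; first by rewrite mulr_ge0// ltW.
    have d1 := decay_ge0 m t (i.+1%:R * h); have d0 := decay_ge0 m s (i.+1%:R * h).
    by rewrite ler_norml; apply/andP; split; lra.
  rewrite big_split/=; lra.
Qed.

End time_kernel.

(** * Elementary bounds on the cosine basis *)

Section eigenfunctions.
Context {R : realType}.

Definition ampl (j : nat) : R := if j is 0%N then Num.sqrt (1 / pi) else Num.sqrt (2 / pi).

Lemma eigfunE (j : nat) (x : R) : eigfun j x = ampl j * cos (j%:R * x).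
Proof. by case: j => [|j]; rewrite /eigfun /ampl// mul0r cos0 mulr1. Qed.

Lemma ampl_ge0 j : 0 <= ampl j.
Proof. by case: j => [|j]; rewrite sqrtr_ge0. Qed.

Lemma ampl_le1 j : ampl j <= 1.
Proof.
have p2 := @pi_ge2 R; have p0 := @pi_gt0 R.
by rewrite -[leRHS]sqrtr1; case: j => [|j]; rewrite /ampl ler_sqrt//
  ler_pdivrMr// mul1r; apply: le_trans p2; lra.
Qed.

Lemma eigfun_le1 j (x : R) : `|eigfun j x| <= 1.
Proof.
rewrite eigfunE normrM (ger0_norm (ampl_ge0 j)).
by rewrite mulr_ile1 ?ampl_ge0 ?ampl_le1// cos_max.
Qed.

Lemma cos_lipschitz (x y : R) : `|cos x - cos y| <= `|x - y|.
Proof.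
wlog xy : x y / x < y.
  move=> W; have [/W//|yx|->] := ltgtP x y; last by rewrite !subrr.
  by rewrite distrC [leRHS]distrC W.
rewrite distrC [leRHS]distrC.
have [|c _ ->] := @MVT _ cos (fun z => - sin z) x y xy.
  exact/continuous_subspaceT/continuous_cos.
by rewrite normrM normrN ler_piMl// sin_max.
Qed.

Lemma sin_increment (x y : R) : x < y -> `|sin y - sin x - cos y * (y - x)| <= (y - x) ^+ 2.
Proof.
move=> xy; have [|c /andP[cx cy] ->] := @MVT _ sin cos x y xy.
  exact/continuous_subspaceT/continuous_sin.
rewrite -mulrBl normrM expr2 (gtr0_norm (_ : 0 < y - x)) ?subr_gt0//.
rewrite ler_wpM2r ?subr_ge0 ?(ltW xy)//; apply: (le_trans (cos_lipschitz _ _)).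
move: cx cy; rewrite !bnd_simp => cx cy.
by rewrite ler_norml; apply/andP; split; lra.
Qed.

(** The terms are the increments of sin (j x) / j up to errors of second order in
    the mesh. *)
Lemma cos_sum_bound (j : nat) (k : R) a b : (0 < j)%N -> 0 < k -> (a <= b)%N ->
  `|\sum_(a <= l < b) k * cos (j%:R * (l.+1%:R * k))| <=
    2 / j%:R + (b - a)%:R * (j%:R * k ^+ 2).
Proof.
move=> j0 k0 ab; have j0' : 0 < j%:R :> R by rewrite ltr0n.
pose s l : R := sin (j%:R * (l%:R * k)) / j%:R.
have tel : \sum_(a <= l < b) (s l.+1 - s l) = s b - s a by rewrite telescope_sumr.
have -> : \sum_(a <= l < b) k * cos (j%:R * (l.+1%:R * k)) = (s b - s a) -
    \sum_(a <= l < b) ((s l.+1 - s l) - k * cos (j%:R * (l.+1%:R * k))).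
  by rewrite sumrB tel; ring.
apply: (le_trans (ler_normB _ _)); apply: lerD.
  rewrite -mulrBl normrM normfV (gtr0_norm j0') ler_wpM2r ?invr_ge0 ?(ltW j0')//.
  apply: (le_trans (ler_normB _ _)).
  by have := sin_max (j%:R * (b%:R * k)); have := sin_max (j%:R * (a%:R * k)); lra.
apply: (le_trans (ler_norm_sum _ _ _)).
rewrite mulr_natl -sumr_const_nat; apply: ler_sum => l _.
have lt : j%:R * (l%:R * k) < j%:R * (l.+1%:R * k).
  by rewrite ltr_pM2l// ltr_pM2r// ltr_nat.
have := sin_increment lt.
have -> : j%:R * (l.+1%:R * k) - j%:R * (l%:R * k) = j%:R * k by rewrite -natr1; ring.
move=> h; have -> : s l.+1 - s l - k * cos (j%:R * (l.+1%:R * k)) =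
  (sin (j%:R * (l.+1%:R * k)) - sin (j%:R * (l%:R * k)) -
    cos (j%:R * (l.+1%:R * k)) * (j%:R * k)) / j%:R.
  by rewrite /s; field; rewrite gt_eqF.
rewrite normrM normfV (gtr0_norm j0') ler_pdivrMr//; apply: (le_trans h).
by rewrite exprMn; lra.
Qed.

(** The condition on the mesh makes the quadrature error at most 1 / j. *)
Lemma eig_sum_bound (j : nat) (k : R) L a b : 0 < k -> L%:R * k <= pi ->
  pi * j%:R ^+ 2 * k <= 1 -> (a <= b)%N -> (b <= L)%N ->
  k * `|\sum_(a <= l < b) eigfun j (l.+1%:R * k)| <= 6 / (j%:R + 1).
Proof.
move=> k0 Lk jk ab bL.
have bak : (b - a)%:R * k <= pi.
  apply: le_trans Lk; rewrite ler_pM2r// ler_nat; exact: leq_trans (leq_subr _ _) bL.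
have p4 : pi <= 4 :> R.
  by have /andP[_] := @pihalf_02 R; lra.
under eq_bigr do rewrite eigfunE.
rewrite -mulr_sumr normrM (ger0_norm (ampl_ge0 j)).
apply: (@le_trans _ _ (k * `|\sum_(a <= l < b) cos (j%:R * (l.+1%:R * k))|)).
  by rewrite ler_wpM2l ?(ltW k0)// ler_piMl ?ampl_le1.
have [->|j0] := posnP j.
  rewrite add0r divr1.
  apply: (@le_trans _ _ (k * (b - a)%:R)); last by rewrite mulrC; lra.
  rewrite ler_wpM2l ?(ltW k0)//; apply: (le_trans (ler_norm_sum _ _ _)).
  rewrite -sumr_const_nat; apply: ler_sum => l _; exact: cos_max.
have j1 : 1 <= j%:R :> R by rewrite ler1n.
have := cos_sum_bound j0 k0 ab.
rewrite -mulr_sumr normrM (gtr0_norm k0) => /le_trans; apply.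
have : (b - a)%:R * (j%:R * k ^+ 2) <= 1 / j%:R.
  rewrite ler_pdivlMr; last by lra.
  have -> : (b - a)%:R * (j%:R * k ^+ 2) * j%:R = ((b - a)%:R * k) * (j%:R ^+ 2 * k) by ring.
  apply: le_trans jk; rewrite -[leRHS]mulrA; apply: ler_wpM2r => //.
  by rewrite mulr_ge0 ?exprn_ge0// ltW.
have : 3 / j%:R <= 6 / (j%:R + 1) :> R.
  by rewrite ler_pdivlMr ?addr_gt0//; [rewrite mulrAC ler_pdivrMr|]; lra.
have : 3 / j%:R = 2 / j%:R + 1 / j%:R :> R by rewrite -mulrDl; congr (_ / _); ring.
lra.
Qed.

Lemma measurable_eigfun j D : measurable_fun D (eigfun j : measurableTypeR R -> R).
Proof.
apply: measurable_funTS.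
have -> : eigfun j = (fun x : R => ampl j * cos (j%:R * x)).
  by apply/funext => x; exact: eigfunE.
apply: measurable_funM; first exact: measurable_cst.
apply: (@measurableT_comp _ _ _ _ _ _ cos).
  by apply: continuous_measurable_fun; exact: continuous_cos.
by apply: measurable_funM => //; exact: measurable_cst.
Qed.

Lemma measurable_decay (m t : R) D : measurable_fun D (decay m t : measurableTypeR R -> R).
Proof.
apply: measurable_funTS; rewrite /decay.
apply: measurable_fun_ifT.
- exact: measurable_fun_ltr.
- apply: (@measurableT_comp _ _ _ _ _ _ expR); first exact: measurable_expR.
  apply: measurableT_comp => //; apply: measurable_funM; first exact: measurable_cst.
  exact: measurable_funB.
- exact: measurable_cst.
Qed.

(** The kernel jumps at t and is only continuous from the right. *)
Lemma decay_right_cvg (m t s : R) (x : nat -> R) : (forall n, s <= x n) ->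
  x n @[n --> \oo] --> s -> decay m t (x n) @[n --> \oo] --> decay m t s.
Proof.
move=> sx xs; have [st|ts] := ltP s t; last first.
  have -> : (fun n => decay m t (x n)) = (fun=> decay m t s).
    apply/funext => n; rewrite /decay ltNge (le_trans ts (sx n))/=.
    by rewrite ltNge ts.
  exact: cvg_cst.
have : expR (- (m * (t - x n))) @[n --> \oo] --> expR (- (m * (t - s))).
  apply: continuous_cvg; first exact: continuous_expR.
  by apply: cvgN; apply: cvgMr; apply: cvgB => //; exact: cvg_cst.
rewrite [in X in _ -> X]/decay st; apply: cvg_trans; apply: near_eq_cvg.
have /cvgrPdist_lt/(_ (t - s)) := xs; rewrite subr_gt0 => /(_ st)[N _ hN].
exists N => // n Nn; have := hN n Nn; rewrite /= distrC.
rewrite ger0_norm ?subr_ge0// => h.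
by rewrite /decay ifT//; lra.
Qed.

End eigenfunctions.

(** * Sampling separable integrands *)

Section approximation.
Context {R : realType}.
Variable T : R.
Hypothesis hT : 0 < T.
Local Notation leb2 := ((@lebesgue_measure R) \x (@lebesgue_measure R))%E.

Definition psi (G : R -> R) (j : nat) (u : R * R) : R := G u.1 * eigfun j u.2.

(** Sampled at the right end points of the cells, since the time kernels are only
    right continuous. *)
Definition approx (G : R -> R) (j N : nat) : elem R :=
  grid_elem N.+1 N (T / N.+1%:R) (pi / N.+1%:R)
    (fun i => G (i.+1%:R * (T / N.+1%:R)))
    (fun l => eigfun j (l.+1%:R * (pi / N.+1%:R))).

Lemma step_gt0 (a : R) N : 0 < a -> 0 < a / N.+1%:R.
Proof. by move=> a0; rewrite divr_gt0// ltr0n. Qed.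

Lemma step_mul (a : R) N : N.+1%:R * (a / N.+1%:R) = a.
Proof. by rewrite mulrC divfK// pnatr_eq0. Qed.

Lemma approx_in G j N : elem_in T (approx G j N).
Proof.
apply: grid_elem_in; rewrite ?step_mul//.
- exact/ltW/step_gt0.
- exact/step_gt0/pi_gt0.
- rewrite -[ltRHS](@step_mul pi N) ltr_pM2r ?ltr_nat//.
  exact/step_gt0/pi_gt0.
Qed.

Lemma step_cvg0 (a : R) : a / N.+1%:R @[N --> \oo] --> 0.
Proof.
have -> : (fun N : nat => a / N.+1%:R) = (fun N : nat => a * harmonic N) by [].
rewrite -(mulr0 a); apply: cvgMr; exact: cvg_harmonic.
Qed.

Lemma L2sq_cvg0 (F : nat -> R * R -> R) (c : R) :
  (forall n, measurable_fun (tdom T) (F n : measurableTypeR R * measurableTypeR R -> R)) ->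
  (forall n u, tdom T u -> `|F n u| <= c) ->
  (forall u, tdom T u -> F n u @[n --> \oo] --> 0) ->
  L2sq T (F n) @[n --> \oo] --> 0%E.
Proof.
move=> mF Fc F0; have mD := measurable_tdom T.
have mF2 n : measurable_fun (tdom T) (fun u : measurableTypeR R * measurableTypeR R => (F n u ^+ 2)%:E).
  exact: measurable_sqr.
have := @dominated_convergence _ _ _ leb2 (tdom T) mD
  (fun n u => (F n u ^+ 2)%:E) (cst 0%E) (cst (c ^+ 2)%:E) mF2.
case.
- exact: measurable_cst.
- apply: aeW => u Du.
  have h : F n u ^+ 2 @[n --> \oo] --> (0 : R).
    rewrite -(mulr0 0); under eq_fun do rewrite expr2.
    by apply: cvgM; exact: F0.
  by apply/fine_cvgP; split; [exact: nearW|exact: h].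
- apply/integrableP; split; first exact: measurable_cst.
  rewrite integral_cst//=; have := leb2_tdom (ltW hT) => /= ->.
  by rewrite -EFinM ltry.
- apply: aeW => u n Du; rewrite gee0_abs ?lee_fin ?sqr_ge0//.
  by rewrite -[F n u ^+ 2]real_normK ?num_real// lerXn2r ?nnegrE ?Fc// (le_trans _ (Fc n u Du)).
move=> _ _; rewrite integral0; exact.
Qed.

Lemma measurable_psi (G : R -> R) j D :
  measurable_fun setT (G : measurableTypeR R -> R) ->
  measurable_fun D (psi G j : measurableTypeR R * measurableTypeR R -> R).
Proof.
move=> mG; apply: measurable_funTS; apply: measurable_funM.
  by apply: (@measurableT_comp _ _ _ _ _ _ G) => //; exact: measurable_fst.
apply: (@measurableT_comp _ _ _ _ _ _ (eigfun j)); last exact: measurable_snd.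
exact: measurable_eigfun.
Qed.

Definition right_cvg (G : R -> R) := forall (s : R) (x : nat -> R),
  (forall n, s <= x n) -> x n @[n --> \oo] --> s -> G (x n) @[n --> \oo] --> G s.

Lemma step_fun_cvg (a s : R) (G : R -> R) (m : nat -> nat) : 0 < a -> right_cvg G -> 0 <= s ->
  (\forall N \near \oo, (0 < m N)%N /\ s <= (m N)%:R * (a / N.+1%:R)) ->
  step_fun (m N) (a / N.+1%:R) (fun i => G (i.+1%:R * (a / N.+1%:R))) s
    @[N --> \oo] --> G s.
Proof.
move=> a0 rG s0 [N0 _ hN].
have ch N : {x | s <= x <= s + a / N.+1%:R /\ ((N0 <= N)%N ->
   step_fun (m N) (a / N.+1%:R) (fun i => G (i.+1%:R * (a / N.+1%:R))) s = G x)}.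
  apply: cid; have [NN|NN] := leqP N0 N.
    have [m0 sm] := hN N NN.
    have [x [x1 x2]] := step_fun_val G (step_gt0 N a0) s0 sm m0.
    by exists x.
  by exists s; split => //; rewrite lexx/= lerDl ltW// step_gt0.
pose x N := sval (ch N).
have xs : x N @[N --> \oo] --> s.
  apply: (@squeeze_cvgr _ _ _ _ (fun=> s) (fun N => s + a / N.+1%:R)).
  - by apply: nearW => N; have [] := svalP (ch N).
  - exact: cvg_cst.
  - rewrite -[X in _ --> X]addr0; apply: cvgD; [exact: cvg_cst|exact: step_cvg0].
have sx n : s <= x n by have [/andP[]] := svalP (ch n).
apply: cvg_trans (rG s x sx xs); apply: near_eq_cvg; exists N0 => // N /= NN.
by have [_ /(_ NN) ->] := svalP (ch N).
Qed.

Lemma eigfun_right_cvg j : right_cvg (eigfun j).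
Proof.
move=> s x _ xs; rewrite eigfunE; under eq_fun do rewrite eigfunE.
apply: cvgMr; apply: continuous_cvg; first exact: continuous_cos.
exact: cvgMr.
Qed.

Lemma approx_cvg (G : R -> R) j : right_cvg G -> (forall x, `|G x| <= 1) ->
  measurable_fun setT (G : measurableTypeR R -> R) ->
  L2sq T (fun u => elem_fun (approx G j N) u - psi G j u) @[N --> \oo] --> 0%E.
Proof.
move=> rG G1 mG; apply: (@L2sq_cvg0 _ 2).
- move=> n; apply: measurable_funB; last exact: measurable_psi.
  exact: (@measurable_elem_fun _ (approx G j n) (tdom T)).
- move=> n [s y] [/=]; rewrite in_itv/= => /andP[s0 _].
  rewrite /dom/= in_itv/= => /andP[y0 _].
  apply: (le_trans (ler_normB _ _)); rewrite grid_elem_fun /psi/= !normrM.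
  have a1 : `|step_fun n.+1 (T / n.+1%:R) (fun i => G (i.+1%:R * (T / n.+1%:R))) s| <= 1.
    by apply: step_fun_le1 => //; exact: step_gt0.
  have a2 : `|step_fun n (pi / n.+1%:R) (fun l => eigfun j (l.+1%:R * (pi / n.+1%:R))) y| <= 1.
    apply: step_fun_le1; [exact/step_gt0/pi_gt0|exact: ltW|].
    by move=> i; exact: eigfun_le1.
  have := mulr_ile1 (normr_ge0 _) (normr_ge0 _) a1 a2.
  have := mulr_ile1 (normr_ge0 _) (normr_ge0 _) (G1 s) (eigfun_le1 j y).
  lra.
- move=> [s y] [/=]; rewrite in_itv/= => /andP[s0 sT].
  rewrite /dom/= in_itv/= => /andP[y0 ypi].
  have c1 := @step_fun_cvg T s G (fun N => N.+1) hT rG s0.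
  have c2 := @step_fun_cvg pi y (eigfun j) id (pi_gt0 R) (@eigfun_right_cvg j) (ltW y0).
  have {}c1 := c1 ltac:(apply: nearW => N; rewrite step_mul; by split).
  have {}c2 : step_fun N (pi / N.+1%:R) (fun i => eigfun j (i.+1%:R * (pi / N.+1%:R))) y
    @[N --> \oo] --> eigfun j y.
    apply: c2; have /cvgrPdist_lt/(_ (pi - y)) := @step_cvg0 pi.
    rewrite subr_gt0 => /(_ ypi)[N0 _ hN0]; exists (maxn 1 N0) => // N /=.
    rewrite geq_max => /andP[N1 NN]; split => //.
    have := hN0 N NN; rewrite /= sub0r normrN ger0_norm; last exact/ltW/step_gt0/pi_gt0.
    have := @step_mul pi N; rewrite -natr1 mulrDl mul1r; lra.
  rewrite -(subrr (psi G j (s, y))); apply: cvgB; last exact: cvg_cst.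
  under eq_fun do rewrite grid_elem_fun/=.
  exact: cvgM.
Qed.

End approximation.

(** * Mean square increments of the modes *)

Section increments.
Context d (Omega : measurableType d) (R : realType) (P : probability Omega R)
  (T H1 H2 : R) (B : R -> R -> {RV P >-> R}).
Hypotheses (hT : 0 < T) (hH1 : 2^-1 <= H1 < 1) (hH2 : 2^-1 <= H2 < 1)
  (hB : fractional_brownian_sheet T H1 H2 B).
Local Notation eint := (elem_int (fun t x w => B t x w)).
Local Notation wint := (wiener_integral P T (fun t x w => B t x w)).

Definition rate (j : nat) : R := eigval R j ^+ 2.

Lemma rate_ge0 j : 0 <= rate j. Proof. by rewrite /rate sqr_ge0. Qed.

Lemma mode_exists j t : exists W, wint (psi (decay (rate j) t) j) W.
Proof.
have aT N := @approx_in R T hT (decay (rate j) t) j N.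
apply: (wint_exists hT hH1 hH2 hB _ aT).
  by apply: measurable_psi; exact: measurable_decay.
apply: approx_cvg => //.
- by move=> s x sx xs; exact: decay_right_cvg.
- by move=> x; rewrite ger0_norm ?decay_ge0// decay_le1// rate_ge0.
- exact: measurable_decay.
Qed.

(** The time kernel of the mode j changes over a time dt and lives for a time of
    order (j+1)^(-4). The constant covers j = 0 and the passage from j to j + 1. *)
Definition mode_scale (j : nat) (dt : R) : R :=
  64 * Num.max 1 T * Num.min dt ((j%:R + 1) ^- 4).

Lemma mode_scale_gt0 j dt : 0 < dt -> 0 < mode_scale j dt.
Proof.
move=> dt0; rewrite /mode_scale mulr_gt0//.
  by rewrite mulr_gt0// lt_max ltr01.
by rewrite lt_min dt0 invr_gt0 exprn_gt0// addr_gt0.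
Qed.

Lemma le_mode_scale (j : nat) (S dt : R) : 0 < dt <= T -> 0 <= S ->
  S <= 4 * dt -> rate j * S <= 4 -> S <= mode_scale j dt.
Proof.
move=> /andP[dt0 dtT] S0 S1 S2; rewrite /mode_scale.
have mT : 1 <= Num.max 1 T by rewrite le_max lexx.
have mT' : T <= Num.max 1 T by rewrite le_max lexx orbT.
move: (Num.max 1 T) mT mT' => M M1 MT.
have [le|ge] := leP dt ((j%:R + 1) ^- 4); first by nra.
case: j S2 ge => [|j] S2 ge.
  by move: ge; rewrite add0r expr1n invr1 => ge; nra.
have j1 : 1 <= j.+1%:R :> R by rewrite ler1n.
move: S2 ge; rewrite /rate /eigval -exprM; move: (j.+1%:R : R) j1 => x x1 S2 ge.
have x4 : (x + 1) ^+ 4 <= 16 * x ^+ 4.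
  have -> : 16 * x ^+ 4 = (2 * x) ^+ 4 by ring.
  by apply: lerXn2r; rewrite ?nnegrE; lra.
have p4 : 0 < (x + 1) ^+ 4 by rewrite exprn_gt0//; lra.
have : S * (x + 1) ^+ 4 <= 64.
  have : S * (x + 1) ^+ 4 <= S * (16 * x ^+ 4) by rewrite ler_wpM2l.
  by move: S2; rewrite (_ : (2 * 2)%N = 4%N)//; lra.
rewrite -ler_pdivlMr// => h; apply: (le_trans h).
by rewrite ler_wpM2r ?invr_ge0 ?(ltW p4)//; lra.
Qed.

(** On a product grid the mean square factorizes into a form in time and a form in
    space. Each is estimated by cancellation, at the scale mode_scale in time and
    6 / (j + 1) in space. *)
Lemma approx_increment_bound j (s t : R) : 0 <= s -> s < t -> t <= T ->
  \forall N \near \oo,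
  (\int[P]_w (eint (approx T (fun x => decay (rate j) t x - decay (rate j) s x) j N) w ^+ 2)%:E
    <= (256 * mode_scale j (t - s) `^ (2 * H1) * ((6 / (j%:R + 1)) `^ (2 * H2 - 1) * pi))%:E)%E.
Proof.
move=> s0 st tT; have dt0 : 0 < t - s by lra.
have /andP[H1a H1b] := hH1; have /andP[H2a H2b] := hH2.
have m0 := rate_ge0 j; have A0 := mode_scale_gt0 j dt0.
have dT : 0 < t - s <= T by apply/andP; split; lra.
set A1 := mode_scale _ _ in A0 *; set A2 := 6 / _.
have A20 : 0 < A2 by rewrite divr_gt0// addr_gt0.
have small (a c : R) : 0 < c -> \forall N \near \oo, a / N.+1%:R < c.
  move=> c0; have /cvgrPdist_lt/(_ c c0)[N0 _ hN] := @step_cvg0 R a.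
  exists N0 => // N NN; have := hN N NN; rewrite /= sub0r normrN.
  exact: le_lt_trans (ler_norm _).
have e1 := small T A1 A0; have e2 := small pi A2 A20.
have e3 := small T (t - s) dt0; have e4 := small (rate j * T) 1 ltr01.
have e5 := small (pi * j%:R ^+ 2 * pi) 1 ltr01.
near=> N.
rewrite (elem_int_msq hB (@approx_in R T hT _ j N)) lee_fin.
have hA : T / N.+1%:R <= A1 by apply: ltW; near: N.
have kA : pi / N.+1%:R <= A2 by apply: ltW; near: N.
have hd : T / N.+1%:R <= t - s by apply: ltW; near: N.
have mh : rate j * (T / N.+1%:R) <= 1 by rewrite mulrA; apply: ltW; near: N.
have jk : pi * j%:R ^+ 2 * (pi / N.+1%:R) <= 1 :> R by rewrite mulrA; apply: ltW; near: N.
have p0 := @pi_gt0 R.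
rewrite /approx grid_elem_form; [|lra|lra|exact/ltW/step_gt0|exact/ltW/step_gt0].
set h := T / N.+1%:R in hA hd mh *; set k := pi / N.+1%:R in kA jk *.
have h0 : 0 < h by exact: step_gt0.
have k0 : 0 < k by exact: step_gt0.
pose g i := decay (rate j) t (i.+1%:R * h) - decay (rate j) s (i.+1%:R * h).
pose c l : R := eigfun j (l.+1%:R * k).
have [g1 g2] := @decay_diff_sum R (rate j) h s t N.+1 m0 h0 mh st hd.
have gL : h * (\sum_(i < N.+1) `|g i|) <= A1.
  by apply: le_mode_scale => //; rewrite mulr_ge0 ?(ltW h0)// sumr_ge0.
have q1 : `|\sum_(i < N.+1) \sum_(j < N.+1) g i * g j *
    cell (grid_cov H1 (ugrid h)) i j| <= 32 * A1 `^ (2 * H1 - 1) * A1.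
  apply: uniform_form_bound => //.
  - by rewrite H1a/= ltW.
  - by move=> i _; exact: decay_diff_le1.
  - move=> a b ab bN; apply: le_trans gL; rewrite ler_wpM2l ?(ltW h0)//.
    apply: (le_trans (ler_norm_sum _ _ _)).
    rewrite -(big_mkord xpredT (fun i => `|g i|)).
    rewrite (@big_cat_nat _ _ _ a 0 N.+1)//=; last exact: leq_trans bN.
    rewrite (@big_cat_nat _ _ _ b a N.+1)//=.
    have : 0 <= \sum_(0 <= i < a) `|g i| by rewrite sumr_ge0.
    have : 0 <= \sum_(b <= i < N.+1) `|g i| by rewrite sumr_ge0.
    lra.
have q2 : `|\sum_(i < N) \sum_(j < N) c i * c j *
    cell (grid_cov H2 (ugrid k)) i j| <= 32 * A2 `^ (2 * H2 - 1) * pi.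
  have Nk : N%:R * k <= pi.
    rewrite -[leRHS](@step_mul R pi N) ler_pM2r// ler_nat; exact: leqnSn.
  apply: uniform_form_bound => //.
  - by rewrite H2a/= ltW.
  - by move=> i _; exact: eigfun_le1.
  - by move=> a b ab bN; exact: (eig_sum_bound k0 Nk jk ab bN).
  - apply: le_trans Nk; rewrite mulrC ler_wpM2r ?(ltW k0)//.
    have -> : N%:R = \sum_(i < N) 1 :> R by rewrite sumr_const card_ord.
    by apply: ler_sum => i _; exact: eigfun_le1.
rewrite -/g -/c.
have -> : A1 `^ (2 * H1) = A1 `^ (2 * H1 - 1) * A1.
  by rewrite [RHS]mulrC mulr_powRB1 ?(ltW A0)//; lra.
apply: (le_trans (ler_norm _)); rewrite !normrM (ger0_norm (_ : 0 <= 4^-1)); last by lra.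
have := ler_pM (normr_ge0 _) (normr_ge0 _) q1 q2.
lra.
Unshelve. all: by end_near. Qed.

Definition inc_const : R :=
  512 * pi * (64 * Num.max 1 T) `^ (2 * H1) * 6 `^ (2 * H2 - 1).

Lemma inc_const_gt0 : 0 < inc_const.
Proof.
have p0 := @pi_gt0 R; rewrite /inc_const; move: (@pi R) p0 => p p0.
have m0 : 0 < 64 * Num.max 1 T by rewrite mulr_gt0// lt_max ltr01.
apply: mulr_gt0; last by apply: powR_gt0; rewrite ltr0n.
apply: mulr_gt0; last by apply: powR_gt0.
by apply: mulr_gt0 p0; rewrite ltr0n.
Qed.

(** The first factor comes from the oscillation of the cosine, the second one from
    the length and the life time of the kernel in time. *)
Lemma mode_increment j (s t : R) Wt Ws : 0 <= s -> s < t -> t <= T ->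
  wint (psi (decay (rate j) t) j) Wt -> wint (psi (decay (rate j) s) j) Ws ->
  (\int[P]_w ((Wt w - Ws w) ^+ 2)%:E <=
   (inc_const * ((j%:R + 1) `^ (1 - 2 * H2) *
      Num.min (t - s) ((j%:R + 1) ^- 4) `^ (2 * H1)))%:E)%E.
Proof.
move=> s0 st tT ht hs; have dt0 : 0 < t - s by lra.
pose G x := decay (rate j) t x - decay (rate j) s x.
have hV : wint (psi G j) (fun w => Wt w - Ws w).
  have := wint_sub ht hs.
  by have -> : (fun u => psi (decay (rate j) t) j u - psi (decay (rate j) s) j u) = psi G j
    by apply/funext => u; rewrite /psi /G mulrBl.
have mG : measurable_fun setT (G : measurableTypeR R -> R).
  by apply: measurable_funB; exact: measurable_decay.
have cv : L2sq T (fun u => elem_fun (approx T G j N) u - psi G j u) @[N --> \oo] --> 0%E.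
  apply: approx_cvg => //.
  - by move=> x y xy yx; apply: cvgB; exact: decay_right_cvg.
  - by move=> x; apply: decay_diff_le1; exact: rate_ge0.
have [N0 _ hN0] := approx_increment_bound j s0 st tT.
set c0 := (256 * _ * _) in hN0.
have mW := (let: And3 _ m _ := hV in m).
have -> : inc_const * ((j%:R + 1) `^ (1 - 2 * H2) *
    Num.min (t - s) ((j%:R + 1) ^- 4) `^ (2 * H1)) = 2 * c0.
  rewrite /c0 /inc_const /mode_scale.
  have j1 : 0 < j%:R + 1 :> R by rewrite ltr_wpDl.
  have M0 : 0 <= Num.min (t - s) ((j%:R + 1) ^- 4).
    by rewrite le_min (ltW dt0) invr_ge0 exprn_ge0// ltW.
  rewrite (powRM _ _ M0); last by rewrite mulr_ge0// le_max ler01.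
  rewrite (powRM (2 * H2 - 1))//.
  have -> : (j%:R + 1)^-1 `^ (2 * H2 - 1) = (j%:R + 1) `^ (1 - 2 * H2).
    rewrite -[(j%:R + 1)^-1]powR_inv1 ?(ltW j1)// -powRrM; congr powR; ring.
  move: (_ `^ _) (_ `^ _) (_ `^ _) (_ `^ _) (@pi R) => a b c e p; ring.
have C0 := wiener_const_ge0 T hH1 hH2.
apply/lee_addgt0Pr => r r0.
(* The extra 1 avoids a division by zero. *)
pose r' := r / (8 * wiener_const T H1 H2 + 1).
have D0 : 0 < 8 * wiener_const T H1 H2 + 1 by lra.
have r'0 : 0 < r' by rewrite divr_gt0.
have [N1 hN1] := cvge0_lt cv r'0.
pose N := maxn N0 N1.
have b1 := hN0 N (leq_maxl _ _); have b2 := hN1 N (leq_maxr _ _).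
have mE := measurable_elem_int B (approx T G j N).
have hd := wint_sub (wint_elem B (@approx_in R T hT G j N)) hV.
have b3 := wint_bound hT hH1 hH2 hB hd.
have := @integral_sqrB _ _ _ P setT measurableT (eint (approx T G j N))
  (fun w => eint (approx T G j N) w - (Wt w - Ws w)) mE (measurable_funB mE mW).
under eq_integral do rewrite subKr.
move=> /le_trans; apply.
apply: (@le_trans _ _ (2%:E * c0%:E + 2%:E * ((4 * wiener_const T H1 H2)%:E * r'%:E))%E).
  apply: leeD; apply: lee_wpmul2l => //.
  apply: (le_trans b3); apply: lee_wpmul2l; first by rewrite lee_fin mulr_ge0.
  exact: ltW.
rewrite !(=^~ EFinM, =^~ EFinD) lee_fin.
have <- : r' * (8 * wiener_const T H1 H2 + 1) = r by rewrite divfK// gt_eqF.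
lra.
Qed.

End increments.

(** * Tonelli on rectangles *)

Section tonelli.
Context d1 d2 (S1 : measurableType d1) (S2 : measurableType d2) (R : realType).
Variables (m1 : {sigma_finite_measure set S1 -> \bar R})
  (m2 : {sigma_finite_measure set S2 -> \bar R}).
Variables (D1 : set S1) (D2 : set S2).
Hypotheses (mD1 : measurable D1) (mD2 : measurable D2).

Lemma restrict_pair (f : S1 * S2 -> \bar R) x y :
  (f \_ (D1 `*` D2)) (x, y) = ((fun x => ((fun y => f (x, y)) \_ D2) y) \_ D1) x.
Proof.
rewrite !patchE; case: ifPn => [/set_mem[/= /mem_set -> /mem_set ->]//|].
case: ifPn => // /set_mem x1; case: ifPn => // /set_mem y2 /negP[].
by apply/mem_set.
Qed.

Lemma measurable_restrict (f : S1 * S2 -> \bar R) :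
  measurable_fun (D1 `*` D2) f -> measurable_fun setT (f \_ (D1 `*` D2)).
Proof.
move=> mf; apply/(measurable_restrictT _ _).1 => //; exact: measurableX.
Qed.

Lemma tonelli_on (f : S1 * S2 -> \bar R) : measurable_fun (D1 `*` D2) f ->
  (forall u, 0 <= f u)%E ->
  (\int[m1 \x m2]_(u in D1 `*` D2) f u =
   \int[m1]_(x in D1) \int[m2]_(y in D2) f (x, y))%E.
Proof.
move=> mf f0; rewrite integral_mkcond.
have p0 u : (0 <= (f \_ (D1 `*` D2)) u)%E by rewrite patchE; case: ifP.
rewrite (fubini_tonelli1 _ (measurable_restrict mf) p0) [RHS]integral_mkcond.
apply: eq_integral => x _; rewrite /fubini_F [RHS]patchE.
under eq_integral do rewrite restrict_pair patchE.
by case: ifPn => _; [rewrite [RHS]integral_mkcond|rewrite integral0].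
Qed.

Lemma tonelli_swap (f : S1 * S2 -> \bar R) : measurable_fun (D1 `*` D2) f ->
  (forall u, 0 <= f u)%E ->
  (\int[m1]_(x in D1) \int[m2]_(y in D2) f (x, y) =
   \int[m2]_(y in D2) \int[m1]_(x in D1) f (x, y))%E.
Proof.
move=> mf f0; rewrite -tonelli_on// integral_mkcond.
have p0 u : (0 <= (f \_ (D1 `*` D2)) u)%E by rewrite patchE; case: ifP.
rewrite (fubini_tonelli2 _ (measurable_restrict mf) p0) [RHS]integral_mkcond.
apply: eq_integral => y _; rewrite /fubini_G [RHS]patchE.
have [yD|yD] := boolP (y \in D2).
  rewrite [RHS]integral_mkcond; apply: eq_integral => x _.
  by rewrite restrict_pair !patchE yD.
apply: integral0_eq => x _; rewrite restrict_pair !patchE (negPf yD).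
by case: ifP.
Qed.

Lemma measurable_section_integral (f : S1 * S2 -> \bar R) :
  measurable_fun (D1 `*` D2) f -> (forall u, 0 <= f u)%E ->
  measurable_fun D1 (fun x => \int[m2]_(y in D2) f (x, y))%E.
Proof.
move=> mf f0.
have p0 u : (0 <= (f \_ (D1 `*` D2)) u)%E by rewrite patchE; case: ifP.
have := @measurable_fun_fubini_tonelli_F _ _ _ _ _ m2 _ (measurable_restrict mf) p0.
move=> /(measurable_funS measurableT (@subsetT _ D1)); apply: eq_measurable_fun.
move=> x /set_mem D1x; rewrite /fubini_F [RHS]integral_mkcond.
by apply: eq_integral => y _; rewrite restrict_pair patchE mem_set.
Qed.

End tonelli.

(** * Orthonormality of the cosine basis *)

Section orthonormal.
Context {R : realType}.
Local Notation leb := (@lebesgue_measure R).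

Lemma continuous_FTC2_derive (f F : R -> R) a b : a < b -> continuous f ->
  (forall x : R, is_derive x 1 F (f x)) ->
  (\int[leb]_(x in `]a, b[) (f x)%:E = (F b - F a)%:E)%E.
Proof.
move=> ab cf dF.
have cF : continuous F.
  by move=> x; apply/differentiable_continuous/derivable1_diffP; exact: (@ex_derive _ _ _ _ _ _ _ (dF x)).
have mf : measurable_fun setT (f : measurableTypeR R -> R) by exact: continuous_measurable_fun.
rewrite -(integral_itv_bndoo true false); last first.
  by apply/measurable_EFinP; apply: measurable_funTS; exact: mf.
rewrite (@continuous_FTC2 _ f F)//.
- exact/continuous_subspaceT.
- split => //.
  + by apply: cvg_at_right_filter; exact: cF.
  + by apply: cvg_at_left_filter; exact: cF.
- by move=> x _; rewrite derive1E; exact: (@derive_val _ _ _ _ _ _ _ (dF x)).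
Qed.

Lemma sin_int_pi (n : nat) : sin (n%:R * pi) = 0 :> R.
Proof.
elim: n => [|n IH]; first by rewrite mul0r sin0.
by rewrite -natr1 mulrDl mul1r sinDpi IH oppr0.
Qed.

Lemma integral_cos_int (n : nat) : (0 < n)%N ->
  (\int[leb]_(x in dom) (cos (n%:R * x))%:E = 0)%E.
Proof.
move=> n0; have n0' : n%:R != 0 :> R by rewrite pnatr_eq0 -lt0n.
have := @continuous_FTC2_derive (fun x => cos (n%:R * x))
  (fun x => n%:R^-1 * sin (n%:R * x)) 0 pi (pi_gt0 R).
rewrite sin_int_pi !mulr0 sin0 mulr0 subrr => h; apply: h.
- move=> x; apply: continuous_comp; last exact: continuous_cos.
  exact: mulrl_continuous.
- move=> x; apply: is_derive_eq.
  by rewrite /GRing.scale/= mulr1 mulrCA mulVf// mulr1.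
Qed.

Lemma ampl_sqr j : ampl j ^+ 2 * pi = (if j is 0%N then 1 else 2) :> R.
Proof.
have p0 := @pi_gt0 R.
by case: j => [|j]; rewrite /ampl sqr_sqrtr ?divr_ge0 ?(ltW p0)// divfK// gt_eqF.
Qed.

Lemma integrable_dom_continuous (f : R -> R) : continuous f ->
  leb.-integrable dom (EFin \o f).
Proof.
move=> cf; apply: (@integrableS _ _ _ leb `[0, pi]%classic) => //.
- exact: measurable_dom.
- by move=> x /=; rewrite /dom /= !in_itv/= => /andP[/ltW -> /ltW ->].
- apply: continuous_compact_integrable; first exact: segment_compact.
  exact/continuous_subspaceT.
Qed.

Lemma continuous_eigfun j : continuous (eigfun j : R -> R).
Proof.
have -> : eigfun j = (fun x : R => ampl j * cos (j%:R * x)).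
  by apply/funext => x; exact: eigfunE.
move=> x; apply: cvgMr.
by apply: continuous_comp; [exact: mulrl_continuous|exact: continuous_cos].
Qed.

Lemma integrable_eigfunM j k : leb.-integrable dom (fun x => (eigfun j x * eigfun k x)%:E).
Proof.
apply: integrable_dom_continuous => x; apply: cvgM; exact: continuous_eigfun.
Qed.

Lemma integrable_cos_nat n : leb.-integrable dom (fun x => (cos (n%:R * x))%:E).
Proof.
apply: integrable_dom_continuous => x.
by apply: continuous_comp; [exact: mulrl_continuous|exact: continuous_cos].
Qed.

Lemma eigfun_orthonormal j k :
  (\int[leb]_(x in dom) (eigfun j x * eigfun k x)%:E = (j == k)%:R%:E)%E.
Proof.
wlog jk : j k / (k <= j)%N.
  move=> W; have [/W//|/ltnW/W] := leqP k j.
  by rewrite eq_sym => <-; apply: eq_integral => x _; rewrite mulrC.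
have E (x : R) : eigfun j x * eigfun k x = ampl j * ampl k / 2 *
    (cos ((j + k)%:R * x) + cos ((j - k)%:R * x)).
  rewrite !eigfunE natrD natrB// mulrDl mulrBl cosD cosB.
  move: (cos _) (sin _) (cos _) (sin _) (ampl _) (ampl _) => a b c e f g; by field.
under eq_integral do rewrite E EFinM EFinD.
rewrite integralZl//; last 2 first.
- exact: measurable_dom.
- by apply: integrableD; [exact: measurable_dom|exact: integrable_cos_nat|exact: integrable_cos_nat].
rewrite integralD; [|exact: measurable_dom|exact: integrable_cos_nat|exact: integrable_cos_nat].
have dom1 : (\int[leb]_(x in dom) (cos ((0%N)%:R * x))%:E = (pi : R)%:E)%E.
  under eq_integral do rewrite mul0r cos0.
  rewrite integral_cst; last exact: measurable_dom.
  by rewrite mul1e /dom/= lebesgue_measure_itv/= lte_fin pi_gt0 -EFinB subr0.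
have [->|jk'] := eqVneq j k.
  rewrite subnn dom1; have [->|k0] := posnP k.
    rewrite addn0 dom1 -EFinD -EFinM; congr EFin.
    have := ampl_sqr 0; move: (@pi R) (ampl 0) => p a /= e.
    by have -> : a * a / 2 * (p + p) = a ^+ 2 * p by [field].
  rewrite integral_cos_int ?addn_gt0 ?k0// add0e -EFinM; congr EFin.
  have := ampl_sqr k; case: k k0 {jk E} => // k _.
  by move: (@pi R) (ampl _) => p a e; have -> : a * a / 2 * p = a ^+ 2 * p / 2 by [field]; rewrite e divff.
have lt : (k < j)%N by rewrite ltn_neqAle eq_sym jk'.
by rewrite !integral_cos_int ?subn_gt0 ?addn_gt0 ?(leq_ltn_trans _ lt)// adde0 mule0.
Qed.

Lemma eigfun_parseval n (a : 'I_n -> R) :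
  (\int[leb]_(x in dom) ((\sum_i a i * eigfun i x) ^+ 2)%:E = (\sum_i a i ^+ 2)%:E)%E.
Proof.
rewrite (@integral_gram _ _ _ leb dom measurable_dom n a (fun i => eigfun i)
  (fun i j => (i == j)%:R)).
- congr EFin; apply: eq_bigr => i _; rewrite (bigD1 i)//= big1 ?addr0.
    by rewrite eqxx mulr1 expr2.
  by move=> j /negPf ji; rewrite eq_sym ji mulr0.
- by move=> i j; exact: integrable_eigfunM.
- by move=> i j; exact: eigfun_orthonormal.
Qed.

End orthonormal.

(** * The kernel of the stochastic convolution *)

Section convolution_kernel.
Context {R : realType}.
Variable T : R.
Hypothesis hT : 0 < T.
Local Notation leb := (@lebesgue_measure R).
Local Notation leb2 := (leb \x leb)%E.
Local Notation rate := (@rate R).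

Lemma integral_decay_sqr (m t : R) : 0 < m -> t <= T ->
  (\int[leb]_(s in `[0%R, T]) (decay m t s ^+ 2)%:E <= ((2 * m)^-1)%:E)%E.
Proof.
move=> m0 tT; have [t0|t0] := leP t 0.
  rewrite integral0_eq ?lee_fin ?invr_ge0 ?mulr_ge0 ?(ltW m0)//.
  move=> s /=; rewrite in_itv/= => /andP[s0 _].
  by rewrite /decay ltNge (le_trans t0 s0)/= expr0n.
pose f (s : R) := expR (2 * m * (s - t)).
have E : {in `[0, T]%classic, forall s, (decay m t s ^+ 2)%:E = ((EFin \o f) \_ `[0, t[) s}.
  move=> s /set_mem/=; rewrite in_itv/= => /andP[s0 _]; rewrite patchE.
  rewrite /decay; have [st|ts] := ltP s t; last first.
    by rewrite expr0n/= memNset//= in_itv/= ltNge ts andbF.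
  rewrite mem_set/= ?in_itv/= ?s0// /f -expRM_natl; congr (expR _)%:E; ring.
have -> : (\int[leb]_(s in `[0%R, T]) (decay m t s ^+ 2)%:E =
    \int[leb]_(s in `[0%R, T]) ((EFin \o f) \_ `[0%R, t[%classic) s)%E by exact: eq_integral.
rewrite -integral_mkcondr setIidr; last first.
  by move=> s /=; rewrite !in_itv/= => /andP[-> /ltW/le_trans->].
have cf : continuous f.
  move=> x; apply: continuous_comp; last exact: continuous_expR.
  by apply: cvgM; [exact: cvg_cst|apply: cvgB => //; exact: cvg_cst].
rewrite integral_itv_bndoo; last first.
  apply/measurable_EFinP; apply: measurable_funTS.
  exact: (continuous_measurable_fun cf).
have h := @continuous_FTC2_derive R f (fun s => (2 * m)^-1 * expR (2 * m * (s - t))) 0 t t0 cf.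
have dF (x : R) : is_derive x 1 (fun s => (2 * m)^-1 * expR (2 * m * (s - t))) (f x).
  rewrite /f; apply: is_derive_eq.
  rewrite /GRing.scale/=; move: (expR _) => e; field.
  by rewrite gt_eqF.
apply: (@le_trans _ _ (\int[leb]_(x in `]0%R, t[) (f x)%:E)%E) => //.
have {}h := h dF; move: h => /= h; have -> : (\int[leb]_(x in `]0%R, t[) (f x)%:E = _)%E := h.
rewrite lee_fin subrr mulr0 expR0 mulr1 gerBl mulr_ge0 ?expR_ge0// invr_ge0.
by rewrite mulr_ge0// ltW.
Qed.

(** For k > 0, the squared L2 norm of exp (- k^4 s) over all s > 0. *)
Definition kernel_bound (k : nat) : R := if k is 0%N then T else (2 * k%:R ^+ 4)^-1.

Lemma kernel_bound_ge0 k : 0 <= kernel_bound k.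
Proof.
by case: k => [|k]; rewrite /kernel_bound ?(ltW hT)// invr_ge0 mulr_ge0// exprn_ge0.
Qed.

Lemma integral_decay_rate (k : nat) t : t <= T ->
  (\int[leb]_(s in `[0%R, T]) (decay (rate k) t s ^+ 2)%:E <= (kernel_bound k)%:E)%E.
Proof.
move=> tT; case: k => [|k].
  apply: (@le_trans _ _ (\int[leb]_(s in `[0%R, T]) 1%:E)%E).
    apply: ge0_le_integral => //=.
    - by move=> s _; rewrite lee_fin sqr_ge0.
    - by apply/measurable_EFinP; apply: measurable_funX; exact: measurable_decay.
    - move=> s _; rewrite lee_fin exprn_ile1 ?decay_ge0// decay_le1//; exact: rate_ge0.
  rewrite integral_cst//= lebesgue_measure_itv/= lte_fin hT mul1e.
  by rewrite -EFinB subr0.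
apply: le_trans (integral_decay_sqr _ tT) _.
  by rewrite /rate /eigval exprn_gt0// exprn_gt0// ltr0n.
by rewrite lee_fin /kernel_bound /rate /eigval -exprM.
Qed.

(** Orthonormality in space at each fixed time, then integration in time. *)
Lemma L2sq_modes n (a : 'I_n -> R) t : t <= T ->
  (L2sq T (fun u => (\sum_i a i * psi (decay (rate i) t) i u)%R) <=
   (\sum_i a i ^+ 2 * kernel_bound i)%:E)%E.
Proof.
move=> tT; rewrite /L2sq /tdom.
have md k D : measurable_fun D (decay (rate k) t : measurableTypeR R -> R).
  exact: measurable_decay.
have mS : measurable_fun (tdom T) (fun u : measurableTypeR R * measurableTypeR R =>
    \sum_i a i * psi (decay (rate i) t) i u).
  apply: measurable_sum => i; apply: measurable_funM; first exact: measurable_cst.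
  by apply: measurable_psi; exact: md.
rewrite (@tonelli_on _ _ _ _ R leb leb _ _ (measurable_itv _) measurable_dom); last 2 first.
- exact: measurable_sqr.
- by move=> u; rewrite lee_fin sqr_ge0.
have -> : (\int[leb]_(s in `[0%R, T]) \int[leb]_(y in dom)
      ((\sum_i a i * psi (decay (rate i) t) i (s, y)) ^+ 2)%:E =
    \int[leb]_(s in `[0%R, T]) \sum_i ((a i ^+ 2)%:E * (decay (rate i) t s ^+ 2)%:E))%E.
  apply: eq_integral => s _; transitivity (\int[leb]_(y in dom)
      ((\sum_i (a i * decay (rate i) t s) * eigfun i y) ^+ 2)%:E)%E.
    by apply: eq_integral => y _; congr ((_ ^+ 2)%:E); apply: eq_bigr => i _; rewrite mulrA.
  by rewrite eigfun_parseval -sumEFin; apply: eq_bigr => i _; rewrite exprMn EFinM.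
rewrite ge0_integral_sum//=; last 2 first.
- by move=> i; apply: measurable_funeM; apply/measurable_EFinP; apply: measurable_funX; exact: md.
- by move=> i s _; rewrite mule_ge0// lee_fin sqr_ge0.
rewrite -sumEFin; apply: lee_sum => i _.
rewrite ge0_integralZl//=.
- rewrite (EFinM (a i ^+ 2) (kernel_bound i)); apply: lee_wpmul2l; first by rewrite lee_fin sqr_ge0.
  exact: integral_decay_rate.
- by apply/measurable_EFinP; apply: measurable_funX; exact: md.
- by move=> s _; rewrite lee_fin sqr_ge0.
- by rewrite lee_fin sqr_ge0.
Qed.

Lemma L2sq_fatou (F : nat -> R * R -> R) (G : R * R -> R) (c : \bar R) :
  (forall n, measurable_fun (tdom T) (F n : measurableTypeR R * measurableTypeR R -> R)) ->
  (forall u, tdom T u -> F n u @[n --> \oo] --> G u) ->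
  (forall n, L2sq T (F n) <= c)%E -> (L2sq T G <= c)%E.
Proof.
move=> mF FG Fc; have mD := measurable_tdom T.
have mF2 n : measurable_fun (tdom T) (fun u : measurableTypeR R * measurableTypeR R => (F n u ^+ 2)%:E).
  exact: measurable_sqr.
have F0 n u : tdom T u -> (0 <= (F n u ^+ 2)%:E)%E by rewrite lee_fin sqr_ge0.
have := fatou leb2 mD mF2 F0; rewrite /L2sq.
have -> : (\int[leb2]_(u in tdom T) limn_einf (fun n => (F n u ^+ 2)%:E) =
    \int[leb2]_(u in tdom T) (G u ^+ 2)%:E)%E.
  apply: eq_integral => u /set_mem Du.
  have cv : (F n u ^+ 2)%:E @[n --> \oo] --> (G u ^+ 2)%:E.
    apply/fine_cvgP; split; first exact: nearW.
    rewrite /= expr2; under eq_fun do rewrite /= expr2.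
    by apply: cvgM; exact: FG.
  by have [-> _] := cvg_limn_einf_sup cv.
move=> /le_trans; apply; rewrite limn_einf_lim; apply: lime_le.
  exact: is_cvg_einfs.
apply: nearW => n; apply: le_trans (Fc n).
by apply: ereal_inf_lbound; exists n => /=.
Qed.

Lemma green_series_cvg (tau x y : R) : 0 < tau ->
  cvgn (series (fun j => expR (- eigval R j ^+ 2 * tau) * eigfun j x * eigfun j y)).
Proof.
move=> tau0; apply: normed_cvg.
apply: (@series_le_cvg _ _ (geometric 1 (expR (- tau)))).
- by move=> n /=.
- by move=> n; rewrite /geometric/= mul1r exprn_ge0// expR_ge0.
- move=> n; rewrite /= /geometric/= mul1r !normrM (ger0_norm (expR_ge0 _)) -expRM_natl.
  apply: (@le_trans _ _ (expR (- eigval R n ^+ 2 * tau))).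
    rewrite -mulrA ler_piMr ?expR_ge0// mulr_ile1 ?eigfun_le1//.
  rewrite ler_expR mulrN mulNr lerN2 ler_pM2r// /eigval -exprM.
  case: n => [|n]; first by rewrite expr0n.
  by rewrite -natrX ler_nat; rewrite -[leqLHS]expn1 leq_pexp2l.
- apply: is_cvg_geometric_series; rewrite ger0_norm ?expR_ge0//.
  by rewrite -[ltRHS]expR0 ltr_expR oppr_lt0.
Qed.

Lemma convolution_integrand_cvg (t x : R) u : tdom T u ->
  \sum_(i < n) eigfun i x * psi (decay (rate i) t) i u @[n --> \oo]
    --> convolution_integrand t x u.
Proof.
case: u => s y [/=]; rewrite in_itv/= => /andP[s0 sT] Dy.
rewrite /convolution_integrand/= indicE; have [st|ts] := ltP s t; last first.
  rewrite memNset ?mul0r; last by move=> [/=]; rewrite in_itv/= s0 ltNge ts.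
  have -> : (fun n => \sum_(i < n) eigfun i x * psi (decay (rate i) t) i (s, y)) = (fun=> 0).
    by apply/funext => n; apply: big1 => i _; rewrite /psi /= /decay ltNge ts mul0r mulr0.
  exact: cvg_cst.
rewrite mem_set ?mul1r; last by split => //=; rewrite in_itv/= s0.
have : 0 < t - s by lra.
move=> h; have := @green_series_cvg _ x y h; rewrite -/(green (t - s) x y).
rewrite (_ : series _ = (fun n => \sum_(i < n) eigfun i x * psi (decay (rate i) t) i (s, y)))//.
apply/funext => n; rewrite /series/= big_mkord; apply: eq_bigr => i _.
rewrite /psi/= /decay st /rate mulNr; ring.
Qed.

(** Comparison with the telescoping series of 1 / k - 1 / (k + 1). *)
Lemma sum_inv_quad_le (N n : nat) : (0 < N)%N ->
  \sum_(i < n) (if (i < N)%N then 0 else ((2 * i%:R ^+ 2)^-1 : R)) <= N%:R^-1.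
Proof.
move=> N0; have N0' : 0 < N%:R :> R by rewrite ltr0n.
have [nN|Nn] := leqP n N.
  rewrite big1 ?invr_ge0 ?(ltW N0')// => i _.
  by rewrite (leq_trans (ltn_ord i) nN).
suff: \sum_(i < n) (if (i < N)%N then 0 else ((2 * i%:R ^+ 2)^-1 : R)) <= N%:R^-1 - n%:R^-1.
  by move=> /le_trans; apply; rewrite gerBl invr_ge0.
have : forall m, (N <= m)%N ->
  \sum_(i < m) (if (i < N)%N then 0 else ((2 * i%:R ^+ 2)^-1 : R)) <= N%:R^-1 - m%:R^-1.
  elim=> [|m IH Nm]; first by rewrite leqn0 => /eqP Nz; rewrite Nz in N0.
  rewrite big_ord_recr/=; move: Nm; rewrite leq_eqVlt => /orP[/eqP Nm|Nm].
    rewrite Nm ltnSn addr0 subrr big1// => i _.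
    by rewrite ltnS ltnW.
  have {}Nm : (N <= m)%N by rewrite -ltnS.
  rewrite ltnNge Nm/=; have := IH Nm.
  have m1 : 1 <= m%:R :> R by rewrite ler1n (leq_trans N0).
  have : (2 * m%:R ^+ 2)^-1 <= m%:R^-1 - m.+1%:R^-1 :> R.
    rewrite -[m.+1%:R]natr1; move: (m%:R : R) m1 => r r1.
    have -> : r^-1 - (r + 1)^-1 = (r * (r + 1))^-1 by field; lra.
    by rewrite lef_pV2 ?posrE; nra.
  by move=> h1 h2; apply: (le_trans (lerD h2 h1)); rewrite addrA subrK.
by apply; exact: ltnW.
Qed.

(** By Fatou's lemma finite blocks are enough, and their squared norms are at most
    tails of a convergent series that does not involve x. *)
Lemma convolution_tail (t x : R) N : t <= T -> (0 < N)%N ->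
  (L2sq T (fun u => (convolution_integrand t x u -
     \sum_(i < N) eigfun i x * psi (decay (rate i) t) i u)%R) <= (N%:R^-1)%:E)%E.
Proof.
move=> tT N0; pose c n (i : 'I_n) : R := if (i < N)%N then 0 else eigfun i x.
apply: (@L2sq_fatou (fun M u => \sum_(i < N + M) c _ i * psi (decay (rate i) t) i u)).
- move=> n; apply: measurable_sum => i; apply: measurable_funM; first exact: measurable_cst.
  by apply: measurable_psi; exact: measurable_decay.
- move=> u Du; have := @convolution_integrand_cvg t x u Du.
  rewrite -(cvg_shiftn N) => cv.
  have E M : \sum_(i < N + M) c _ i * psi (decay (rate i) t) i u =
     \sum_(i < M + N) eigfun i x * psi (decay (rate i) t) i u -
     \sum_(i < N) eigfun i x * psi (decay (rate i) t) i u.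
    rewrite [(M + N)%N]addnC !big_split_ord/= addrAC subrr add0r big1 ?add0r => [|i _].
      by apply: eq_bigr => i _; rewrite /c /= ltnNge leq_addr.
    by rewrite /c /= ltn_ord mul0r.
  under eq_fun do rewrite E.
  by apply: cvgB => //; exact: cvg_cst.
- move=> n; apply: (le_trans (L2sq_modes _ tT)); rewrite lee_fin.
  apply: le_trans (sum_inv_quad_le (N + n) N0); apply: ler_sum => i _.
  rewrite /c; case: ifPn => [_|]; first by rewrite expr0n/= mul0r.
  rewrite -leqNgt => Ni; have i0 : (0 < i)%N by exact: leq_trans Ni.
  have i1 : 1 <= i%:R :> R by rewrite ler1n.
  apply: (@le_trans _ _ (kernel_bound i)).
    rewrite ler_piMl ?kernel_bound_ge0// -[leRHS](expr1n _ 2) -[leLHS]real_normK ?num_real//.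
    by apply: lerXn2r; rewrite ?nnegrE// eigfun_le1.
  case: (nat_of_ord i) i0 i1 => // k _ k1; rewrite /kernel_bound lef_pV2 ?posrE.
  + by rewrite ler_pM2l// ler_weXn2l.
  + by rewrite mulr_gt0// exprn_gt0// ltr0n.
  + by rewrite mulr_gt0// exprn_gt0// ltr0n.
Qed.

Lemma eigfun_lipschitz k (x z : R) : `|eigfun k x - eigfun k z| <= k%:R * `|x - z|.
Proof.
rewrite !eigfunE -mulrBr normrM (ger0_norm (ampl_ge0 k)).
apply: (@le_trans _ _ `|cos (k%:R * x) - cos (k%:R * z)|).
  by rewrite ler_piMl// ampl_le1.
by apply: (le_trans (cos_lipschitz _ _)); rewrite -mulrBr normrM ger0_norm.
Qed.

(** The Lipschitz constants of the basis cost a factor k^2 and leave the series of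
    k^2 / (2 k^4). Orthogonality is essential: the triangle inequality would lead
    to the divergent series of 1 / k. *)
Lemma convolution_lipschitz (t x z : R) : t <= T ->
  (L2sq T (fun u => (convolution_integrand t x u - convolution_integrand t z u)%R)
    <= (`|x - z| ^+ 2)%:E)%E.
Proof.
move=> tT.
apply: (@L2sq_fatou (fun M u => \sum_(i < M) (eigfun i x - eigfun i z) * psi (decay (rate i) t) i u)).
- move=> n; apply: measurable_sum => i; apply: measurable_funM; first exact: measurable_cst.
  by apply: measurable_psi; exact: measurable_decay.
- move=> u Du.
  under eq_fun do under eq_bigr do rewrite mulrBl.
  under eq_fun do rewrite sumrB.
  by apply: cvgB; exact: convolution_integrand_cvg.
- move=> n; apply: (le_trans (L2sq_modes _ tT)); rewrite lee_fin.
  apply: (@le_trans _ _ (\sum_(i < n) `|x - z| ^+ 2 *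
      (if (i < 1)%N then 0 else (2 * i%:R ^+ 2)^-1))); last first.
    by rewrite -mulr_sumr -[leRHS]mulr1 ler_wpM2l ?sqr_ge0//; have := @sum_inv_quad_le 1 n isT; rewrite invr1.
  apply: ler_sum => i _; have := eigfun_lipschitz i x z.
  case: (nat_of_ord i) => [|k] /=.
    by rewrite mul0r normr_le0 => /eqP ->; rewrite expr0n/= mul0r mulr0.
  move=> h; have k0 : 0 < k.+1%:R :> R by rewrite ltr0n.
  have h2 : (eigfun k.+1 x - eigfun k.+1 z) ^+ 2 <= (k.+1%:R * `|x - z|) ^+ 2.
    rewrite -[leLHS]real_normK ?num_real//.
    by apply: lerXn2r; rewrite ?nnegrE// mulr_ge0// ltW.
  rewrite /kernel_bound; apply: (@le_trans _ _ ((k.+1%:R * `|x - z|) ^+ 2 * (2 * k.+1%:R ^+ 4)^-1)).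
    by rewrite ler_wpM2r// invr_ge0 mulr_ge0// exprn_ge0// ltW.
  move: k0 {h h2}; move: (k.+1%:R : R) (`|x - z|) => r e r0.
  rewrite le_eqVlt; apply/orP; left; apply/eqP; field.
  by rewrite gt_eqF.
Qed.

End convolution_kernel.

(** * Inequalities between powers *)

Section power_interpolation.
Context {R : realType}.

(** Split at y = l. This trades a real power for an integer one, at the expected
    size l of y. *)
Lemma powR_le_interp (p l y : R) (k : nat) : 1 <= p -> p <= k%:R -> 0 < l -> 0 <= y ->
  y `^ p <= l `^ p * (1 + (l ^+ k)^-1 * y ^+ k).
Proof.
move=> p1 pk l0 y0; have -> : y = l * (y / l) by rewrite mulrC divfK// gt_eqF.
set r := y / l; have r0 : 0 <= r by rewrite divr_ge0// ltW.
rewrite powRM ?(ltW l0)// exprMn mulKf ?expf_neq0 ?gt_eqF// ler_wpM2l ?powR_ge0//.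
have rk : 0 <= r ^+ k by rewrite exprn_ge0.
have [r1|r1] := leP r 1.
  apply: (@le_trans _ _ (1 `^ p)); last by rewrite powR1; lra.
  by rewrite ge0_ler_powR ?nnegrE//; lra.
by rewrite -[X in _ <= 1 + X]powR_mulrn//; apply: le_trans (ler_powR (ltW r1) pk) _; lra.
Qed.

Lemma min_powR_le (a b q th : R) : 0 < a -> 0 < b -> 0 <= th <= q ->
  Num.min a b `^ q <= a `^ th * b `^ (q - th).
Proof.
move=> a0 b0 /andP[th0 thq]; have m0 : 0 < Num.min a b by rewrite lt_min a0.
have -> : Num.min a b `^ q = Num.min a b `^ th * Num.min a b `^ (q - th).
  by rewrite -powRD; [congr powR; lra|rewrite (gt_eqF m0) implybT].
apply: ler_pM; rewrite ?powR_ge0//; apply: ge0_ler_powR;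
  rewrite ?nnegrE ?(ltW m0) ?(ltW a0) ?(ltW b0) ?subr_ge0 ?ge_min ?lexx ?orbT//.
Qed.

End power_interpolation.

(** * Spectral expansion of the stochastic convolution *)

Section modes.
Context d (Omega : measurableType d) (R : realType) (P : probability Omega R)
  (T H1 H2 sigma : R) (B : R -> R -> {RV P >-> R}) (o : R -> R -> Omega -> R).
Hypotheses (hT : 0 < T) (hH1 : 2^-1 <= H1 < 1) (hH2 : 2^-1 <= H2 < 1)
  (hB : fractional_brownian_sheet T H1 H2 B)
  (ho : stochastic_convolution P T sigma (fun t x w => B t x w) o).
Local Notation wint := (wiener_integral P T (fun t x w => B t x w)).

Lemma measurable_field_section (v : R -> R -> Omega -> R) (t x : R) : measurable_field T v ->
  0 <= t <= T -> 0 < x < pi -> measurable_fun setT (v t x).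
Proof.
move=> mv t0 x0; have mD : measurable ([set: Omega] `*` (dom : set (measurableTypeR R))).
  by apply: measurableX => //; exact: measurable_dom.
have mp : measurable_fun setT (fun w : Omega => (w, x : measurableTypeR R)).
  by exact: measurable_pair2.
apply: (measurable_comp mD _ (mv t t0) mp).
by move=> _ [w _ <-]; split => //=; rewrite /dom/= in_itv.
Qed.

(** What the remaining arguments use of the modes. They vanish at time 0
    everywhere, and not only almost surely, so that chaining can start from 0. *)
Definition mode_interface (W : nat -> R -> Omega -> R) : Prop :=
  [/\ forall j t, measurable_fun setT (W j t),
      forall k th, (0 < k)%N -> 0 <= th <= H1 -> exists C : R, 0 < C /\
        forall j (s t : R), 0 <= s -> s < t -> t <= T ->
        (\int[P]_w ((W j t w - W j s w) ^+ k.*2)%:E <=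
         (C * ((j%:R + 1) `^ (1 - 2 * H2 - 8 * H1 + 8 * th) * (t - s) `^ (2 * th)) ^+ k)%:E)%E,
      forall j w, W j 0 w = 0
    & exists C : R, 0 <= C /\ forall (t x : R) N, 0 <= t <= T -> 0 < x < pi -> (0 < N)%N ->
        (\int[P]_w ((o t x w - \sum_(i < N) eigfun i x * W i t w) ^+ 2)%:E <=
         (C / N%:R)%:E)%E].

(** Interpolation between the two arguments of the minimum. *)
Lemma mode_increment_power j (th s t : R) Wt Ws : 0 <= th <= H1 -> 0 <= s -> s < t -> t <= T ->
  wint (psi (decay (rate R j) t) j) Wt -> wint (psi (decay (rate R j) s) j) Ws ->
  (\int[P]_w ((Wt w - Ws w) ^+ 2)%:E <= (inc_const T H1 H2 *
     ((j%:R + 1) `^ (1 - 2 * H2 - 8 * H1 + 8 * th) * (t - s) `^ (2 * th)))%:E)%E.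
Proof.
move=> /andP[th0 th1] s0 st tT ht hs.
apply: (le_trans (mode_increment hT hH1 hH2 hB s0 st tT ht hs)); rewrite lee_fin.
apply: ler_wpM2l; first exact/ltW/inc_const_gt0.
have j1 : 0 < j%:R + 1 :> R by rewrite ltr_wpDl.
have -> : 1 - 2 * H2 - 8 * H1 + 8 * th = (1 - 2 * H2) + (- 4) * (2 * H1 - 2 * th) by ring.
rewrite (@powRD _ _ (1 - 2 * H2)); last by rewrite (gt_eqF j1) implybT.
rewrite -[leRHS]mulrA ler_wpM2l ?powR_ge0// [leRHS]mulrC.
apply: (le_trans (@min_powR_le _ (t - s) ((j%:R + 1) ^- 4) (2 * H1) (2 * th) _ _ _)) => //.
- by rewrite subr_gt0.
- by apply/andP; split; lra.
rewrite (powRrM (j%:R + 1) (- 4)) powRN (_ : (j%:R + 1) `^ 4 = (j%:R + 1) ^+ 4)//.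
by rewrite -powR_mulrn ?(ltW j1).
Qed.

Lemma modes_exist : exists W, mode_interface W.
Proof.
have C0 := wiener_const_ge0 T hH1 hH2; have I0 := inc_const_gt0 T H1 H2.
pose V j t := sval (cid (mode_exists hT hH1 hH2 hB j t)).
have hV j t : wint (psi (decay (rate R j) t) j) (V j t) := svalP (cid _).
have mV j t : measurable_fun setT (V j t) by have [_ m _] := hV j t.
have V0 j : {ae P, forall w, V j 0 w = 0}.
  have z : (\int[P]_w (V j 0 w ^+ 2)%:E = 0)%E.
    apply/eqP; rewrite eq_le integral_ge0 ?andbT; last by move=> w _; rewrite lee_fin sqr_ge0.
    apply: (le_trans (wint_bound hT hH1 hH2 hB (hV j 0))).
    have -> : (L2sq T (psi (decay (rate R j) 0) j) = 0)%E.
      apply: integral0_eq => -[s y] [/=]; rewrite in_itv/= => /andP[s0 _] _.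
      by rewrite /psi /decay/= ltNge s0/= mul0r expr0n.
    by rewrite mule0.
  have mV2 : measurable_fun setT (fun w => (V j 0 w ^+ 2)%:E).
    by apply/measurable_EFinP; exact: measurable_funX.
  have : (\int[P]_w `|(V j 0 w ^+ 2)%:E| = 0)%E.
    by rewrite -{}[RHS]z; apply: eq_integral => w _; rewrite gee0_abs// lee_fin sqr_ge0.
  move=> /(ae_eq_integral_abs P measurableT mV2).1; apply: filterS => w /(_ I) h.
  by have /eqP := h; rewrite eqe sqrf_eq0 => /eqP.
exists (fun j t w => sigma * (V j t w - V j 0 w)); split.
- by move=> j t; apply: measurable_funM; [exact: measurable_cst|exact: measurable_funB].
- move=> k th k0 hth; have [C [Cp hC]] := wint_moment hB k0.
  exists (C * inc_const T H1 H2 ^+ k * (sigma ^+ k.*2 + 1)); split.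
    by rewrite mulr_gt0 ?mulr_gt0 ?exprn_gt0// ltr_wpDl// exprn_even_ge0// odd_double.
  move=> j s t s0 st tT; set v := (_ `^ _ * _).
  have v0 : 0 < v.
    by rewrite mulr_gt0// powR_gt0 ?subr_gt0// ltr_wpDl.
  have b := mode_increment_power hth s0 st tT (hV j t) (hV j s).
  have := hC _ _ _ (wint_sub (hV j t) (hV j s)) (mulr_gt0 I0 v0) b.
  set I := (\int[P]_w _)%E; move=> {}b.
  apply: (@le_trans _ _ ((sigma ^+ k.*2)%:E * I)%E).
    rewrite -ge0_integralZl//.
    + rewrite le_eqVlt; apply/orP; left; apply/eqP; apply: eq_integral => w _.
      by rewrite -EFinM -exprMn -mulrBr opprB addrA subrK.
    + by apply/measurable_EFinP; apply: measurable_funX; exact: measurable_funB.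
    + by move=> w _; rewrite lee_fin exprn_even_ge0// odd_double.
    + by rewrite lee_fin exprn_even_ge0// odd_double.
  apply: (@le_trans _ _ ((sigma ^+ k.*2)%:E * (C * (inc_const T H1 H2 * v) ^+ k)%:E)%E).
    by apply: lee_wpmul2l => //; rewrite lee_fin exprn_even_ge0// odd_double.
  rewrite -EFinM lee_fin exprMn.
  have : 0 <= C * (inc_const T H1 H2 ^+ k * v ^+ k).
    by rewrite !mulr_ge0 ?exprn_ge0 ?(ltW Cp) ?(ltW I0) ?(ltW v0).
  move: (C) (inc_const _ _ _ ^+ k) (v ^+ k) (sigma ^+ _) => a b' c e h; nra.
- by move=> j w; rewrite subrr mulr0.
- exists (sigma ^+ 2 * (4 * wiener_const T H1 H2)); split.
    by apply: mulr_ge0; [exact: sqr_ge0|exact: mulr_ge0].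
  move=> t x N t0 x0 N0; have [mo /(_ t x t0 x0)[Z [hZ oZ]]] := ho.
  have mZ : measurable_fun setT Z by have [_ m _] := hZ.
  have hS := wint_sum (fun i : 'I_N => eigfun i x) (fun i => hV i t).
  have mS : measurable_fun setT (fun w => \sum_(i < N) eigfun i x * V i t w).
    by have [_ m _] := hS.
  have hD := wint_sub hZ hS; have mD := measurable_funB mZ mS.
  have b := wint_bound hT hH1 hH2 hB hD.
  apply: (@le_trans _ _ (\int[P]_w ((sigma * (Z w - \sum_(i < N) eigfun i x * V i t w)) ^+ 2)%:E)%E).
    apply: ae_le_integral_nonmeas.
    + by move=> w; rewrite lee_fin sqr_ge0.
    + by move=> w; rewrite lee_fin sqr_ge0.
    + by apply: measurable_sqr; apply: measurable_funM => //; exact: measurable_cst.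
    + apply: filterS2 oZ (ae_foralln V0) => w -> Vw0; rewrite mulrBr mulr_sumr.
      by under eq_bigr do rewrite Vw0 subr0 mulrCA.
  rewrite (integral_sqrZ P measurableT sigma mD).
  have h := convolution_tail hT x (proj2 (andP t0)) N0.
  rewrite -mulrA (EFinM (sigma ^+ 2)); apply: lee_wpmul2l; first by rewrite lee_fin sqr_ge0.
  apply: (le_trans b); rewrite (EFinM (4 * _)); apply: lee_wpmul2l => //.
  by rewrite lee_fin mulr_ge0.
Qed.

Lemma lipschitz_moment k : (0 < k)%N -> exists C : R, 0 < C /\
  forall t x z : R, 0 <= t <= T -> 0 < x < pi -> 0 < z < pi -> x != z ->
  (\int[P]_w ((o t x w - o t z w) ^+ k.*2)%:E <= (C * `|x - z| ^+ k.*2)%:E)%E.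
Proof.
move=> k0; have C0 := wiener_const_ge0 T hH1 hH2.
have [C [Cp hC]] := wint_moment hB k0.
set K := 4 * wiener_const T H1 H2 + 1; have K0 : 0 < K by rewrite /K; lra.
have s0 : 0 <= sigma ^+ k.*2 by rewrite exprn_even_ge0// odd_double.
exists ((sigma ^+ k.*2 + 1) * (C * K ^+ k)); split.
  by rewrite mulr_gt0 ?mulr_gt0 ?exprn_gt0// ltr_wpDl.
move=> t x z t0 x0 z0 xz; have [mo hoZ] := ho.
have [Z [hZ oZ]] := hoZ t x t0 x0; have [Y [hY oY]] := hoZ t z t0 z0.
have mZ : measurable_fun setT Z by have [_ m _] := hZ.
have mY : measurable_fun setT Y by have [_ m _] := hY.
have e0 : 0 < `|x - z| by rewrite normr_gt0 subr_eq0.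
have b : (\int[P]_w ((Z w - Y w) ^+ 2)%:E <= (K * `|x - z| ^+ 2)%:E)%E.
  apply: (le_trans (wint_bound hT hH1 hH2 hB (wint_sub hZ hY))).
  apply: (@le_trans _ _ ((4 * wiener_const T H1 H2)%:E * (`|x - z| ^+ 2)%:E)%E).
    apply: lee_wpmul2l; first by rewrite lee_fin mulr_ge0.
    exact: (convolution_lipschitz hT x z (proj2 (andP t0))).
  by rewrite -EFinM lee_fin ler_wpM2r ?sqr_ge0// /K; lra.
have {}b := hC _ _ _ (wint_sub hZ hY) (mulr_gt0 K0 (exprn_gt0 2 e0)) b.
apply: (@le_trans _ _ (\int[P]_w ((sigma ^+ k.*2)%:E * ((Z w - Y w) ^+ k.*2)%:E))%E).
  apply: ae_le_integral_nonmeas.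
  - by move=> w; rewrite lee_fin exprn_even_ge0// odd_double.
  - by move=> w; rewrite mule_ge0// lee_fin exprn_even_ge0// odd_double.
  - by apply: measurable_funeM; apply/measurable_EFinP; apply: measurable_funX; exact: measurable_funB.
  - apply: filterS2 oZ oY => w -> ->.
    by rewrite -mulrBr exprMn EFinM.
rewrite ge0_integralZl//; last 2 first.
- by apply/measurable_EFinP; apply: measurable_funX; exact: measurable_funB.
- by move=> w _; rewrite lee_fin exprn_even_ge0// odd_double.
apply: (@le_trans _ _ ((sigma ^+ k.*2)%:E * (C * (K * `|x - z| ^+ 2) ^+ k)%:E)%E).
  by apply: lee_wpmul2l; rewrite ?lee_fin.
rewrite -EFinM lee_fin exprMn -exprM mul2n.
have : 0 <= C * (K ^+ k * `|x - z| ^+ k.*2).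
  by rewrite !mulr_ge0 ?exprn_ge0 ?(ltW Cp) ?(ltW K0).
move: (C) (K ^+ k) (`|x - z| ^+ _) (sigma ^+ _) s0 => a b' c e s0 h; nra.
Qed.

Lemma spatial_lipschitz (p : R) : 1 <= p -> exists C : R, 0 < C /\
  forall x z : R, 0 < x < pi -> 0 < z < pi ->
  (ereal_sup [set 'E_P[fun w => (`|o t x w - o t z w| `^ p)%R] | t in `[0%R, T]]
     <= (C * `|x - z| `^ p)%:E)%E.
Proof.
move=> p1; pose k := (Num.truncn p).+1.
have pk : p <= k.*2%:R.
  have : p < k%:R by rewrite /k; exact: truncnS_gt.
  by rewrite -addnn natrD; have : 0 <= k%:R :> R by []; lra.
have [C [C0 hC]] := @lipschitz_moment k isT.
exists (1 + C); split; first by lra.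
move=> x z x0 z0; apply: ge_ereal_sup => _ [t t0 <-].
have {}t0 : 0 <= t <= T by move: t0; rewrite /= in_itv.
rewrite unlock; have [->|xz] := eqVneq x z.
  rewrite integral0_eq ?lee_fin ?mulr_ge0 ?powR_ge0//; first by lra.
  by move=> w _; rewrite subrr normr0 powR0// gt_eqF//; lra.
have e0 : 0 < `|x - z| by rewrite normr_gt0 subr_eq0.
have [mo _] := ho.
have mD : measurable_fun setT (fun w => o t x w - o t z w).
  by apply: measurable_funB; exact: measurable_field_section.
move: (`|x - z|) e0 (@hC t x z t0 x0 z0 xz) => l e0 {}hC.
have mk : measurable_fun setT (fun w => ((o t x w - o t z w) ^+ k.*2)%:E).
  by apply/measurable_EFinP; apply: measurable_funX.
have k2 (y : R) : 0 <= y ^+ k.*2 by rewrite exprn_even_ge0// odd_double.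
apply: (@le_trans _ _ (\int[P]_w ((l `^ p)%:E * (1%:E + ((l ^+ k.*2)^-1)%:E *
    ((o t x w - o t z w) ^+ k.*2)%:E)))%E).
  apply: ge0_le_integral_nonmeas => w; first by rewrite lee_fin powR_ge0.
  rewrite !(=^~ EFinM, =^~ EFinD) lee_fin.
  apply: (le_trans (powR_le_interp p1 pk e0 (normr_ge0 _))).
  by have -> : `|o t x w - o t z w| ^+ k.*2 = (o t x w - o t z w) ^+ k.*2 by rewrite -normrX ger0_norm.
rewrite ge0_integralZl//; last 3 first.
- apply: emeasurable_funD; [exact: measurable_cst|exact: measurable_funeM].
- by move=> w _; apply: adde_ge0 => //; apply: mule_ge0; rewrite lee_fin ?invr_ge0.
- by rewrite lee_fin powR_ge0.
rewrite ge0_integralD//; last 2 first.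
- by move=> w _; rewrite mule_ge0 ?lee_fin ?invr_ge0.
- exact: measurable_funeM.
have -> : (\int[P]__ 1%:E = 1%:E)%E.
  by rewrite integral_cst//= probability_setT mule1.
rewrite ge0_integralZl//; last 2 first.
- by move=> w _; rewrite lee_fin.
- by rewrite lee_fin invr_ge0.
apply: (@le_trans _ _ ((l `^ p)%:E * (1%:E + ((l ^+ k.*2)^-1)%:E * (C * l ^+ k.*2)%:E))%E).
  apply: lee_wpmul2l; first by rewrite lee_fin powR_ge0.
  apply: leeD => //; apply: lee_wpmul2l; first by rewrite lee_fin invr_ge0.
  exact: hC.
rewrite !(=^~ EFinM, =^~ EFinD) lee_fin mulrC mulrCA mulVf ?mulr1//.
by rewrite expf_neq0// gt_eqF.
Qed.

End modes.

(** * Fourier coefficients in L2 *)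

Section fourier.
Context {R : realType}.
Local Notation leb := (@lebesgue_measure R).

Lemma measurable_fun_sqr_dom (v : R -> R) :
  measurable_fun dom v -> measurable_fun dom (fun x : measurableTypeR R => (v x ^+ 2)%:E).
Proof. by move=> mv; exact: (@measurable_sqr _ (measurableTypeR R) R dom v mv). Qed.

Lemma leb_dom : leb dom = (pi : R)%:E.
Proof. by rewrite /dom/= lebesgue_measure_itv/= lte_fin pi_gt0 -EFinB subr0. Qed.

Lemma square_integrable_eigfunM (v : R -> R) j : square_integrable v ->
  leb.-integrable dom (fun x => (v x * eigfun j x)%:E).
Proof.
move=> [mv fv]; have mD := @measurable_dom R.
have mve : measurable_fun dom (fun x : measurableTypeR R => (v x * eigfun j x)%:E).
  apply/measurable_EFinP; apply: measurable_funM; [exact: mv|exact: measurable_eigfun].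
apply/integrableP; split; first exact: mve.
have m2 := measurable_fun_sqr_dom mv.
apply: (@le_lt_trans _ _ (\int[leb]_(x in dom) ((v x ^+ 2)%:E + 1%:E))%E).
  apply: ge0_le_integral => //.
  - exact: measurableT_comp.
  - by apply: emeasurable_funD => //; exact: measurable_cst.
  - move=> x _; rewrite -EFinD lee_fin normrM.
    have := eigfun_le1 j x; have := normr_ge0 (eigfun j x); have := normr_ge0 (v x).
    rewrite -[v x ^+ 2]real_normK ?num_real//; move: `|v x| `|eigfun j x| => a b; nra.
rewrite ge0_integralD//; last by move=> x _; rewrite lee_fin sqr_ge0.
apply: lte_add_pinfty => //; rewrite integral_cst//.
by have := @leb_dom => /= ->; rewrite mul1e ltry.
Qed.

Lemma fourier_coefE (v : R -> R) j : square_integrable v ->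
  (\int[leb]_(x in dom) (v x * eigfun j x)%:E = (fourier_coef v j)%:E)%E.
Proof.
move=> /(square_integrable_eigfunM j) iv; rewrite /fourier_coef /Rintegral fineK//.
by apply: integrable_fin_num => //; exact: measurable_dom.
Qed.

Lemma square_integrableD (f g : R -> R) : square_integrable f -> square_integrable g ->
  square_integrable (fun x => f x + g x).
Proof.
move=> [mf ff] [mg fg]; split; first exact: measurable_funD.
apply: (le_lt_trans (@integral_sqrD _ (measurableTypeR R) R leb dom measurable_dom f g mf mg)).
by rewrite lte_add_pinfty// lte_mul_pinfty.
Qed.

Lemma square_integrableZ (f : R -> R) (a : R) : square_integrable f ->
  square_integrable (fun x => a * f x).
Proof.
move=> [mf ff]; split; first by apply: measurable_funM => //; exact: measurable_cst.
rewrite /l2sqnorm (@integral_sqrZ _ (measurableTypeR R) R leb dom measurable_dom f a mf).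
by rewrite lte_mul_pinfty// lee_fin sqr_ge0.
Qed.

Lemma square_integrableB (f g : R -> R) : square_integrable f -> square_integrable g ->
  square_integrable (fun x => f x - g x).
Proof.
move=> sf sg; have := square_integrableD sf (square_integrableZ (-1) sg).
by under eq_fun do rewrite mulN1r.
Qed.

Lemma square_integrable_bounded (f : R -> R) (c : R) : measurable_fun dom f ->
  (forall x, dom x -> `|f x| <= c) -> square_integrable f /\ (l2sqnorm f <= (c ^+ 2 * pi)%:E)%E.
Proof.
move=> mf fc; suff h : (l2sqnorm f <= (c ^+ 2 * pi)%:E)%E.
  by split => //; split => //; apply: (le_lt_trans h); rewrite ltry.
rewrite EFinM -leb_dom -integral_cst; last exact: measurable_dom.
apply: ge0_le_integral => //.
- exact: measurable_dom.
- by move=> x _; rewrite lee_fin sqr_ge0.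
- exact: measurable_fun_sqr_dom.
- move=> x Dx; rewrite lee_fin -[leLHS]real_normK ?num_real//.
  by apply: lerXn2r; rewrite ?nnegrE ?fc// (le_trans _ (fc x Dx)).
Qed.

Lemma square_integrable_eigfun j : square_integrable (eigfun j : R -> R).
Proof.
have [] := @square_integrable_bounded (eigfun j) 1 => //.
- exact: measurable_eigfun.
- by move=> x _; exact: eigfun_le1.
Qed.

Lemma square_integrable_sum (c : nat -> R) N :
  square_integrable (fun x : R => \sum_(i < N) eigfun i x * c i).
Proof.
elim: N => [|N IH].
  under eq_fun do rewrite big_ord0.
  have m0 : measurable_fun dom (cst 0 : measurableTypeR R -> R) by exact: measurable_cst.
  have [|s _] := @square_integrable_bounded (cst 0) 0 m0; last exact: s.
  by move=> x _; rewrite normr0.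
under eq_fun do rewrite big_ord_recr/=.
apply: square_integrableD => //.
under eq_fun do rewrite mulrC.
exact/square_integrableZ/square_integrable_eigfun.
Qed.

Lemma fourier_coefD (f g : R -> R) j : square_integrable f -> square_integrable g ->
  fourier_coef (fun x => f x + g x) j = fourier_coef f j + fourier_coef g j.
Proof.
move=> sf sg; apply: EFin_inj.
rewrite -fourier_coefE; last exact: square_integrableD.
under eq_integral do rewrite mulrDl EFinD.
rewrite integralD; [|exact: measurable_dom|exact: square_integrable_eigfunM..].
by rewrite !fourier_coefE.
Qed.

Lemma fourier_coefZ (f : R -> R) (a : R) j : square_integrable f ->
  fourier_coef (fun x => a * f x) j = a * fourier_coef f j.
Proof.
move=> sf; apply: EFin_inj.
rewrite -fourier_coefE; last exact: square_integrableZ.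
under eq_integral do rewrite -mulrA EFinM.
rewrite integralZl; [|exact: measurable_dom|exact: square_integrable_eigfunM].
by rewrite fourier_coefE.
Qed.

Lemma fourier_coefB (f g : R -> R) j : square_integrable f -> square_integrable g ->
  fourier_coef (fun x => f x - g x) j = fourier_coef f j - fourier_coef g j.
Proof.
move=> sf sg; have -> : (fun x => f x - g x) = (fun x => f x + (-1) * g x).
  by apply/funext => x; rewrite mulN1r.
rewrite fourier_coefD// ?fourier_coefZ ?mulN1r//.
exact: square_integrableZ.
Qed.

Lemma fourier_coef_eigfun (i j : nat) : fourier_coef (eigfun i : R -> R) j = (i == j)%:R.
Proof.
apply: EFin_inj; rewrite -fourier_coefE; last exact: square_integrable_eigfun.
exact: eigfun_orthonormal.
Qed.

Lemma fourier_coef_sum (c : nat -> R) N j :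
  fourier_coef (fun x : R => \sum_(i < N) eigfun i x * c i) j = if (j < N)%N then c j else 0.
Proof.
elim: N => [|N IH].
  under eq_fun do rewrite big_ord0.
  by rewrite /fourier_coef /Rintegral integral0_eq// => x _; rewrite mul0r.
under eq_fun do rewrite big_ord_recr/=.
rewrite fourier_coefD ?IH; last 2 first.
- exact: square_integrable_sum.
- under eq_fun do rewrite mulrC.
  exact/square_integrableZ/square_integrable_eigfun.
under eq_fun do rewrite mulrC.
rewrite fourier_coefZ ?fourier_coef_eigfun; last exact: square_integrable_eigfun.
rewrite [(j < N.+1)%N]ltnS [(j <= N)%N]leq_eqVlt [N == j]eq_sym; case: eqVneq => [->|jN] /=; first by rewrite ltnn mulr1 add0r.
by rewrite mulr0 addr0.
Qed.

(** Bessel's inequality for one coefficient, through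
    2 a b <= a^2 / dl + dl b^2. *)
Lemma fourier_coef_le (f : R -> R) j (dl : R) : 0 < dl -> square_integrable f ->
  (l2sqnorm f <= (dl ^+ 2)%:E)%E -> `|fourier_coef f j| <= dl.
Proof.
move=> d0 sf h; have mD := @measurable_dom R.
have iv := square_integrable_eigfunM j sf; have mf := sf.1.
have me := square_integrable_eigfun j.
rewrite -lee_fin -abse_EFin -fourier_coefE//.
apply: (le_trans (le_abse_integral leb mD (measurable_int _ iv))).
apply: (@le_trans _ _ (\int[leb]_(x in dom) ((2 * dl)^-1%:E * (f x ^+ 2)%:E +
    (dl / 2)%:E * (eigfun j x ^+ 2)%:E))%E).
  apply: ge0_le_integral => //.
  - by apply: measurableT_comp => //; exact: measurable_int iv.
  - apply: emeasurable_funD; apply: measurable_funeM; apply: measurable_fun_sqr_dom.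
      exact: mf.
    exact: measurable_eigfun.
  - move=> x _; rewrite !(=^~ EFinM, =^~ EFinD) /= lee_fin normrM.
    rewrite -[f x ^+ 2]real_normK ?num_real// -[eigfun j x ^+ 2]real_normK ?num_real//.
    move: `|f x| `|eigfun j x| => a b; rewrite -subr_ge0.
    have -> : (2 * dl)^-1 * a ^+ 2 + dl / 2 * b ^+ 2 - a * b = (2 * dl)^-1 * (a - dl * b) ^+ 2.
      by field; rewrite gt_eqF.
    by rewrite mulr_ge0 ?sqr_ge0// invr_ge0 mulr_ge0// ltW.
rewrite ge0_integralD//; last 4 first.
- by move=> x _; rewrite mule_ge0// lee_fin ?sqr_ge0// invr_ge0 mulr_ge0// ltW.
- by apply: measurable_funeM; apply: measurable_fun_sqr_dom; exact: mf.
- by move=> x _; rewrite mule_ge0// lee_fin ?sqr_ge0// divr_ge0// ltW.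
- by apply: measurable_funeM; apply: measurable_fun_sqr_dom; exact: measurable_eigfun.
rewrite ge0_integralZl//; last 3 first.
- by apply: measurable_fun_sqr_dom; exact: mf.
- by move=> x _; rewrite lee_fin sqr_ge0.
- by rewrite lee_fin invr_ge0 mulr_ge0// ltW.
rewrite ge0_integralZl//; last 3 first.
- by apply: measurable_fun_sqr_dom; exact: measurable_eigfun.
- by move=> x _; rewrite lee_fin sqr_ge0.
- by rewrite lee_fin divr_ge0// ltW.
apply: (@le_trans _ _ ((2 * dl)^-1%:E * (dl ^+ 2)%:E + (dl / 2)%:E * 1%:E)%E).
  apply: leeD; first by apply: lee_wpmul2l => //; rewrite lee_fin invr_ge0 mulr_ge0// ltW.
  apply: lee_wpmul2l; first by rewrite lee_fin divr_ge0// ltW.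
  under eq_integral do rewrite expr2.
  by rewrite eigfun_orthonormal eqxx.
rewrite !(=^~ EFinM, =^~ EFinD) lee_fin.
rewrite le_eqVlt; apply/orP; left; apply/eqP; field.
by rewrite gt_eqF.
Qed.

(** Coefficients are continuous in L2, and the j-th coefficient of a partial sum
    of length N > j is c j. *)
Lemma fourier_coef_unique (v : R -> R) (c : nat -> R) : measurable_fun dom v ->
  (forall (e : R) j, 0 < e -> exists N, (j < N)%N /\
     (l2sqnorm (fun x => (v x - \sum_(i < N) eigfun i x * c i)%R) <= e%:E)%E) ->
  square_integrable v /\ forall j, fourier_coef v j = c j.
Proof.
move=> mv h.
have sd (e : R) N : (l2sqnorm (fun x => (v x - \sum_(i < N) eigfun i x * c i)%R) <= e%:E)%E ->
    square_integrable (fun x => v x - \sum_(i < N) eigfun i x * c i).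
  move=> le; split; last exact: le_lt_trans le (ltry _).
  by apply: measurable_funB => //; have [] := square_integrable_sum c N.
have sv : square_integrable v.
  have [N [_ /sd s1]] := h 1 0%N ltr01.
  have := square_integrableD s1 (square_integrable_sum c N).
  by under eq_fun do rewrite subrK.
split => // j; apply/eqP; rewrite -subr_eq0 -normr_le0.
apply/ler_addgt0Pl => e e0; rewrite addr0.
have [N [jN b]] := h (e ^+ 2) j (exprn_gt0 2 e0).
have := fourier_coef_le j e0 (sd _ _ b) b.
by rewrite fourier_coefB ?fourier_coef_sum ?jN//; exact: square_integrable_sum.
Qed.

End fourier.

(** * Fourier coefficients of a random field *)

Section random_fourier.
Context d (Omega : measurableType d) (R : realType) (P : probability Omega R).
Local Notation leb := (@lebesgue_measure R).

(** By Tonelli, mean square convergence of the spectral expansion at every point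
    is mean convergence of the squared L2 distance. The lower limit of this
    distance vanishes almost surely, which determines the Fourier coefficients. *)
Lemma ae_fourier_coef (v : R -> Omega -> R) (W : nat -> Omega -> R) (C : R) :
  measurable_fun ([set: Omega] `*` dom) (fun u : Omega * R => v u.2 u.1) ->
  (forall j, measurable_fun setT (W j)) -> 0 <= C ->
  (forall (x : R) N, 0 < x < pi -> (0 < N)%N ->
    (\int[P]_w ((v x w - \sum_(i < N) eigfun i x * W i w) ^+ 2)%:E <= (C / N%:R)%:E)%E) ->
  {ae P, forall w, square_integrable (v^~ w) /\ forall j, fourier_coef (v^~ w) j = W j w}.
Proof.
move=> mv mW C0 hC; have mD := @measurable_dom R.
pose F N (u : Omega * measurableTypeR R) : \bar R :=
  ((v u.2 u.1 - \sum_(i < N) eigfun i u.2 * W i u.1) ^+ 2)%:E.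
have mF N : measurable_fun ([set: Omega] `*` dom) (F N).
  apply: measurable_sqr; apply: measurable_funB; first exact: mv.
  apply: measurable_funTS; apply: measurable_sum => i; apply: measurable_funM.
    apply: (@measurableT_comp _ _ _ _ _ _ (eigfun i)); last exact: measurable_snd.
    exact: measurable_eigfun.
  by apply: (@measurableT_comp _ _ _ _ _ _ (W i)) => //; exact: measurable_fst.
have F0 N u : (0 <= F N u)%E by rewrite lee_fin sqr_ge0.
pose Y N w := (\int[leb]_(x in dom) F N (w, x))%E.
have mY N : measurable_fun setT (Y N).
  exact: (@measurable_section_integral _ _ _ _ R leb _ _ measurableT mD _ (mF N) (F0 N)).
have Y0 N w : (0 <= Y N w)%E by apply: integral_ge0 => x _.
have YC N : (0 < N)%N -> (\int[P]_w Y N w <= (C * pi / N%:R)%:E)%E.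
  move=> N0.
  have -> : (\int[P]_w Y N w = \int[leb]_(x in dom) \int[P]_w F N (w, x))%E.
    exact: (@tonelli_swap _ _ _ _ R P leb _ _ measurableT mD _ (mF N) (F0 N)).
  have -> : ((C * pi / N%:R)%:E = \int[leb]_(x in dom) (C / N%:R)%:E)%E.
    by rewrite integral_cst//; have := @leb_dom R => /= ->; rewrite -EFinM mulrAC.
  apply: ge0_le_integral => //.
  - by move=> x _; apply: integral_ge0.
  - have mF' : measurable_fun (dom `*` [set: Omega])
        (fun u : measurableTypeR R * Omega => F N (u.2, u.1)).
      apply: (measurable_comp _ _ (mF N)).
      - exact: measurableX.
      - by move=> _ [[x w] [/= Dx _] <-].
      - by apply: measurable_funTS; exact: measurable_swap.
    exact: (@measurable_section_integral _ _ _ _ R P _ _ mD measurableT _ mF' (fun u => F0 N (u.2, u.1))).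
  - by move=> x Dx; apply: hC => //; move: Dx; rewrite /dom/= in_itv.
(* The infimum over N >= n lies below every later Y N, so it has mean zero. *)
pose E n w := einfs (Y ^~ w) n.
have mE n : measurable_fun setT (E n) by exact: measurable_fun_einfs.
have E0 n w : (0 <= E n w)%E by apply: le_ereal_inf_tmp => _ [k _ <-].
have EY n w N : (n <= N)%N -> (E n w <= Y N w)%E.
  by move=> nN; apply: ereal_inf_lbound; exists N.
have Ez : {ae P, forall w n, E n w = 0%E}.
  apply: ae_foralln => n.
  suff z : (\int[P]_w E n w = 0)%E.
    have : (\int[P]_w `|E n w| = 0)%E.
      by rewrite -[RHS]z; apply: eq_integral => w _; rewrite gee0_abs.
    by move=> /(ae_eq_integral_abs P measurableT (mE n)).1; apply: filterS => w /(_ I).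
  apply/eqP; rewrite eq_le integral_ge0// andbT; apply/lee_addgt0Pr => e e0; rewrite add0e.
  have /cvgrPdist_lt/(_ e e0)[N0 _ hN] := @step_cvg0 R (C * pi).
  pose N := maxn n N0.
  apply: (@le_trans _ _ (\int[P]_w Y N.+1 w)%E).
    by apply: ge0_le_integral => // w _; apply: EY; rewrite leqW// leq_maxl.
  apply: (le_trans (YC N.+1 isT)); rewrite lee_fin.
  have := hN N (leq_maxr _ _); rewrite /= sub0r normrN => /ltW.
  exact/le_trans/ler_norm.
apply: filterS Ez => w Ew; apply: fourier_coef_unique.
  have mD2 : measurable ([set: Omega] `*` (dom : set (measurableTypeR R))).
    exact: measurableX.
  have mp : measurable_fun dom (fun x : measurableTypeR R => (w, x)).
    by apply: measurable_funTS; exact: pair1_measurable.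
  have sub : [set (w, x) | x in dom] `<=` [set: Omega] `*` (dom : set (measurableTypeR R)).
    by move=> _ [x Dx <-].
  exact: (measurable_comp mD2 sub mv mp).
move=> e j e0; have : (E j.+1 w < e%:E)%E by rewrite Ew lte_fin.
move=> /ereal_inf_lt[_ [N /= jN <-] /ltW YN]; exists N; split => //.
Qed.

End random_fourier.

(** * Powers of the Sobolev norm *)

Section norm_bound.
Context {R : realType}.

Lemma nneseries_bounded (x : nat -> R) (M : R) : (forall j, 0 <= x j) ->
  (forall n, \sum_(i < n) x i <= M) ->
  exists s : R, [/\ (\sum_(0 <= j <oo) (x j)%:E = s%:E)%E, 0 <= s &
    \sum_(i < n) x i @[n --> \oo] --> s].
Proof.
move=> x0 xM; set S := (\sum_(0 <= j <oo) (x j)%:E)%E.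
have cS : cvgn (fun n => \sum_(0 <= i < n) (x i)%:E)%E.
  by apply: is_cvg_nneseries => n _ _; rewrite lee_fin.
have S0 : (0 <= S)%E by apply: nneseries_ge0 => n _ _; rewrite lee_fin.
have SM : (S <= M%:E)%E.
  apply: lime_le => //; apply: nearW => n; rewrite sumEFin lee_fin big_mkord; exact: xM.
have fS : S \is a fin_num by rewrite ge0_fin_numE// (le_lt_trans SM)// ltry.
exists (fine S); split; [by rewrite fineK|exact: fine_ge0|].
have : (\sum_(0 <= i < n) (x i)%:E)%E @[n --> \oo] --> (fine S)%:E by rewrite fineK.
have -> : (fun n => \sum_(0 <= i < n) (x i)%:E)%E = (fun n => (\sum_(i < n) x i)%:E).
  by apply/funext => n; rewrite sumEFin big_mkord.
by move=> /fine_cvgP[].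
Qed.

Lemma pow_tangent k (y m : R) : 0 <= y -> 0 <= m ->
  m ^+ k.+1 + k.+1%:R * m ^+ k * (y - m) <= y ^+ k.+1.
Proof.
move=> y0 m0; elim: k => [|k IH]; first by rewrite !expr1 expr0; lra.
have h := ler_wpM2l y0 IH; rewrite [leRHS]exprS; apply: le_trans h; rewrite -subr_ge0.
have -> : y * (m ^+ k.+1 + k.+1%:R * m ^+ k * (y - m)) -
  (m ^+ k.+2 + k.+2%:R * m ^+ k.+1 * (y - m)) = k.+1%:R * m ^+ k * (y - m) ^+ 2.
  rewrite -[k.+2%:R]natr1 !exprS; ring.
by rewrite mulr_ge0 ?sqr_ge0// mulr_ge0// exprn_ge0.
Qed.

(** The tangent inequality at the weighted mean, where the linear terms cancel
    after summation. *)
Lemma jensen_pow k n (b y : nat -> R) (B : R) : (forall i, 0 <= b i) ->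
  (forall i, 0 <= y i) -> \sum_(i < n) b i <= B ->
  (\sum_(i < n) b i * y i) ^+ k.+1 <= B ^+ k * \sum_(i < n) b i * y i ^+ k.+1.
Proof.
move=> b0 y0 bB; set A := \sum_(i < n) b i in bB; set S := \sum_(i < n) b i * y i.
have A0 : 0 <= A by exact: sumr_ge0.
have q0 : 0 <= \sum_(i < n) b i * y i ^+ k.+1.
  by apply: sumr_ge0 => i _; rewrite mulr_ge0// exprn_ge0.
have S0 : 0 <= S by apply: sumr_ge0 => i _; rewrite mulr_ge0.
apply: (@le_trans _ _ (A ^+ k * \sum_(i < n) b i * y i ^+ k.+1)); last first.
  by rewrite ler_wpM2r// lerXn2r ?nnegrE// (le_trans A0).
have [A0'|A0'] := eqVneq A 0.
  have z (i : 'I_n) : b i = 0.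
    apply/eqP; rewrite eq_le b0 andbT -A0' /A (bigD1 i)//= lerDl.
    by apply: sumr_ge0.
  by rewrite /S big1 ?expr0n ?mulr_ge0 ?exprn_ge0// => i _; rewrite z mul0r.
have Ap : 0 < A by rewrite lt_neqAle eq_sym A0'.
pose m := S / A; have m0 : 0 <= m by rewrite divr_ge0.
have Sm : S = A * m by rewrite /m mulrC divfK.
have : A * m ^+ k.+1 <= \sum_(i < n) b i * y i ^+ k.+1.
  apply: (@le_trans _ _ (\sum_(i < n) b i * (m ^+ k.+1 + k.+1%:R * m ^+ k * (y i - m)))); last first.
    by apply: ler_sum => i _; rewrite ler_wpM2l// pow_tangent.
  have -> : \sum_(i < n) b i * (m ^+ k.+1 + k.+1%:R * m ^+ k * (y i - m)) =
     A * m ^+ k.+1 + k.+1%:R * m ^+ k * (S - A * m).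
    rewrite /S /A !mulr_suml -sumrB mulr_sumr -big_split/=.
    by apply: eq_bigr => i _; ring.
  by rewrite Sm subrr mulr0 addr0.
move=> /(ler_wpM2l (exprn_ge0 k A0)); apply: le_trans.
by rewrite Sm exprMn [A ^+ k.+1]exprSr mulrA.
Qed.

Definition sobolev_weight (beta : R) (j : nat) : R := eigval R j `^ beta.

(** Jensen's inequality for the weights b. The majorants h may be infinite and
    need not come from v alone, so that the same bound serves a fixed time and a
    supremum over times. *)
Lemma hnorm_pow_le (beta p l B : R) (v : R -> R) (b : nat -> R) (k : nat)
    (h : nat -> \bar R) :
  square_integrable v -> 1 <= p -> p <= k.+1.*2%:R -> 0 < l ->
  (forall j, 0 < b j) -> (forall n, \sum_(i < n) b i <= B) ->
  (forall j, ((fourier_coef v j ^+ k.+1.*2)%:E <= h j)%E) ->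
  (poweR (hnorm beta v) p <= (l `^ p)%:E * (1%:E + ((l ^+ k.+1.*2)^-1 * B ^+ k)%:E *
     \sum_(0 <= j <oo) ((b j * (sobolev_weight beta j / b j) ^+ k.+1)%:E * h j)))%E.
Proof.
move=> sv p1 pk l0 b0 bB hv.
have k2 (y : R) : 0 <= y ^+ k.+1.*2 by rewrite exprn_even_ge0// odd_double.
have h0 j : (0 <= h j)%E by apply: le_trans (hv j); rewrite lee_fin.
have w0 j : 0 <= sobolev_weight beta j by exact: powR_ge0.
have c0 j : 0 <= b j * (sobolev_weight beta j / b j) ^+ k.+1.
  by rewrite mulr_ge0 ?exprn_ge0 ?divr_ge0// ltW.
have B0 : 0 < B.
  by apply: lt_le_trans (bB 1%N); rewrite big_ord_recl big_ord0 addr0.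
set Q := (\sum_(0 <= j <oo) _)%E.
have Q0 : (0 <= Q)%E by apply: nneseries_ge0 => j _ _; rewrite mule_ge0// lee_fin.
have d0 : 0 < (l ^+ k.+1.*2)^-1 * B ^+ k by rewrite mulr_gt0 ?invr_gt0 ?exprn_gt0.
have [fQ|] := boolP (Q \is a fin_num); last first.
  rewrite ge0_fin_numE// -leNgt leye_eq => /eqP ->.
  by rewrite gt0_muley ?lte_fin// addey// gt0_muley ?leey// lte_fin powR_gt0.
set q := fine Q; have Qq : Q = q%:E by rewrite fineK.
pose x j := sobolev_weight beta j * fourier_coef v j ^+ 2.
have x0 j : 0 <= x j by rewrite mulr_ge0 ?sqr_ge0.
have xk n : (\sum_(i < n) x i) ^+ k.+1 <= B ^+ k * q.
  have -> : \sum_(i < n) x i = \sum_(i < n) b i * (x i / b i).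
    by apply: eq_bigr => i _; rewrite mulrC divfK// gt_eqF.
  apply: (le_trans (@jensen_pow k n b (fun i => x i / b i) B _ _ (bB n))).
  - by move=> i; exact: ltW.
  - by move=> i; rewrite divr_ge0// ltW.
  - rewrite ler_wpM2l ?exprn_ge0 ?(ltW B0)// -lee_fin -Qq -sumEFin.
    rewrite -(big_mkord xpredT (fun i => (b i * (x i / b i) ^+ k.+1)%:E)).
    apply: (@le_trans _ _ (\sum_(0 <= j < n) ((b j * (sobolev_weight beta j / b j) ^+ k.+1)%:E * h j))%E).
      apply: lee_sum => j _.
      have -> : b j * (x j / b j) ^+ k.+1 =
         (b j * (sobolev_weight beta j / b j) ^+ k.+1) * fourier_coef v j ^+ k.+1.*2.
        by rewrite /x mulrAC [_ / _ * _ in LHS]mulrC exprMn -exprM mul2n; ring.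
      by rewrite EFinM; apply: lee_wpmul2l => //; rewrite lee_fin.
    by apply: nneseries_lim_ge => j _ _; rewrite mule_ge0// lee_fin.
have [n|s [Ss s0 cs]] := @nneseries_bounded x (1 + B ^+ k * q) x0.
  apply: (le_trans _ (lerD (lexx 1) (xk n))).
  have S0 : 0 <= \sum_(i < n) x i by exact: sumr_ge0.
  move: (\sum_(i < n) x i) S0 => r r0; have [r1|r1] := leP r 1.
    by apply: (le_trans r1); rewrite lerDl exprn_ge0.
  have : r <= r ^+ k.+1 by rewrite ler_eXnr// ltW.
  lra.
have sk : s ^+ k.+1 <= B ^+ k * q.
  have c : (\sum_(i < n) x i) ^+ k.+1 @[n --> \oo] --> s ^+ k.+1.
    elim: k.+1 => [|m IH]; first by under eq_fun do rewrite expr0; exact: cvg_cst.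
    by under eq_fun do rewrite exprS; rewrite exprS; exact: cvgM.
  rewrite -(cvg_lim (@Rhausdorff R) c); apply: limr_le; first by apply/cvg_ex; eexists; exact: c.
  exact: nearW.
rewrite /hnorm asboolT//.
have -> : (\sum_(0 <= j <oo) (eigval R j `^ beta * `|fourier_coef v j| ^+ 2)%:E = s%:E)%E.
  by rewrite -Ss; apply: eq_eseriesr => j _; rewrite real_normK ?num_real.
rewrite !poweR_EFin Qq !(=^~ EFinM, =^~ EFinD) lee_fin.
apply: (le_trans (powR_le_interp p1 pk l0 (powR_ge0 _ _))).
rewrite ler_wpM2l ?powR_ge0// lerD2l -mulrA ler_wpM2l ?invr_ge0//.
by rewrite -mul2n exprM powR12_sqrt// sqr_sqrtr.
Qed.

End norm_bound.

(** * Dyadic chaining *)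

Section chaining.
Context {R : realType}.
Variable T : R.
Hypothesis hT : 0 < T.

Definition dyadic (n i : nat) : R := i%:R * (T / 2 ^+ n).

Definition dyadic_index (n : nat) (t : R) : nat := Num.truncn (t / (T / 2 ^+ n)).

Definition dyadic_floor (n : nat) (t : R) : R := dyadic n (dyadic_index n t).

Lemma mesh_gt0 n : 0 < T / 2 ^+ n.
Proof. by rewrite divr_gt0// exprn_gt0. Qed.

Lemma dyadic0 n : dyadic n 0 = 0. Proof. by rewrite /dyadic mul0r. Qed.

Lemma dyadic_max n : dyadic n (2 ^ n) = T.
Proof. by rewrite /dyadic natrX mulrC divfK// expf_neq0. Qed.

Lemma le_dyadic n i j : (i <= j)%N -> dyadic n i <= dyadic n j.
Proof. by move=> ij; rewrite ler_wpM2r ?ler_nat// ltW// mesh_gt0. Qed.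

Lemma lt_dyadic n i j : (i < j)%N -> dyadic n i < dyadic n j.
Proof. by move=> ij; rewrite ltr_pM2r ?ltr_nat// mesh_gt0. Qed.

Lemma dyadicS n i : dyadic n i.+1 = dyadic n i + T / 2 ^+ n.
Proof. by rewrite /dyadic -natr1; ring. Qed.

Lemma dyadic_double n i : dyadic n.+1 i.*2 = dyadic n i.
Proof.
rewrite /dyadic -addnn natrD exprS; have : 2 ^+ n != 0 :> R by rewrite expf_neq0.
by move: (2 ^+ n) => e e0; field.
Qed.

Lemma dyadic_floorP n t : 0 <= t -> dyadic_floor n t <= t < dyadic_floor n t + T / 2 ^+ n.
Proof.
move=> t0; rewrite /dyadic_floor -dyadicS /dyadic -ler_pdivlMr ?mesh_gt0//.
rewrite -ltr_pdivrMr ?mesh_gt0// /dyadic_index.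
have x0 : 0 <= t / (T / 2 ^+ n) by rewrite divr_ge0// ltW// mesh_gt0.
by rewrite truncn_le x0 truncnS_gt.
Qed.

Lemma dyadic_floor_ge0 n t : 0 <= dyadic_floor n t.
Proof. by rewrite /dyadic_floor -(dyadic0 n) le_dyadic. Qed.

Lemma dyadic_index_le n t : 0 <= t -> t <= T -> (dyadic_index n t <= 2 ^ n)%N.
Proof.
move=> t0 tT; rewrite leqNgt; apply/negP => /(@lt_dyadic n).
have /andP[+ _] := @dyadic_floorP n t t0; rewrite dyadic_max /dyadic_floor; lra.
Qed.

Lemma lt_dyadicE n i j : (dyadic n i < dyadic n j) = (i < j)%N.
Proof. by rewrite ltr_pM2r ?ltr_nat// mesh_gt0. Qed.

Lemma dyadic_index_refine n t : 0 <= t ->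
  dyadic_index n.+1 t = (dyadic_index n t).*2 \/ dyadic_index n.+1 t = (dyadic_index n t).*2.+1.
Proof.
move=> t0; have /andP[a1 a2] := @dyadic_floorP n t t0.
have /andP[b1 b2] := @dyadic_floorP n.+1 t t0.
move: a1 a2 b1 b2; rewrite /dyadic_floor -!dyadicS.
set i := dyadic_index n t; set j := dyadic_index n.+1 t => a1 a2 b1 b2.
have h1 : (i.*2 < j.+1)%N by rewrite -(lt_dyadicE n.+1) dyadic_double; lra.
have h2 : (j < i.+1.*2)%N by rewrite -(lt_dyadicE n.+1) dyadic_double; lra.
by clear -h1 h2; lia.
Qed.

Lemma dyadic_index_close n s t : 0 <= s -> s <= t -> t - s < T / 2 ^+ n ->
  dyadic_index n t = dyadic_index n s \/ dyadic_index n t = (dyadic_index n s).+1.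
Proof.
move=> s0 st ts; have /andP[a1 a2] := @dyadic_floorP n s s0.
have /andP[b1 b2] := @dyadic_floorP n t (le_trans s0 st).
move: a1 a2 b1 b2; rewrite /dyadic_floor -!dyadicS.
set i := dyadic_index n s; set j := dyadic_index n t => a1 a2 b1 b2.
have h1 : (i < j.+1)%N by rewrite -(lt_dyadicE n); lra.
have h2 : (j < i.+2)%N.
  rewrite -(lt_dyadicE n) dyadicS; lra.
by clear -h1 h2; lia.
Qed.

Definition dyadic_variation (k : nat) (f : R -> R) (n : nat) : R :=
  \sum_(i < 2 ^ n) (f (dyadic n i.+1) - f (dyadic n i)) ^+ k.*2.

Lemma dyadic_variation_ge0 k f n : 0 <= dyadic_variation k f n.
Proof. by apply: sumr_ge0 => i _; rewrite exprn_even_ge0// odd_double. Qed.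

Lemma dyadic_variation_ge k f n i : (i < 2 ^ n)%N ->
  (f (dyadic n i.+1) - f (dyadic n i)) ^+ k.*2 <= dyadic_variation k f n.
Proof.
move=> iN; rewrite /dyadic_variation (bigD1 (Ordinal iN))//= lerDl.
by apply: sumr_ge0 => j _; rewrite exprn_even_ge0// odd_double.
Qed.

(** The telescoping increments of f along the dyadic floors of t. *)
Definition floor_step (f : R -> R) (t : R) (n : nat) : R :=
  if n is m.+1 then f (dyadic_floor n t) - f (dyadic_floor m t)
  else f (dyadic_floor 0 t).

Lemma sum_floor_step f t n : \sum_(i < n.+1) floor_step f t i = f (dyadic_floor n t).
Proof.
elim: n => [|n IH]; first by rewrite big_ord_recl big_ord0 addr0.
by rewrite big_ord_recr/= IH addrC subrK.
Qed.

Lemma floor_step_le k f t n : (0 < k)%N -> f 0 = 0 -> 0 <= t -> t <= T ->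
  floor_step f t n ^+ k.*2 <= dyadic_variation k f n.
Proof.
move=> k0 f0 t0 tT; have z : (0 : R) ^+ k.*2 = 0.
  by rewrite expr0n double_eq0 eqn0Ngt k0.
case: n => [|n] /=.
  have := dyadic_index_le 0 t0 tT; rewrite /dyadic_floor expn0.
  case: (dyadic_index 0 t) => [|[|//]] _.
    by rewrite dyadic0 f0 z dyadic_variation_ge0.
  have := @dyadic_variation_ge k f 0 0%N isT.
  by rewrite dyadic0 f0 subr0.
have jle := dyadic_index_le n.+1 t0 tT; rewrite /dyadic_floor.
rewrite -(dyadic_double n).
have [->|e] := dyadic_index_refine n t0; first by rewrite subrr z dyadic_variation_ge0.
by rewrite e in jle *; apply: dyadic_variation_ge.
Qed.

Lemma close_step_le k f s t n : (0 < k)%N -> 0 <= s -> s <= t -> t <= T -> t - s < T / 2 ^+ n ->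
  (f (dyadic_floor n t) - f (dyadic_floor n s)) ^+ k.*2 <= dyadic_variation k f n.
Proof.
move=> k0 s0 st tT ts; have jle := dyadic_index_le n (le_trans s0 st) tT.
rewrite /dyadic_floor; have [->|e] := dyadic_index_close s0 st ts.
  by rewrite subrr expr0n double_eq0 eqn0Ngt k0 dyadic_variation_ge0.
by rewrite e in jle *; apply: dyadic_variation_ge.
Qed.

Variable rho : R.
Hypothesis hrho : 0 < rho < 1.

Let rho_gt0 : 0 < rho. Proof. by case/andP: hrho. Qed.

Definition geo : R := (1 - rho)^-1.

Lemma geo_ge1 : 1 <= geo.
Proof.
rewrite /geo; have /andP[r0 r1] := hrho.
by rewrite -[leLHS]invr1 lef_pV2 ?posrE; lra.
Qed.

Lemma geo_sum n : \sum_(i < n) rho ^+ i <= geo.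
Proof.
have /andP[r0 r1] := hrho; rewrite /geo.
have -> : \sum_(i < n) rho ^+ i = (1 - rho ^+ n) / (1 - rho).
  elim: n => [|n IH]; first by rewrite big_ord0 expr0 subrr mul0r.
  by rewrite big_ord_recr/= IH exprS; field; lra.
rewrite ler_piMl ?invr_ge0; try lra.
by have : 0 <= rho ^+ n by [rewrite exprn_ge0// ltW]; lra.
Qed.

(** The weights that Jensen's inequality yields from the geometric weights rho^m. *)
Definition chain_coef (k m : nat) : R := geo ^+ (k.*2.-1) * (rho ^+ m * (rho ^- m) ^+ k.*2).

Lemma chain_coef_ge0 k m : 0 <= chain_coef k m.
Proof.
have g1 := geo_ge1; have r0 := ltW rho_gt0; rewrite /chain_coef.
apply: mulr_ge0; first by apply: exprn_ge0; lra.
by apply: mulr_ge0; rewrite exprn_ge0// invr_ge0 exprn_ge0.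
Qed.

Definition chain_term (k : nat) (f : R -> R) (m : nat) : R :=
  chain_coef k m * dyadic_variation k f m.

Lemma chain_term_ge0 k f m : 0 <= chain_term k f m.
Proof. by rewrite mulr_ge0 ?chain_coef_ge0 ?dyadic_variation_ge0. Qed.

Definition chain_bound (k : nat) (f : R -> R) : \bar R :=
  (\sum_(0 <= m <oo) (chain_term k f m)%:E)%E.

(** A dyadic value is the telescoped sum of one step per level; Jensen's
    inequality with geometric weights turns it into the variations over the
    levels, whatever the time. *)
Lemma dyadic_floor_chain k f t n : (0 < k)%N -> f 0 = 0 -> 0 <= t -> t <= T ->
  ((f (dyadic_floor n t) ^+ k.*2)%:E <= chain_bound k f)%E.
Proof.
move=> k0 f0 t0 tT.
apply: (@le_trans _ _ (\sum_(0 <= m < n.+1) (chain_term k f m)%:E)%E); last first.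
  by apply: nneseries_lim_ge => m _ _; rewrite lee_fin chain_term_ge0.
rewrite sumEFin lee_fin big_mkord -sum_floor_step.
have k2 : k.*2 = (k.*2.-1).+1 by rewrite prednK// double_gt0.
have rp m : 0 < rho ^+ m by rewrite exprn_gt0.
apply: (@le_trans _ _ ((\sum_(i < n.+1) rho ^+ i * (`|floor_step f t i| / rho ^+ i)) ^+ k.*2)).
  have -> : \sum_(i < n.+1) rho ^+ i * (`|floor_step f t i| / rho ^+ i) =
      \sum_(i < n.+1) `|floor_step f t i|.
    by apply: eq_bigr => i _; rewrite mulrC divfK// gt_eqF.
  rewrite -[leLHS]ger0_norm ?exprn_even_ge0 ?odd_double// normrX.
  by rewrite lerXn2r ?nnegrE ?sumr_ge0// ler_norm_sum.
rewrite k2; apply: (le_trans (@jensen_pow R k.*2.-1 n.+1 (fun i => rho ^+ i)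
   (fun i => `|floor_step f t i| / rho ^+ i) geo _ _ (geo_sum _))).
- by move=> i; exact: ltW.
- by move=> i; rewrite divr_ge0// ltW.
rewrite -k2 mulr_sumr; apply: ler_sum => i _; rewrite /chain_term /chain_coef.
rewrite exprMn -normrX ger0_norm; last by rewrite exprn_even_ge0// odd_double.
have := floor_step_le i k0 f0 t0 tT.
have g1 := geo_ge1.
rewrite -!mulrA => h; rewrite ler_wpM2l ?exprn_ge0//; first by lra.
rewrite ler_wpM2l ?(ltW (rp _))// mulrC ler_wpM2l// exprn_ge0// invr_ge0 ltW//.
Qed.

(** If |y| exceeds rho^m, then |y| / rho^m is below its 2k-th power. *)
Lemma small_pow_le k (y z : R) m : (0 < k)%N -> y ^+ k.*2 <= z ->
  `|y| <= rho ^+ m + chain_coef k m * z.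
Proof.
move=> k0 yz; have rp : 0 < rho ^+ m by rewrite exprn_gt0.
have g1 := geo_ge1.
have y2 : `|y| ^+ k.*2 = y ^+ k.*2.
  by rewrite -normrX ger0_norm// exprn_even_ge0// odd_double.
have z0 : 0 <= z by rewrite (le_trans _ yz)// -y2 exprn_ge0.
have k2 : (0 < k.*2)%N by rewrite double_gt0.
have [h|h] := leP `|y| (rho ^+ m).
  by apply: (le_trans h); rewrite lerDl mulr_ge0// chain_coef_ge0.
have h1 : 1 <= `|y| / rho ^+ m by rewrite ler_pdivlMr// mul1r ltW.
have h2 : `|y| / rho ^+ m <= (`|y| / rho ^+ m) ^+ k.*2 by rewrite ler_eXnr.
apply: (@le_trans _ _ (chain_coef k m * z)); last by rewrite lerDr ltW.
apply: (@le_trans _ _ (rho ^+ m * (rho ^- m) ^+ k.*2 * z)).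
  rewrite -[leRHS]mulrA -ler_pdivrMl// mulrC; apply: (le_trans h2).
  by rewrite exprMn y2 mulrC ler_wpM2l// exprn_ge0// invr_ge0 ltW.
rewrite /chain_coef -[leRHS]mulrA; apply: ler_peMl; last exact: exprn_ege1.
by apply: mulr_ge0 => //; apply: mulr_ge0; [exact: ltW|rewrite exprn_ge0// invr_ge0 ltW].
Qed.

End chaining.

(** * Convergence of the zeta series *)

Section zeta.
Context {R : realType}.

(** From ln x <= x - 1, applied to the quotient of consecutive integers. *)
Lemma powRN_increment (kap : R) i : 0 < kap ->
  kap * (i.+2%:R `^ (- 1 - kap)) <= i.+1%:R `^ (- kap) - i.+2%:R `^ (- kap).
Proof.
move=> k0; have i1 : 0 < i.+1%:R :> R by rewrite ltr0n.
have i2 : 0 < i.+2%:R :> R by rewrite ltr0n.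
have -> : i.+1%:R `^ (- kap) = i.+2%:R `^ (- kap) * (i.+1%:R / i.+2%:R) `^ (- kap).
  rewrite -powRM ?(ltW i2) ?divr_ge0 ?(ltW i1)//; congr powR.
  by rewrite mulrC divfK// gt_eqF.
have -> : (- 1 - kap) = - kap + - 1 :> R by ring.
rewrite powRD ?(gt_eqF i2) ?implybT// powR_inv1 ?(ltW i2)//.
rewrite mulrCA -[X in _ <= _ - X]mulr1 -mulrBr ler_wpM2l ?powR_ge0//.
have q0 : 0 < i.+1%:R / i.+2%:R :> R by rewrite divr_gt0.
have -> : kap / i.+2%:R = - kap * (i.+1%:R / i.+2%:R - 1).
  have -> : i.+1%:R = i.+2%:R - 1 :> R by rewrite -[i.+2%:R]natr1 addrK.
  by move: (i.+2%:R : R) i2 => x x0; field; rewrite gt_eqF.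
rewrite /powR (gt_eqF q0).
have h : ln (i.+1%:R / i.+2%:R) <= i.+1%:R / i.+2%:R - 1 :> R.
  have := @le_ln1Dx R (i.+1%:R / i.+2%:R - 1).
  by rewrite [1 + _]addrC subrK; apply; rewrite ltrBrDr addNr.
have := expR_ge1Dx (- kap * ln (i.+1%:R / i.+2%:R : R)).
rewrite lerBrDl; apply: le_trans; rewrite lerD2l !mulNr lerN2.
by rewrite ler_wpM2l// ltW.
Qed.

Lemma zeta_sum (kap : R) n : 0 < kap ->
  \sum_(i < n) (i%:R + 1) `^ (- 1 - kap) <= 1 + kap^-1.
Proof.
move=> k0; case: n => [|n]; first by rewrite big_ord0 addr_ge0// invr_ge0 ltW.
rewrite big_ord_recl/= add0r powR1 lerD2l.
have : \sum_(i < n) (i.+1%:R + 1) `^ (- 1 - kap) <= kap^-1 * (1 - n.+1%:R `^ (- kap)).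
  elim: n => [|n IH]; first by rewrite big_ord0 powR1 subrr mulr0.
  rewrite big_ord_recr/=; have := @powRN_increment kap n k0.
  rewrite -ler_pdivlMl// natr1 => h; apply: (le_trans (lerD IH h)).
  by rewrite -mulrDr addrA subrK.
move=> /le_trans; apply; by rewrite ler_piMr ?invr_ge0 ?(ltW k0)// gerBl powR_ge0.
Qed.

End zeta.

(** * Moments of the chaining bound *)

Section chain_moment.
Context d (Omega : measurableType d) (R : realType) (P : probability Omega R).
Variables (T th : R) (k : nat).
Hypotheses (hT : 0 < T) (th0 : 0 < th) (thk : 1 <= th * k%:R).

(** Chosen so that ratio^4 = 2^(-2 th) is the gain in mean square from one dyadic
    level to the next; ratio_pow_le then pays for the number of cells and for the
    weights of the chain. *)
Definition ratio : R := 2 `^ (- (th / 2)).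

Lemma ratio_lt1 : 0 < ratio < 1.
Proof.
rewrite /ratio powR_gt0//= powRN invf_lt1 ?powR_gt0//.
rewrite /powR pnatr_eq0/= -[ltLHS]expR0 ltr_expR mulr_gt0 ?ln_gt0 ?ltr1n//.
by rewrite divr_gt0.
Qed.

Lemma ratio4 : ratio ^+ 4 = 2 `^ (- (2 * th)).
Proof. by rewrite -powR_mulrn ?powR_ge0// -powRrM; congr powR; field. Qed.

Lemma ratio_pow_le : 2 * ratio ^+ k.*2 <= 1.
Proof.
rewrite -powR_mulrn ?powR_ge0// -powRrM -[X in X * _](powRr1 (ler0n R 2)) -powRD; last by rewrite pnatr_eq0 implybT.
rewrite -[leRHS](powRr0 2) ler_powR ?ler1n//.
have : th / 2 * k.*2%:R = th * k%:R by rewrite -addnn natrD; field.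
by rewrite mulNr => ->; rewrite subr_le0.
Qed.

Lemma mesh_powR m : (T / 2 ^+ m) `^ (2 * th) = T `^ (2 * th) * (ratio ^+ 4) ^+ m.
Proof.
rewrite powRM ?(ltW hT) ?invr_ge0 ?exprn_ge0//; congr (_ * _).
rewrite ratio4 -powR_mulrn ?powR_ge0// -powRrM -[2 ^+ m]powR_mulrn// -powRN -powRrM.
by congr powR; ring.
Qed.

Local Notation geo := (geo ratio).

Lemma measurable_chain_term (X : R -> Omega -> R) m :
  (forall t, measurable_fun setT (X t)) ->
  measurable_fun setT (fun w => chain_term T ratio k (X^~ w) m).
Proof.
move=> mX; apply: measurable_funM; first exact: measurable_cst.
by apply: measurable_sum => i; apply: measurable_funX; exact: measurable_funB.
Qed.

Lemma measurable_chain_bound (X : R -> Omega -> R) :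
  (forall t, measurable_fun setT (X t)) ->
  measurable_fun setT (fun w => chain_bound T ratio k (X^~ w)).
Proof.
move=> mX; apply: (@ge0_emeasurable_sum _ _ _ _
  (fun m w => (chain_term T ratio k (X^~ w) m)%:E) xpredT) => m.
- by move=> w _ _; rewrite lee_fin (chain_term_ge0 T ratio_lt1).
- by move=> _; apply/measurable_EFinP; exact: measurable_chain_term.
Qed.

(** At the level m there are 2^m increments, with 2k-th moments of order
    ratio^(4 k m). After the weights of the chain, of order ratio^(m - 2 k m), each
    level contributes at most a constant times ratio^m. *)
Lemma chain_moment (X : R -> Omega -> R) (C a : R) : 0 <= C -> 0 <= a ->
  (forall t, measurable_fun setT (X t)) ->
  (forall s t, 0 <= s -> s < t -> t <= T ->
    (\int[P]_w ((X t w - X s w) ^+ k.*2)%:E <= (C * (a * (t - s) `^ (2 * th)) ^+ k)%:E)%E) ->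
  (\int[P]_w chain_bound T ratio k (X^~ w) <= (geo ^+ k.*2 * C * (a * T `^ (2 * th)) ^+ k)%:E)%E.
Proof.
move=> C0 a0 mX hX; have k2 (y : R) : 0 <= y ^+ k.*2 by rewrite exprn_even_ge0// odd_double.
have g1 := geo_ge1 ratio_lt1; have g0 := le_trans ler01 g1; have /andP[r0 r1] := ratio_lt1.
rewrite /chain_bound integral_nneseries//; last 2 first.
- by move=> m; apply/measurable_EFinP; exact: measurable_chain_term.
- by move=> m w _; rewrite lee_fin (chain_term_ge0 T ratio_lt1).
set D := (a * T `^ (2 * th)) ^+ k.
have D0 : 0 <= D by rewrite exprn_ge0// mulr_ge0// powR_ge0.
have bnd m : (\int[P]_w (chain_term T ratio k (X^~ w) m)%:E <=
    (geo ^+ (k.*2.-1) * (C * D) * ratio ^+ m)%:E)%E.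
  have mv : measurable_fun setT (fun w => dyadic_variation T k (X^~ w) m).
    by apply: measurable_sum => i; apply: measurable_funX; exact: measurable_funB.
  under eq_integral do rewrite /chain_term EFinM.
  rewrite ge0_integralZl//; last 3 first.
  - exact/measurable_EFinP.
  - by move=> w _; rewrite lee_fin dyadic_variation_ge0.
  - by rewrite lee_fin (chain_coef_ge0 ratio_lt1).
  under eq_integral do rewrite /dyadic_variation -sumEFin.
  rewrite ge0_integral_sum//; last 2 first.
  - by move=> i; apply/measurable_EFinP; apply: measurable_funX; exact: measurable_funB.
  - by move=> i w _; rewrite lee_fin.
  apply: (@le_trans _ _ ((chain_coef ratio k m)%:E *
     \sum_(i < 2 ^ m) (C * (D * ((ratio ^+ 4) ^+ m) ^+ k))%:E)%E).
    apply: lee_wpmul2l; first by rewrite lee_fin (chain_coef_ge0 ratio_lt1).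
    apply: lee_sum => i _.
    have iN : (i.+1 <= 2 ^ m)%N by exact: ltn_ord.
    have := hX (dyadic T m i) (dyadic T m i.+1).
    have -> : dyadic T m i.+1 - dyadic T m i = T / 2 ^+ m by rewrite dyadicS addrC addKr.
    rewrite mesh_powR mulrA exprMn; apply.
    + by rewrite -(dyadic0 T m) le_dyadic.
    + exact: lt_dyadic.
    + by rewrite -{2}(dyadic_max T m) le_dyadic.
  rewrite sumEFin sumr_const card_ord -EFinM lee_fin /chain_coef -mulr_natl natrX.
  move: (ratio_pow_le) => h2; set r := ratio ^+ m.
  have rp : 0 < r by rewrite exprn_gt0.
  have -> : (ratio ^+ 4) ^+ m = r ^+ 4 by rewrite -!exprM mulnC.
  have -> : (r ^+ 4) ^+ k = r ^+ k.*2 * r ^+ k.*2.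
    by rewrite -exprM -exprD addnn -!mul2n mulnA.
  rewrite exprVn.
  have -> : geo ^+ k.*2.-1 * (r * (r ^+ k.*2)^-1) *
      (2 ^+ m * (C * (D * (r ^+ k.*2 * r ^+ k.*2)))) =
      geo ^+ k.*2.-1 * (C * D) * r * (2 ^+ m * r ^+ k.*2).
    have : r ^+ k.*2 != 0 by rewrite expf_neq0// gt_eqF.
    by move: (r ^+ _) (geo ^+ _) (2 ^+ m) => e f g e0; field.
  rewrite ler_piMr//.
    apply: mulr_ge0; last exact: ltW.
    by apply: mulr_ge0; [exact: exprn_ge0|exact: mulr_ge0].
  have -> : 2 ^+ m * r ^+ k.*2 = (2 * ratio ^+ k.*2) ^+ m.
    by rewrite exprMn -!exprM mulnC.
  by rewrite exprn_ile1// mulr_ge0// exprn_ge0// ltW.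
apply: (@le_trans _ _ (\sum_(0 <= m <oo) (geo ^+ (k.*2.-1) * (C * D) * ratio ^+ m)%:E)%E).
  apply: lee_nneseries => m _; last exact: bnd.
  by move=> _; apply: integral_ge0 => w _; rewrite lee_fin (chain_term_ge0 T ratio_lt1).
apply: lime_le.
  apply: is_cvg_nneseries => m _ _; rewrite lee_fin; apply: mulr_ge0.
    by apply: mulr_ge0; [exact: exprn_ge0|exact: mulr_ge0].
  by rewrite exprn_ge0// ltW.
apply: nearW => n; rewrite sumEFin lee_fin -mulr_sumr big_mkord.
have k0 : (0 < k)%N.
  by rewrite lt0n; apply/eqP => k00; move: thk; rewrite k00 mulr0; lra.
have -> : geo ^+ k.*2 = geo ^+ k.*2.-1 * geo by rewrite -exprSr prednK// double_gt0.
have := geo_sum ratio_lt1 n; set S := \sum_(i < n) _.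
rewrite -!mulrA => h; rewrite ler_wpM2l ?exprn_ge0//.
rewrite [leRHS]mulrC -!mulrA ler_wpM2l// ler_wpM2l//.
Qed.

End chain_moment.

(** * Integrals of the norm majorant *)

Section weighted.
Context d (Omega : measurableType d) (R : realType) (P : probability Omega R).

(** The series on the right-hand side of hnorm_pow_le, as a function on Omega. *)
Definition norm_majorant (b w : nat -> R) (k : nat) (h : nat -> Omega -> \bar R) (x : Omega) : \bar R :=
  (\sum_(0 <= j <oo) ((b j * (w j / b j) ^+ k)%:E * h j x))%E.

Variables (b w a : nat -> R) (B : R) (k : nat) (h : nat -> Omega -> \bar R).
Hypotheses (b0 : forall j, 0 < b j) (bB : forall n, \sum_(i < n) b i <= B)
  (w0 : forall j, 0 <= w j) (a0 : forall j, 0 <= a j) (wab : forall j, w j * a j <= b j)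
  (h0 : forall j x, (0 <= h j x)%E) (mh : forall j, measurable_fun setT (h j)).

Let c0 j : 0 <= b j * (w j / b j) ^+ k.
Proof. by rewrite mulr_ge0 ?exprn_ge0 ?divr_ge0// ltW. Qed.

Lemma measurable_norm_majorant : measurable_fun setT (norm_majorant b w k h).
Proof.
apply: (@ge0_emeasurable_sum _ _ _ _
  (fun j x => ((b j * (w j / b j) ^+ k)%:E * h j x)%E) xpredT) => j.
- by move=> x _ _; rewrite mule_ge0// lee_fin.
- by move=> _; exact: measurable_funeM.
Qed.

Lemma norm_majorant_ge0 x : (0 <= norm_majorant b w k h x)%E.
Proof. by apply: nneseries_ge0 => j _ _; rewrite mule_ge0// lee_fin. Qed.

(** The weights are matched to the moments: the j-th term integrates to at most
    K (b j). *)
Lemma integral_norm_majorant (K : R) : 0 <= K ->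
  (forall j, \int[P]_x h j x <= (K * a j ^+ k)%:E)%E ->
  (\int[P]_x norm_majorant b w k h x <= (K * B)%:E)%E.
Proof.
move=> K0 hK; rewrite /norm_majorant integral_nneseries//; last 2 first.
- by move=> j; exact: measurable_funeM.
- by move=> j x _; rewrite mule_ge0// lee_fin.
apply: (@le_trans _ _ (\sum_(0 <= j <oo) (K * b j)%:E)%E).
  apply: lee_nneseries => j _.
    by move=> _; apply: integral_ge0 => x _; rewrite mule_ge0// lee_fin.
  rewrite ge0_integralZl//; last by rewrite lee_fin.
  apply: (@le_trans _ _ ((b j * (w j / b j) ^+ k)%:E * (K * a j ^+ k)%:E)%E).
    by apply: lee_wpmul2l; rewrite ?lee_fin.
  rewrite -EFinM lee_fin.
  have -> : b j * (w j / b j) ^+ k * (K * a j ^+ k) = K * b j * (w j * a j / b j) ^+ k.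
    by rewrite !exprMn; ring.
  rewrite ler_piMr ?mulr_ge0 ?(ltW (b0 _))// exprn_ile1//.
    by rewrite divr_ge0 ?mulr_ge0// ltW.
  by rewrite ler_pdivrMr// mul1r.
apply: lime_le.
  by apply: is_cvg_nneseries => j _ _; rewrite lee_fin mulr_ge0// ltW.
apply: nearW => n; rewrite sumEFin lee_fin -mulr_sumr big_mkord ler_wpM2l//.
Qed.

Lemma integral_affine_majorant (K c e : R) : 0 <= K -> 0 <= c -> 0 <= e ->
  (forall j, \int[P]_x h j x <= (K * a j ^+ k)%:E)%E ->
  (\int[P]_x (c%:E * (1%:E + e%:E * norm_majorant b w k h x)) <= (c * (1 + e * (K * B)))%:E)%E.
Proof.
move=> K0 cc0 e0 hK; have mQ := measurable_norm_majorant.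
rewrite ge0_integralZl//; last 2 first.
- by apply: emeasurable_funD; [exact: measurable_cst|exact: measurable_funeM].
- by move=> x _; apply: adde_ge0 => //; rewrite mule_ge0 ?lee_fin ?norm_majorant_ge0.
rewrite EFinM; apply: lee_wpmul2l; first by rewrite lee_fin.
rewrite ge0_integralD//; last 2 first.
- by move=> x _; rewrite mule_ge0 ?lee_fin ?norm_majorant_ge0.
- exact: measurable_funeM.
rewrite EFinD; apply: leeD.
  by rewrite integral_cst//= probability_setT mule1.
rewrite ge0_integralZl//; last by move=> x _; exact: norm_majorant_ge0.
rewrite EFinM; apply: lee_wpmul2l; first by rewrite lee_fin.
exact: integral_norm_majorant.
Qed.

End weighted.

(** * L2 continuity along dyadic times *)

Section continuity.
Context {R : realType}.

Lemma cvg_fourier_coef (v : nat -> R -> R) (v0 : R -> R) j :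
  (forall n, square_integrable (v n)) -> square_integrable v0 ->
  l2sqnorm (fun x => v n x - v0 x) @[n --> \oo] --> 0%E ->
  fourier_coef (v n) j @[n --> \oo] --> fourier_coef v0 j.
Proof.
move=> sv sv0 cv; apply/cvgrPdist_le => e e0.
have [N hN] := cvge0_lt cv (exprn_gt0 2 e0).
exists N => // n /= Nn; rewrite distrC -fourier_coefB//.
by apply: fourier_coef_le => //; [exact: square_integrableB|apply: ltW; exact: hN].
Qed.

Lemma dyadic_floor_cvg (T t : R) : 0 < T -> 0 <= t <= T ->
  dyadic_floor T n t @[n --> \oo] --> within `[0, T] (nbhs t).
Proof.
move=> hT /andP[t0 tT]; have bnd n := @dyadic_floorP _ T hT n t t0.
have c : dyadic_floor T n t @[n --> \oo] --> t.
  have m0 : T / 2 ^+ n @[n --> \oo] --> (0 : R).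
    rewrite -(mulr0 T); apply: cvgMr; under eq_fun do rewrite -exprVn.
    by apply: cvg_expr; rewrite ger0_norm ?invr_ge0// invf_lt1// ltr1n.
  apply: (@squeeze_cvgr _ _ _ _ (fun n => t - T / 2 ^+ n) (fun=> t)).
  - by apply: nearW => n; have /andP[] := bnd n; move=> *; apply/andP; split; lra.
  - by rewrite -[X in _ --> X]subr0; apply: cvgB => //; exact: cvg_cst.
  - exact: cvg_cst.
move=> A wA; have [N _ hN] := c _ wA; exists N => // n Nn; apply: (hN n Nn).
rewrite /= in_itv/= dyadic_floor_ge0//=; have /andP[+ _] := bnd n; lra.
Qed.

End continuity.

(** * Moments of the supremum and of the increments *)

Section estimates.
Context d (Omega : measurableType d) (R : realType) (P : probability Omega R)
  (T H1 H2 : R) (o : R -> R -> Omega -> R) (W : nat -> R -> Omega -> R).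
Hypotheses (hT : 0 < T) (hH1 : 2^-1 <= H1 < 1) (hH2 : 2^-1 <= H2 < 1)
  (mo : measurable_field T o) (hW : mode_interface P T H1 H2 o W).

Let mW j t : measurable_fun setT (W j t). Proof. by case: hW. Qed.

Lemma ae_coef_modes (v : R -> R -> Omega -> R) t : measurable_field T v ->
  (forall x, 0 < x < pi -> {ae P, forall w, v t x w = o t x w}) -> 0 <= t <= T ->
  {ae P, forall w, square_integrable (fun x => v t x w) /\
     forall j, fourier_coef (fun x => v t x w) j = W j t w}.
Proof.
move=> mv vo t0; have [_ _ _ [C [C0 hC]]] := hW.
apply: (@ae_fourier_coef _ _ _ P (v t) (fun j => W j t) C) => //; first exact: mv.
move=> x N x0 N0; apply: le_trans (hC t x N t0 x0 N0).
have mS : measurable_fun setT (fun w => \sum_(i < N) eigfun i x * W i t w).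
  by apply: measurable_sum => i; apply: measurable_funM => //; exact: measurable_cst.
apply: ae_le_integral_nonmeas.
- by move=> w; rewrite lee_fin sqr_ge0.
- by move=> w; rewrite lee_fin sqr_ge0.
- apply: measurable_sqr; apply: measurable_funB => //.
  exact: (measurable_field_section mo).
- by apply: filterS (vo x x0) => w ->.
Qed.

Definition mode_weight (th : R) (j : nat) : R := (j%:R + 1) `^ (1 - 2 * H2 - 8 * H1 + 8 * th).

Definition summable_weight (kap : R) (j : nat) : R := (j%:R + 1) `^ (- 1 - kap).

Lemma summable_weight_gt0 kap j : 0 < summable_weight kap j.
Proof. by rewrite powR_gt0// ltr_wpDl. Qed.

(** The exponents add up to -1 - kap, where kap is eight times the gap between th
    and the critical time regularity. *)
Lemma weight_product_le (th beta : R) j : 0 <= beta ->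
  sobolev_weight beta j * mode_weight th j <=
  summable_weight (8 * ((4 * H1 + H2 - 1 - beta) / 4 - th)) j.
Proof.
move=> b0; have j1 : 0 < j%:R + 1 :> R by rewrite ltr_wpDl.
have -> : summable_weight (8 * ((4 * H1 + H2 - 1 - beta) / 4 - th)) j =
    (j%:R + 1) `^ (2 * beta) * mode_weight th j.
  rewrite /summable_weight /mode_weight -powRD ?(gt_eqF j1) ?implybT//.
  by congr powR; field.
have -> : (j%:R + 1) `^ (2 * beta) = ((j%:R + 1) ^+ 2) `^ beta.
  by rewrite powRrM (powR_mulrn 2 (ltW j1)).
rewrite ler_wpM2r ?powR_ge0// /sobolev_weight /eigval ge0_ler_powR ?nnegrE ?sqr_ge0//.
by rewrite lerXn2r ?nnegrE ?(ltW j1)// lerDl.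
Qed.

Lemma exponent_exists (p x : R) : exists k : nat, p <= k.+1.*2%:R /\ x <= k.+1%:R.
Proof.
exists (Num.truncn (Num.max p x)).
have h : Num.max p x < (Num.truncn (Num.max p x)).+1%:R by exact: truncnS_gt.
have hp : p <= Num.max p x by rewrite le_max lexx.
have hx : x <= Num.max p x by rewrite le_max lexx orbT.
move: (Num.truncn _).+1 h => n h; rewrite -addnn natrD.
by have : 0 <= n%:R :> R by []; split; lra.
Qed.

Lemma mode_chain_moment (th : R) (k : nat) : 0 < th -> th <= H1 -> 1 <= th * k%:R ->
  exists K : R, 0 <= K /\ forall j,
  (\int[P]_w chain_bound T (ratio th) k (fun t => W j t w) <=
   (K * mode_weight th j ^+ k)%:E)%E.
Proof.
move=> th0 thH thk; have [_ M2 _ _] := hW.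
have k0 : (0 < k)%N.
  by rewrite lt0n; apply/eqP => kz; move: thk; rewrite kz mulr0; lra.
have [C [C0 hC]] := M2 k th k0 ltac:(apply/andP; split; lra).
have g0 : 0 <= geo (ratio th) := le_trans ler01 (geo_ge1 (ratio_lt1 th0)).
exists (geo (ratio th) ^+ k.*2 * C * (T `^ (2 * th)) ^+ k); split.
  apply: mulr_ge0; last by rewrite exprn_ge0// powR_ge0.
  by apply: mulr_ge0; [exact: exprn_ge0|exact: ltW].
move=> j; have := @chain_moment _ _ _ P T th k hT th0 thk (W j) C (mode_weight th j)
  (ltW C0) (powR_ge0 _ _) (mW j).
have -> : geo (ratio th) ^+ k.*2 * C * (T `^ (2 * th)) ^+ k * mode_weight th j ^+ k =
    geo (ratio th) ^+ k.*2 * C * (mode_weight th j * T `^ (2 * th)) ^+ k.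
  by rewrite exprMn; ring.
by apply => s t s0 st tT; exact: hC.
Qed.

(** Chaining bounds each mode at all dyadic times by one variable; L2 continuity
    of the paths extends the bound to all times. Any positive th below the critical
    regularity will do. *)
Theorem sup_moment_finite (p beta : R) (o' : R -> R -> Omega -> R) : 1 <= p ->
  0 <= beta < 4 * H1 + H2 - 1 -> continuous_version P T o o' ->
  (\int[P]_w ereal_sup
     [set poweR (hnorm beta (fun x => o' t x w)) p | t in `[0%R, T]] < +oo)%E.
Proof.
move=> p1 /andP[b0 b1] [mo' o'o co'].
have /andP[H1a H1b] := hH1; have /andP[H2a H2b] := hH2.
pose gam := (4 * H1 + H2 - 1 - beta) / 4.
have gam0 : 0 < gam by rewrite divr_gt0//; lra.
(* positive, at most H1, and strictly below the critical regularity *)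
pose th := Num.min H1 (gam / 2).
have th0 : 0 < th by rewrite lt_min; apply/andP; split; lra.
have thH : th <= H1 by rewrite ge_min lexx.
have thg : th <= gam / 2 by rewrite ge_min lexx orbT.
pose kap := 8 * (gam - th); have kap0 : 0 < kap by rewrite /kap; lra.
have [k' [pk hk]] := exponent_exists p th^-1; set k := k'.+1 in pk hk.
have thk : 1 <= th * k%:R by rewrite -ler_pdivrMl// mulr1.
have [_ _ W0 _] := hW.
have [K [K0 hK]] := mode_chain_moment th0 thH thk.
pose rho := ratio th; have hr : 0 < rho < 1 := ratio_lt1 th0.
pose h j w := chain_bound T rho k (fun t => W j t w).
have k2 (y : R) : 0 <= y ^+ k.*2 by rewrite exprn_even_ge0// odd_double.
have h0 j w : (0 <= h j w)%E.
  by apply: nneseries_ge0 => m _ _; rewrite lee_fin (chain_term_ge0 T hr).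
have mh j : measurable_fun setT (h j).
  by apply: (measurable_chain_bound T k th0) => t; exact: mW.
pose b := summable_weight kap; pose w_ := sobolev_weight beta.
have bpos j : 0 < b j by exact: summable_weight_gt0.
have bB n : \sum_(i < n) b i <= 1 + kap^-1 by exact: zeta_sum.
pose G w := ((1 `^ p)%:E * (1%:E + ((1 ^+ k.*2)^-1 * (1 + kap^-1) ^+ k')%:E *
   norm_majorant b w_ k h w))%E.
have B0 : 0 <= (1 ^+ k.*2)^-1 * (1 + kap^-1) ^+ k'.
  by rewrite expr1n invr1 mul1r exprn_ge0// addr_ge0// invr_ge0 ltW.
have wa j : w_ j * mode_weight th j <= b j by exact: weight_product_le.
have intG : (\int[P]_w G w < +oo)%E.
  apply: (le_lt_trans (@integral_affine_majorant _ _ _ P b w_ (mode_weight th) (1 + kap^-1) k h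
    bpos bB (fun j => powR_ge0 _ _) (fun j => powR_ge0 _ _) wa h0 mh K _ _ K0 (powR_ge0 _ _) B0 hK)).
  exact: ltry.
have mG : measurable_fun setT G.
  apply: measurable_funeM; apply: emeasurable_funD; first exact: measurable_cst.
  apply: measurable_funeM; apply: measurable_norm_majorant => // i; exact: powR_ge0.
have G0 w : (0 <= G w)%E.
  rewrite mule_ge0 ?lee_fin ?powR_ge0// adde_ge0// mule_ge0 ?lee_fin//.
  by apply: norm_majorant_ge0 => // j; exact: powR_ge0.
apply: le_lt_trans intG; apply: ae_le_integral_nonmeas => //.
  move=> w; apply: (@le_trans _ _ (poweR (hnorm beta (fun x => o' 0 x w)) p)); first exact: poweR_ge0.
  by apply: ereal_sup_ubound; exists 0 => //=; rewrite in_itv/= lexx ltW.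
have aeD : {ae P, forall w n (i : nat), (i <= 2 ^ n)%N -> forall j,
    fourier_coef (fun x => o' (dyadic T n i) x w) j = W j (dyadic T n i) w}.
  apply: ae_foralln => n; apply: ae_foralln => i.
  have [iN|iN] := leqP i (2 ^ n); last by apply: aeW.
  have t0 : 0 <= dyadic T n i <= T.
    by rewrite -{1}(dyadic0 T n) -{4}(dyadic_max T n) !le_dyadic.
  have := @ae_coef_modes o' (dyadic T n i) mo' (fun x => o'o _ x t0) t0.
  by apply: filterS => w [_ h'] _.
apply: filterS aeD => w hw; apply: ge_ereal_sup => _ [t t0 <-].
have {}t0 : 0 <= t <= T by move: t0; rewrite /= in_itv.
have /andP[t1 t2] := t0; have [st ct] := co' w t t0.
apply: (@hnorm_pow_le _ beta p 1 (1 + kap^-1) _ b k' (fun j => h j w)) => // j.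
have df0 n : 0 <= dyadic_floor T n t <= T.
  rewrite dyadic_floor_ge0//=; have /andP[+ _] := @dyadic_floorP _ T hT n t t1; lra.
have cvc : fourier_coef (fun x => o' (dyadic_floor T n t) x w) j @[n --> \oo]
    --> fourier_coef (fun x => o' t x w) j.
  apply: cvg_fourier_coef => //; first by move=> n; have [] := co' w _ (df0 n).
  exact: (cvg_comp _ _ (dyadic_floor_cvg hT t0) ct).
have cvk : fourier_coef (fun x => o' (dyadic_floor T n t) x w) j ^+ k.*2 @[n --> \oo]
    --> fourier_coef (fun x => o' t x w) j ^+ k.*2.
  elim: (k.*2) => [|m IH]; first by under eq_fun do rewrite expr0; exact: cvg_cst.
  by under eq_fun do rewrite exprS; rewrite exprS; exact: cvgM.
have cvE : (fourier_coef (fun x => o' (dyadic_floor T n t) x w) j ^+ k.*2)%:E @[n --> \oo]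
    --> (fourier_coef (fun x => o' t x w) j ^+ k.*2)%:E.
  by apply/fine_cvgP; split; [exact: nearW|exact: cvk].
rewrite -(cvg_lim (@ereal_hausdorff R) cvE); apply: lime_le.
  by apply/cvg_ex; eexists; exact: cvE.
apply: nearW => n; rewrite /dyadic_floor hw ?dyadic_index_le//.
exact: (@dyadic_floor_chain _ T hT rho hr k (fun t => W j t w)).
Qed.

(** The exponent th is the one claimed or, when that one is negative, 0; in the
    latter case the claimed power of t - s is bounded below on [0, T]. *)
Theorem increment_moment (p beta eps : R) : 1 <= p -> 0 <= beta < 4 * H1 + H2 - 1 ->
  0 < eps -> exists C : R, 0 < C /\ forall s t : R, 0 <= s -> s < t -> t <= T ->
  (\int[P]_w poweR (hnorm beta (fun x => (o t x w - o s x w)%R)) p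
   <= (C * (t - s) `^ (((4 * H1 + H2 - 1 - beta) / 4 - eps / 2) * p))%:E)%E.
Proof.
move=> p1 /andP[b0 b1] e0.
have /andP[H1a H1b] := hH1; have /andP[H2a H2b] := hH2.
pose gam := (4 * H1 + H2 - 1 - beta) / 4.
have gam0 : 0 < gam by rewrite divr_gt0//; lra.
pose th := Num.max 0 (gam - eps / 2).
have th0 : 0 <= th by rewrite le_max lexx.
have thH : th <= H1 by rewrite /th /gam ge_max; apply/andP; split; lra.
have thg : th < gam by rewrite gt_max; apply/andP; split; lra.
pose kap := 8 * (gam - th); have kap0 : 0 < kap by rewrite /kap; lra.
have [k' [pk _]] := exponent_exists p 0; set k := k'.+1 in pk.
have [_ M2 W0 _] := hW.
have [C [C0 hC]] := M2 k th isT ltac:(apply/andP; split; lra).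
have B0 : 0 < 1 + kap^-1 by rewrite addr_gt0// invr_gt0.
pose rest := (gam - eps / 2) - th.
have rest0 : rest <= 0 by rewrite /rest /th subr_le0 le_max lexx orbT.
pose D := 1 + C * (1 + kap^-1) ^+ k.
have D0 : 0 < D by rewrite addr_gt0// mulr_gt0// exprn_gt0.
exists (D * T `^ (- rest * p)); split; first by rewrite mulr_gt0// powR_gt0.
move=> s t s0 st tT; have dt0 : 0 < t - s by lra.
pose l := (t - s) `^ th; have l0 : 0 < l by rewrite powR_gt0.
pose h j w := ((W j t w - W j s w) ^+ k.*2)%:E.
have k2 (y : R) : 0 <= y ^+ k.*2 by rewrite exprn_even_ge0// odd_double.
have h0 j w : (0 <= h j w)%E by rewrite lee_fin.
have mh j : measurable_fun setT (h j).
  by apply/measurable_EFinP; apply: measurable_funX; exact: measurable_funB.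
pose K := C * l ^+ k.*2.
have K0 : 0 <= K by rewrite mulr_ge0 ?(ltW C0)// exprn_ge0// ltW.
have hK j : (\int[P]_w h j w <= (K * mode_weight th j ^+ k)%:E)%E.
  apply: (le_trans (hC j s t s0 st tT)); rewrite lee_fin le_eqVlt; apply/orP; left; apply/eqP.
  rewrite /K /l -mul2n exprM -mulrA -exprMn; congr (_ * _ ^+ _).
  rewrite [RHS]mulrC; congr (_ * _).
  by rewrite -(powR_mulrn 2 (powR_ge0 _ _)) -powRrM mulrC.
pose b := summable_weight kap; pose w_ := sobolev_weight beta.
have bpos j : 0 < b j by exact: summable_weight_gt0.
have bB n : \sum_(i < n) b i <= 1 + kap^-1 by exact: zeta_sum.
have wa j : w_ j * mode_weight th j <= b j by exact: weight_product_le.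
have t0T : 0 <= t <= T by apply/andP; split; lra.
have s0T : 0 <= s <= T by apply/andP; split; lra.
have lB : 0 <= (l ^+ k.*2)^-1 * (1 + kap^-1) ^+ k'.
  by rewrite mulr_ge0 ?invr_ge0 ?exprn_ge0// ltW.
apply: (@le_trans _ _ (\int[P]_w ((l `^ p)%:E * (1%:E + ((l ^+ k.*2)^-1 * (1 + kap^-1) ^+ k')%:E *
   norm_majorant b w_ k h w)))%E).
  apply: ae_le_integral_nonmeas.
  - by move=> w; exact: poweR_ge0.
  - move=> w; rewrite mule_ge0 ?lee_fin ?powR_ge0// adde_ge0// mule_ge0 ?lee_fin//.
    by apply: norm_majorant_ge0 => // j; exact: powR_ge0.
  - apply: measurable_funeM; apply: emeasurable_funD; first exact: measurable_cst.
    apply: measurable_funeM; apply: measurable_norm_majorant => // i; exact: powR_ge0.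
  have := @ae_coef_modes o t mo (fun x _ => aeW _ (fun w => erefl _)) t0T.
  have := @ae_coef_modes o s mo (fun x _ => aeW _ (fun w => erefl _)) s0T.
  apply: filterS2 => w [ss cs] [sst ct].
  apply: (@hnorm_pow_le _ beta p l (1 + kap^-1) _ b k' (fun j => h j w)) => //.
    exact: square_integrableB.
  by move=> j; rewrite fourier_coefB// cs ct.
apply: (le_trans (@integral_affine_majorant _ _ _ P b w_ (mode_weight th) (1 + kap^-1) k h
    bpos bB (fun j => powR_ge0 _ _) (fun j => powR_ge0 _ _) wa h0 mh K _ _ K0 (powR_ge0 _ _) lB hK)).
rewrite lee_fin.
have -> : (l ^+ k.*2)^-1 * (1 + kap^-1) ^+ k' * (K * (1 + kap^-1)) = D - 1.
  have : l ^+ k.*2 != 0 by rewrite expf_neq0// gt_eqF.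
  rewrite /D /K /k (exprSr (1 + kap^-1) k').
  move: (l ^+ _) ((1 + kap^-1) ^+ k') (1 + kap^-1) => e g m e1; by field.
rewrite addrC subrK mulrC -mulrA ler_wpM2l ?(ltW D0)//.
have -> : (gam - eps / 2) * p = th * p + rest * p by rewrite /rest; ring.
rewrite powRD ?(gt_eqF dt0) ?implybT// mulrCA /l -powRrM ler_peMr ?powR_ge0//.
rewrite mulNr powRN mulrC ler_pdivlMr ?powR_gt0// mul1r.
have rp : 0 <= - (rest * p) by rewrite oppr_ge0 mulr_le0_ge0//; lra.
rewrite -lef_pV2 ?posrE ?powR_gt0// -!powRN.
by rewrite ge0_ler_powR ?nnegrE ?(ltW hT) ?(ltW dt0)//; lra.
Qed.

End estimates.

(** * Limits along dyadic times *)

Section dyadic_limit.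
Context {R : realType}.
Variables (T rho : R) (k : nat).
Hypotheses (hT : 0 < T) (hrho : 0 < rho < 1) (k0 : (0 < k)%N).

Definition dyadic_lim (f : R -> R) (t : R) : R := limn (fun n => f (dyadic_floor T n t)).

Variable f : R -> R.
Hypotheses (f0 : f 0 = 0) (fb : (chain_bound T rho k f < +oo)%E).

Let u m := rho ^+ m + chain_term T rho k f m.

Let u_ge0 m : 0 <= u m.
Proof.
by rewrite addr_ge0 ?(chain_term_ge0 T hrho)// exprn_ge0//; have /andP[/ltW] := hrho.
Qed.

Let u_sum : exists s : R, (forall n, \sum_(i < n) u i <= s) /\
  (forall e : R, 0 < e -> exists n, s - \sum_(i < n.+1) u i <= e /\ u n <= e).
Proof.
have c0 : (0 <= chain_bound T rho k f)%E.
  by apply: nneseries_ge0 => m _ _; rewrite lee_fin (chain_term_ge0 T hrho).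
have fc : chain_bound T rho k f \is a fin_num by rewrite ge0_fin_numE.
have [|s [_ s0 cs]] := @nneseries_bounded R u (geo rho + fine (chain_bound T rho k f)) u_ge0.
  move=> n; rewrite big_split/= lerD ?(geo_sum hrho)// -lee_fin fineK// -sumEFin.
  rewrite -(big_mkord xpredT (fun m => (chain_term T rho k f m)%:E)).
  by apply: nneseries_lim_ge => m _ _; rewrite lee_fin (chain_term_ge0 T hrho).
have nd : {homo (fun n => \sum_(i < n) u i) : m n / (m <= n)%N >-> m <= n}.
  move=> m n mn; rewrite -!(big_mkord xpredT u) (@big_cat_nat _ _ _ m 0 n)//= lerDl.
  exact: sumr_ge0.
have ub n : \sum_(i < n) u i <= s.
  rewrite -(cvg_lim (@Rhausdorff R) cs); apply: (nondecreasing_cvgn_le nd).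
  by apply/cvg_ex; eexists; exact: cs.
exists s; split => // e e0.
have /cvgrPdist_le/(_ e e0)[N _ hN] := cs.
exists N; split.
  apply: le_trans (hN N.+1 _); [exact: ler_norm|exact: leqnSn].
have h1 := hN N (leqnn N); have h2 := ub N.+1.
rewrite big_ord_recr/= in h2; have := le_trans (ler_norm _) h1.
lra.
Qed.

Lemma floor_increment_le t n m : 0 <= t -> t <= T -> (n <= m)%N ->
  `|f (dyadic_floor T m t) - f (dyadic_floor T n t)| <=
    \sum_(i < m.+1) u i - \sum_(i < n.+1) u i.
Proof.
move=> t0 tT; elim: m => [|m IH].
  by rewrite leqn0 => /eqP ->; rewrite !subrr normr0.
rewrite leq_eqVlt => /orP[/eqP ->|]; first by rewrite !subrr normr0.
rewrite ltnS => /IH {}IH; rewrite big_ord_recr/=.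
have := @floor_step_le R T hT k f t m.+1 k0 f0 t0 tT.
move=> /(small_pow_le hrho m.+1 k0); rewrite -/(chain_term T rho k f m.+1) -/(u m.+1) /= => h.
have := ler_normD (f (dyadic_floor T m.+1 t) - f (dyadic_floor T m t))
  (f (dyadic_floor T m t) - f (dyadic_floor T n t)).
rewrite addrA subrK; lra.
Qed.

Lemma is_cvg_dyadic t : 0 <= t -> t <= T -> cvgn (fun n => f (dyadic_floor T n t)).
Proof.
move=> t0 tT; have [s [us ue]] := u_sum.
apply: (@cvg_of_summable_increments _ _ (fun n => u n.+1)).
  move=> n; have := floor_increment_le t0 tT (leqnSn n).
  by rewrite [\sum_(i < n.+2) _]big_ord_recr/= addrAC subrr add0r.
apply: nneseries_lty_cvg => [n|]; first exact: u_ge0.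
apply: (@le_lt_trans _ _ s%:E); last exact: ltry.
apply: lime_le; first by apply: is_cvg_nneseries => n _ _; rewrite lee_fin.
apply: nearW => n; rewrite sumEFin lee_fin; apply: le_trans (us n.+1).
by rewrite big_ord_recl/= big_mkord lerDr.
Qed.

Lemma dyadic_lim_cvg t : 0 <= t -> t <= T ->
  f (dyadic_floor T n t) @[n --> \oo] --> dyadic_lim f t.
Proof. by move=> t0 tT; exact: is_cvg_dyadic. Qed.

Lemma dyadic_lim_pow_le t : 0 <= t -> t <= T ->
  dyadic_lim f t ^+ k.*2 <= fine (chain_bound T rho k f).
Proof.
move=> t0 tT; have c := dyadic_lim_cvg t0 tT.
have ck : f (dyadic_floor T n t) ^+ k.*2 @[n --> \oo] --> dyadic_lim f t ^+ k.*2.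
  elim: (k.*2) => [|m IH]; first by under eq_fun do rewrite expr0; exact: cvg_cst.
  by under eq_fun do rewrite exprS; rewrite exprS; exact: cvgM.
have c0 : (0 <= chain_bound T rho k f)%E.
  by apply: nneseries_ge0 => m _ _; rewrite lee_fin (chain_term_ge0 T hrho).
have fc : chain_bound T rho k f \is a fin_num by rewrite ge0_fin_numE.
rewrite -(cvg_lim (@Rhausdorff R) ck); apply: limr_le.
  by apply/cvg_ex; eexists; exact: ck.
apply: nearW => n; rewrite -lee_fin fineK//.
exact: (dyadic_floor_chain hT hrho).
Qed.

(** Times closer than the mesh of a level have equal or adjacent dyadic floors at
    this level, and the finer levels contribute the tail of a convergent series. *)
Lemma dyadic_lim_continuous t (e : R) : 0 <= t -> t <= T -> 0 < e ->
  exists dl : R, 0 < dl /\ forall s, 0 <= s -> s <= T -> `|s - t| < dl ->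
    `|dyadic_lim f s - dyadic_lim f t| <= e.
Proof.
move=> t0 tT e0; have [S [us ue]] := u_sum.
have e30 : 0 < e / 3 by rewrite divr_gt0.
have [n [n1 n2]] := ue _ e30; exists (T / 2 ^+ n); split; first exact: mesh_gt0.
have tail s : 0 <= s -> s <= T -> `|dyadic_lim f s - f (dyadic_floor T n s)| <= e / 3.
  move=> s0 sT; have c := dyadic_lim_cvg s0 sT.
  have c' : `|f (dyadic_floor T m s) - f (dyadic_floor T n s)| @[m --> \oo] -->
      `|dyadic_lim f s - f (dyadic_floor T n s)|.
    by apply: cvg_norm; apply: cvgB => //; exact: cvg_cst.
  rewrite -(cvg_lim (@Rhausdorff R) c'); apply: limr_le.
    by apply/cvg_ex; eexists; exact: c'.
  exists n => // m /= nm; apply: (le_trans (floor_increment_le s0 sT nm)).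
  by have := us m.+1; lra.
have close s r : 0 <= s -> s <= r -> r <= T -> r - s < T / 2 ^+ n ->
    `|f (dyadic_floor T n r) - f (dyadic_floor T n s)| <= e / 3.
  move=> s0 sr rT rs; apply: le_trans n2; rewrite /u /chain_term.
  by apply: (small_pow_le hrho) => //; exact: close_step_le.
move=> s s0 sT st.
have mid : `|f (dyadic_floor T n s) - f (dyadic_floor T n t)| <= e / 3.
  have [le|/ltW le] := leP s t.
    rewrite distrC; apply: close => //; apply: le_lt_trans st.
    by rewrite distrC ler_norm.
  by apply: close => //; apply: le_lt_trans st; exact: ler_norm.
have h1 := tail s s0 sT; have h2 := tail t t0 tT; rewrite distrC in h2.
have := ler_normD (dyadic_lim f s - f (dyadic_floor T n s))
  (f (dyadic_floor T n s) - f (dyadic_floor T n t)).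
have := ler_normD (dyadic_lim f s - f (dyadic_floor T n s) +
  (f (dyadic_floor T n s) - f (dyadic_floor T n t))) (f (dyadic_floor T n t) - dyadic_lim f t).
rewrite !addrA !subrK; lra.
Qed.

End dyadic_limit.

(** * Uniformly convergent spectral series *)

Section uniform_series.
Context {R : realType}.

(** A series of coefficients with a summable majorant, against bounded
    functions: the sum inherits continuity in the parameter, uniformly in x. *)
Variables (e : nat -> R) (E : R).
Hypotheses (e0 : forall j, 0 <= e j) (eE : forall n, \sum_(i < n) e i <= E).

Lemma cvg_majorant_series (c : nat -> R) : (forall j, `|c j| <= e j) -> cvgn (series c).
Proof.
move=> ce; apply: normed_cvg; apply: (@series_le_cvg _ _ e) => [n /=|n|n /=|] //.
apply: nneseries_lty_cvg => //; have [s [-> _ _]] := nneseries_bounded e0 eE.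
exact: ltry.
Qed.

Lemma majorant_series_le (c : nat -> R) (x : R) : (forall j, `|c j| <= e j) ->
  `|limn (series (fun j => eigfun j x * c j))| <= E.
Proof.
move=> ce; have ce' j : `|eigfun j x * c j| <= e j.
  by rewrite normrM (le_trans _ (ce j))// ler_piMl// eigfun_le1.
have cv := cvg_majorant_series ce'.
have cn : `|series (fun j => eigfun j x * c j) n| @[n --> \oo] -->
    `|limn (series (fun j => eigfun j x * c j))| by exact: cvg_norm.
rewrite -(cvg_lim (@Rhausdorff R) cn); apply: limr_le.
  by apply/cvg_ex; eexists; exact: cn.
apply: nearW => n; rewrite /series/= big_mkord; apply: le_trans (eE n).
by apply: (le_trans (ler_norm_sum _ _ _)); apply: ler_sum => i _.
Qed.

Lemma finite_modulus (c : R -> nat -> R) (A : set R) (t r : R) J : 0 < r ->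
  (forall j, exists dl : R, 0 < dl /\ forall s, A s -> `|s - t| < dl -> `|c s j - c t j| <= r) ->
  exists dl : R, 0 < dl /\ forall s, A s -> `|s - t| < dl ->
    \sum_(j < J) `|c s j - c t j| <= J%:R * r.
Proof.
move=> r0 h; elim: J => [|J [d1 [d10 hd1]]].
  by exists 1; split => // s _ _; rewrite big_ord0 mul0r.
have [d2 [d20 hd2]] := h J; exists (Num.min d1 d2); split; first by rewrite lt_min d10.
move=> s As; rewrite lt_min => /andP[s1 s2]; rewrite big_ord_recr/=.
by have := hd1 s As s1; have := hd2 s As s2; rewrite -natr1; lra.
Qed.

(** Finitely many coefficients are treated one by one, the others by the tail of
    the majorant. *)
Lemma majorant_series_modulus (c : R -> nat -> R) (A : set R) (t r : R) : A t -> 0 < r ->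
  (forall s, A s -> forall j, `|c s j| <= e j) ->
  (forall j (q : R), 0 < q ->
     exists dl : R, 0 < dl /\ forall s, A s -> `|s - t| < dl -> `|c s j - c t j| <= q) ->
  exists dl : R, 0 < dl /\ forall s, A s -> `|s - t| < dl -> forall x,
   `|limn (series (fun j => eigfun j x * c s j)) - limn (series (fun j => eigfun j x * c t j))| <= r.
Proof.
move=> At r0 ce ct; have [S [_ S0 cS]] := nneseries_bounded e0 eE.
have nd : {homo (fun n => \sum_(i < n) e i) : m n / (m <= n)%N >-> m <= n}.
  move=> m n mn; rewrite -!(big_mkord xpredT e) (@big_cat_nat _ _ _ m 0 n)//= lerDl.
  exact: sumr_ge0.
have ub n : \sum_(i < n) e i <= S.
  rewrite -(cvg_lim (@Rhausdorff R) cS); apply: (nondecreasing_cvgn_le nd).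
  by apply/cvg_ex; eexists; exact: cS.
have r40 : 0 < r / 4 by rewrite divr_gt0.
have /cvgrPdist_le/(_ _ r40)[J _ hJ] := cS.
have {}hJ : S - \sum_(i < J) e i <= r / 4.
  by apply: le_trans (hJ J (leqnn J)); exact: ler_norm.
have q0 : 0 < r / (2 * J.+1%:R) by rewrite divr_gt0.
have [dl [dl0 hdl]] := @finite_modulus c A t _ J q0 (fun j => ct j _ q0).
exists dl; split => // s As st x.
have bnd u : A u -> forall j, `|eigfun j x * c u j| <= e j.
  by move=> Au j; rewrite normrM (le_trans _ (ce u Au j))// ler_piMl// eigfun_le1.
have cs := cvg_majorant_series (bnd s As); have ctt := cvg_majorant_series (bnd t At).
have cn : `|series (fun j => eigfun j x * c s j) n - series (fun j => eigfun j x * c t j) n|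
   @[n --> \oo] --> `|limn (series (fun j => eigfun j x * c s j)) -
      limn (series (fun j => eigfun j x * c t j))|.
  by apply: cvg_norm; exact: cvgB.
rewrite -(cvg_lim (@Rhausdorff R) cn); apply: limr_le.
  by apply/cvg_ex; eexists; exact: cn.
exists J => // n /= Jn; rewrite /series/= -sumrB.
apply: (le_trans (ler_norm_sum _ _ _)).
apply: (@le_trans _ _ (\sum_(0 <= j < n) `|c s j - c t j|)).
  by apply: ler_sum => j _; rewrite -mulrBr normrM ler_piMl// eigfun_le1.
rewrite (@big_cat_nat _ _ _ J 0 n)//= big_mkord.
have h1 := hdl s As st.
have h2 : J%:R * (r / (2 * J.+1%:R)) <= r / 2.
  rewrite mulrA ler_pdivrMr ?mulr_gt0//.
  have : J%:R <= J.+1%:R :> R by rewrite ler_nat.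
  by move: (J%:R : R) (J.+1%:R : R) => a b ab; nra.
have h3 : \sum_(J <= j < n) `|c s j - c t j| <= 2 * (\sum_(J <= j < n) e j).
  rewrite mulr_sumr; apply: ler_sum => j _; apply: (le_trans (ler_normB _ _)).
  by have := ce s As j; have := ce t At j; lra.
have h4 : \sum_(J <= j < n) e j <= r / 4.
  apply: le_trans hJ; rewrite lerBrDr addrC -(big_mkord xpredT e) -big_cat_nat//= big_mkord.
  exact: ub.
have h5 : \sum_(J <= j < n) `|c s j - c t j| <= r / 2 by apply: (le_trans h3); lra.
by apply: (le_trans (lerD (le_trans h1 h2) h5)); lra.
Qed.

End uniform_series.

(** * Existence of a continuous version *)

Section existence.
Context d (Omega : measurableType d) (R : realType) (P : probability Omega R)
  (T H1 H2 : R) (o : R -> R -> Omega -> R) (W : nat -> R -> Omega -> R).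
Hypotheses (hT : 0 < T) (hH1 : 2^-1 <= H1 < 1) (hH2 : 2^-1 <= H2 < 1)
  (mo : measurable_field T o) (hW : mode_interface P T H1 H2 o W).

Let mW j t : measurable_fun setT (W j t). Proof. by case: hW. Qed.

(* With th = 1/8 the mean squares of the modes decay like (j+1)^(-3), which leaves
   room for the summable weight (j+1)^(-3/2). *)
Let th : R := 8^-1.
Let k := 8%N.
Let th0 : 0 < th. Proof. by rewrite /th invr_gt0. Qed.
Let thk : 1 <= th * k%:R. Proof. by rewrite /th /k mulVf. Qed.
Let rho : R := ratio th.
Let hrho : 0 < rho < 1. Proof. exact: ratio_lt1. Qed.
Let b : nat -> R := summable_weight (2^-1).
Let wgt (j : nat) : R := (b j)^-1.

Let b_gt0 j : 0 < b j. Proof. exact: summable_weight_gt0. Qed.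

Let b_sum n : \sum_(i < n) b i <= 1 + (2^-1)^-1.
Proof. by apply: zeta_sum; rewrite invr_gt0. Qed.

(* Off an almost sure event the modes are replaced by 0, so that all paths have
   a finite chaining bound. *)
Let raw j w := chain_bound T rho k (fun t => W j t w).
Let good : set Omega := [set w | (norm_majorant b wgt k raw w < +oo)%E].
Let path j t w : R := \1_good w * W j t w.
Let bound j w : R := b j + b j * (wgt j / b j) ^+ k *
  fine (chain_bound T rho k (fun t => path j t w)).

Let raw_ge0 j w : (0 <= raw j w)%E.
Proof. by apply: nneseries_ge0 => m _ _; rewrite lee_fin (chain_term_ge0 T hrho). Qed.

Let measurable_raw j : measurable_fun setT (raw j).
Proof. by apply: (measurable_chain_bound T k th0) => t; exact: mW. Qed.

Let wgt_ge0 j : 0 <= wgt j. Proof. by rewrite invr_ge0 ltW. Qed.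

Let measurable_good : measurable good.
Proof.
have := @emeasurable_fun_infty_o _ _ _ setT _ measurableT
  (@measurable_norm_majorant _ Omega R b wgt k raw b_gt0 wgt_ge0 raw_ge0 measurable_raw) +oo%E.
by rewrite setTI.
Qed.

Let measurable_path j t : measurable_fun setT (path j t).
Proof. by apply: measurable_funM => //; exact: measurable_indic. Qed.

Let path0 j w : path j 0 w = 0.
Proof. by rewrite /path; case: hW => _ _ -> _; rewrite mulr0. Qed.

Let path_good j w : good w -> (fun t => path j t w) = (fun t => W j t w).
Proof. by move=> gw; apply/funext => t; rewrite /path indicE mem_set// mul1r. Qed.

Let path_bad j w : ~ good w -> (fun t => path j t w) = (fun=> 0).
Proof. by move=> gw; apply/funext => t; rewrite /path indicE memNset// mul0r. Qed.

Let chain_bound0 : chain_bound T rho k (fun=> 0) = 0%E.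
Proof.
apply: eseries0 => m _ _; rewrite /chain_term /dyadic_variation big1 ?mulr0// => i _.
by rewrite subrr expr0n.
Qed.

Let path_majorant w : exists2 q : R,
  (norm_majorant b wgt k (fun j w => chain_bound T rho k (fun t => path j t w)) w = q%:E)%E &
  forall j, chain_bound T rho k (fun t => path j t w) \is a fin_num.
Proof.
have c0 j : 0 < b j * (wgt j / b j) ^+ k.
  by rewrite mulr_gt0// exprn_gt0// divr_gt0// invr_gt0.
have [gw|gw] := pselect (good w); last first.
  exists 0; first by apply: eseries0 => j _ _; rewrite path_bad// chain_bound0 mule0.
  by move=> j; rewrite path_bad// chain_bound0.
have g' : (norm_majorant b wgt k (fun j w => chain_bound T rho k (fun t => path j t w)) w =
    norm_majorant b wgt k raw w)%E.
  by apply: eq_eseriesr => j _; rewrite path_good.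
have n0 : (0 <= norm_majorant b wgt k raw w)%E by exact: norm_majorant_ge0.
exists (fine (norm_majorant b wgt k raw w)); first by rewrite g' fineK// ge0_fin_numE.
move=> j; rewrite path_good// ge0_fin_numE; last exact: raw_ge0.
rewrite ltNge leye_eq; apply/negP => /eqP rj.
have : ((b j * (wgt j / b j) ^+ k)%:E * raw j w <= norm_majorant b wgt k raw w)%E.
  have := @nneseries_lim_ge R (fun j => ((b j * (wgt j / b j) ^+ k)%:E * raw j w)%E) xpredT 0%N j.+1.
  rewrite big_nat_recr//= => h; apply: le_trans (h _); last first.
    by move=> i _ _; rewrite mule_ge0// lee_fin ltW.
  by rewrite leeDr// sume_ge0// => i _; rewrite mule_ge0// lee_fin ltW.
rewrite /raw rj gt0_muley ?lte_fin// leye_eq => /eqP nw.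
by move: gw; rewrite /good /= nw ltxx.
Qed.

Let path_fin j w : (chain_bound T rho k (fun t => path j t w) < +oo)%E.
Proof.
have [q _ /(_ j)] := path_majorant w; rewrite ge0_fin_numE//.
by apply: nneseries_ge0 => m _ _; rewrite lee_fin (chain_term_ge0 T hrho).
Qed.

Let bound_ge0 j w : 0 <= bound j w.
Proof.
rewrite addr_ge0 ?(ltW (b_gt0 _))// mulr_ge0//.
  by rewrite mulr_ge0 ?exprn_ge0 ?divr_ge0// ltW.
by apply/fine_ge0/nneseries_ge0 => m _ _; rewrite lee_fin (chain_term_ge0 T hrho).
Qed.

Let bound_sum w : exists E : R, forall n, \sum_(i < n) bound i w <= E.
Proof.
have [q qE fq] := path_majorant w; exists (1 + (2^-1)^-1 + q) => n.
rewrite big_split/= lerD ?b_sum// -lee_fin -qE -sumEFin.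
rewrite -(big_mkord xpredT (fun i => (b i * (wgt i / b i) ^+ k *
  fine (chain_bound T rho k (fun t => path i t w)))%:E)).
have c0 j : 0 <= b j * (wgt j / b j) ^+ k.
  by rewrite mulr_ge0 ?exprn_ge0 ?divr_ge0// ltW.
have -> : (\sum_(0 <= i < n) (b i * (wgt i / b i) ^+ k *
  fine (chain_bound T rho k (fun t => path i t w)))%:E =
  \sum_(0 <= i < n) ((b i * (wgt i / b i) ^+ k)%:E * chain_bound T rho k (fun t => path i t w)))%E.
  by apply: eq_bigr => i _; rewrite EFinM fineK.
apply: nneseries_lim_ge => j _ _; rewrite mule_ge0 ?lee_fin//.
by apply: nneseries_ge0 => m _ _; rewrite lee_fin (chain_term_ge0 T hrho).
Qed.

Let coef j t w : R := if 0 <= t <= T then dyadic_lim T (fun s => path j s w) t else 0.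

Let coef_le j t w : `|coef j t w| <= bound j w.
Proof.
rewrite /coef; case: ifPn => [/andP[t0 tT]|_]; last by rewrite normr0 bound_ge0.
have h := @dyadic_lim_pow_le R T rho k hT hrho isT _ (path0 j w) (path_fin j w) t t0 tT.
set y := dyadic_lim _ _ _ in h *; set q := fine _ in h; rewrite /bound -/q.
have b0 := b_gt0 j.
have yk : `|y| ^+ k.*2 <= q by rewrite -normrX ger0_norm// exprn_even_ge0.
have q0 : 0 <= q by apply: le_trans yk; rewrite exprn_ge0.
have [yb|yb] := leP `|y| (b j).
  apply: (le_trans yb); rewrite lerDl mulr_ge0// mulr_ge0 ?(ltW b0)//.
  by rewrite exprn_ge0// divr_ge0// ltW.
have r1 : 1 <= `|y| / b j by rewrite ler_pdivlMr// mul1r ltW.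
have : `|y| / b j <= (`|y| / b j) ^+ k.*2 by rewrite ler_eXnr.
rewrite ler_pdivrMr// => h2; apply: (le_trans h2).
have -> : (`|y| / b j) ^+ k.*2 * b j = b j * (wgt j / b j) ^+ k * `|y| ^+ k.*2.
  rewrite /wgt -expr2 -exprM exprMn mul2n; ring.
apply: (@le_trans _ _ (b j * (wgt j / b j) ^+ k * q)).
  by rewrite ler_wpM2l// mulr_ge0 ?exprn_ge0 ?divr_ge0// ltW.
by rewrite lerDr ltW.
Qed.

Let field (t x : R) (w : Omega) : R := limn (series (fun j => eigfun j x * coef j t w)).

Let measurable_coef j t : measurable_fun setT (coef j t).
Proof.
have [tT|tT] := boolP (0 <= t <= T); last first.
  have -> : coef j t = cst 0 by apply/funext => w; rewrite /coef (negPf tT).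
  exact: measurable_cst.
have -> : coef j t = (fun w => dyadic_lim T (fun s => path j s w) t).
  by apply/funext => w; rewrite /coef tT.
apply: (@measurable_realfun.measurable_fun_cvg _ _ _ _ (fun n w => path j (dyadic_floor T n t) w)) => // w _.
have /andP[t0 t1] := tT.
exact: (dyadic_lim_cvg hT hrho (k := k) isT (path0 j w) (path_fin j w)).
Qed.

Let field_cvg t x w : \sum_(i < n) eigfun i x * coef i t w @[n --> \oo] --> field t x w.
Proof.
have [E hE] := bound_sum w.
have ce j : `|eigfun j x * coef j t w| <= bound j w.
  by rewrite normrM (le_trans _ (coef_le j t w))// ler_piMl// eigfun_le1.
have := cvg_majorant_series (fun j => bound_ge0 j w) hE ce.
rewrite /field (_ : series _ = (fun n => \sum_(i < n) eigfun i x * coef i t w))//.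
by apply/funext => n; rewrite /series/= big_mkord.
Qed.

Let measurable_field_field : measurable_field T field.
Proof.
move=> t _.
have mD : measurable ([set: Omega] `*` (dom : set (measurableTypeR R))).
  by apply: measurableX => //; exact: measurable_dom.
apply: (@measurable_realfun.measurable_fun_cvg _ _ _ _
  (fun n (u : Omega * measurableTypeR R) => \sum_(i < n) eigfun i u.2 * coef i t u.1)).
  move=> n; apply: measurable_funTS; apply: measurable_sum => i; apply: measurable_funM.
    apply: (@measurableT_comp _ _ _ _ _ _ (eigfun i)); last exact: measurable_snd.
    exact: measurable_eigfun.
  by apply: (@measurableT_comp _ _ _ _ _ _ (coef i t)) => //; exact: measurable_fst.
by move=> u _; exact: field_cvg.
Qed.

Let measurable_field_path t w : measurable_fun dom (fun x => field t x w).
Proof.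
apply: (@measurable_realfun.measurable_fun_cvg _ (measurableTypeR R) _ _
  (fun n x => \sum_(i < n) eigfun i x * coef i t w)).
  move=> n; apply: measurable_funTS; apply: measurable_sum => i; apply: measurable_funM.
    exact: measurable_eigfun.
  exact: measurable_cst.
by move=> x _; exact: field_cvg.
Qed.

Let ae_good : {ae P, forall w, good w}.
Proof.
have [H1a H1b] := andP hH1; have [H2a H2b] := andP hH2.
have thH : th <= H1 by rewrite /th; lra.
have [K [K0 hK]] := mode_chain_moment hT hW th0 thH thk.
have wa j : wgt j * mode_weight H1 H2 th j <= b j.
  rewrite /wgt ler_pdivrMl// -expr2 -powR_mulrn ?powR_ge0// -powRrM /mode_weight.
  rewrite ler_powR//; first by rewrite lerDr.
  by rewrite /th; lra.
have fin : (\int[P]_w norm_majorant b wgt k raw w < +oo)%E.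
  apply: (le_lt_trans (@integral_norm_majorant _ _ _ P b wgt (mode_weight H1 H2 th) _ k raw
    b_gt0 b_sum wgt_ge0 (fun j => powR_ge0 _ _) wa raw_ge0 measurable_raw K K0 hK)).
  exact: ltry.
have mN := @measurable_norm_majorant _ Omega R b wgt k raw b_gt0 wgt_ge0 raw_ge0 measurable_raw.
have iN : P.-integrable setT (norm_majorant b wgt k raw).
  apply/integrableP; split => //; under eq_integral do rewrite gee0_abs ?norm_majorant_ge0//.
  exact: fin.
have := integrable_ae measurableT iN; apply: filterS => w /(_ I) h.
rewrite /good /= -ge0_fin_numE//; exact: norm_majorant_ge0.
Qed.

Let ae_unique_limit (X : nat -> Omega -> R) (Y Z : Omega -> R) :
  (forall n, measurable_fun setT (X n)) -> measurable_fun setT Z ->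
  {ae P, forall w, X n w @[n --> \oo] --> Y w} ->
  (\int[P]_w ((X n w - Z w) ^+ 2)%:E)%E @[n --> \oo] --> 0%E ->
  {ae P, forall w, Y w = Z w}.
Proof.
move=> mX mZ XY XZ; have [phi [phik cphi]] := ae_cvg_subseq mX mZ XZ.
apply: filterS2 XY cphi => w c1 c2.
have c3 : X (phi n) w @[n --> \oo] --> Y w.
  move=> A /c1[N _ hN]; exists N => // n /= Nn.
  by apply: hN => /=; exact: leq_trans Nn (phik n).
by rewrite -(cvg_lim (@Rhausdorff R) c3) -(cvg_lim (@Rhausdorff R) c2).
Qed.

Let ae_coef j t : 0 <= t <= T -> {ae P, forall w, coef j t w = W j t w}.
Proof.
move=> tT; have /andP[t0 t1] := tT.
have [_ M2 _ _] := hW.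
have [H1a H1b] := andP hH1.
have [C [C0 hC]] := M2 1%N th isT ltac:(apply/andP; split; rewrite /th; lra).
apply: (@ae_unique_limit (fun n => W j (dyadic_floor T n t))) => //.
- apply: filterS ae_good => w gw; rewrite /coef tT.
  have := @dyadic_lim_cvg _ T rho k hT hrho isT _ (path0 j w) (path_fin j w) t t0 t1.
  suff -> : (fun n => W j (dyadic_floor T n t) w) = (fun n => path j (dyadic_floor T n t) w) by [].
  by apply/funext => n; exact: (congr1 (@^~ (dyadic_floor T n t)) (esym (path_good j gw))).
- set a := mode_weight H1 H2 th j.
  have bnd n : (\int[P]_w ((W j (dyadic_floor T n t) w - W j t w) ^+ 2)%:E <=
      (C * (a * T `^ (2 * th)) * (ratio th ^+ 4) ^+ n)%:E)%E.
    have /andP[f1 f2] := @dyadic_floorP _ T hT n t t0.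
    have p0 : 0 <= C * (a * T `^ (2 * th)) * (ratio th ^+ 4) ^+ n.
      apply: mulr_ge0; last by rewrite !exprn_ge0// powR_ge0.
      by apply: mulr_ge0; [exact: ltW|rewrite mulr_ge0// powR_ge0].
    move: f1; rewrite le_eqVlt => /orP[/eqP ->|f1].
      under eq_integral do rewrite subrr expr0n/=.
      by rewrite integral0 lee_fin.
    have := hC j _ t (dyadic_floor_ge0 hT n t) f1 t1.
    under eq_integral do rewrite /= -sqrrN opprB.
    move=> /le_trans; apply; rewrite lee_fin expr1 -!mulrA ler_wpM2l ?(ltW C0)//.
    rewrite /a /mode_weight ler_wpM2l ?powR_ge0// -(mesh_powR th hT).
    by rewrite ge0_ler_powR ?nnegrE ?mulr_ge0 ?(ltW th0)//; lra.
  apply: cvge0P => [n|e e0].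
    by apply: integral_ge0 => w _; rewrite lee_fin sqr_ge0.
  have c : C * (a * T `^ (2 * th)) * (ratio th ^+ 4) ^+ n @[n --> \oo] --> 0.
    rewrite -(mulr0 (C * (a * T `^ (2 * th)))); apply: cvgMr; apply: cvg_expr.
    have /andP[r0 r1] := ratio_lt1 th0.
    by rewrite ger0_norm ?exprn_ge0 ?(ltW r0)// exprn_ilt1// ltW.
  have /cvgrPdist_le/(_ e e0)[N _ hN] := c.
  exists N => n Nn; apply: (le_trans (bnd n)); rewrite lee_fin.
  by have := hN n Nn; rewrite /= sub0r normrN; apply: le_trans; exact: ler_norm.
Qed.

(** Almost surely the modes have limits along dyadic times that are continuous in
    t and have summable suprema, so that the spectral series converges uniformly.
    At each point it equals o almost surely, both being limits of the same partial
    sums. *)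
Theorem continuous_version_exists : exists o', continuous_version P T o o'.
Proof.
exists field; split => //.
- move=> t x tT x0; have [_ _ _ [C [C0 hC]]] := hW.
  apply: (@ae_unique_limit (fun n w => \sum_(i < n) eigfun i x * W i t w)).
  + move=> n; apply: measurable_sum => i; apply: measurable_funM => //; exact: measurable_cst.
  + exact: (measurable_field_section mo).
  + apply: filterS (ae_foralln (fun j => ae_coef j tT)) => w cw.
    suff -> : (fun n => \sum_(i < n) eigfun i x * W i t w) =
      (fun n => \sum_(i < n) eigfun i x * coef i t w) by exact: field_cvg.
    by apply/funext => n; apply: eq_bigr => i _; rewrite cw.
  + apply: cvge0P => [n|e e0].
      by apply: integral_ge0 => w _; rewrite lee_fin sqr_ge0.
    have /cvgrPdist_le/(_ e e0)[N _ hN] := @step_cvg0 R C.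
    exists N.+1 => -[//|n] Nn; under eq_integral do rewrite -sqrrN opprB.
    apply: (le_trans (hC t x n.+1 tT x0 isT)); rewrite lee_fin.
    by have := hN n Nn; rewrite /= sub0r normrN; apply: le_trans; exact: ler_norm.
- move=> w t tT; have /andP[t0 t1] := tT; have [E hE] := bound_sum w.
  have b0 := fun j => bound_ge0 j w.
  split.
    have [] := @square_integrable_bounded R (fun x => field t x w) E => //.
    by move=> x _; apply: (majorant_series_le b0 hE) => j; exact: coef_le.
  have mod_ (r : R) : 0 < r -> exists dl : R, 0 < dl /\ forall s, 0 <= s <= T -> `|s - t| < dl ->
      forall x, `|field s x w - field t x w| <= r.
    move=> r0; apply: (majorant_series_modulus b0 hE (A := [set s | 0 <= s <= T])) => //=.
    move=> j q q0.
    have [dl [dl0 h]] := @dyadic_lim_continuous _ T rho k hT hrho isT _ (path0 j w) (path_fin j w) t q t0 t1 q0.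
    exists dl; split => // s sT st; rewrite /coef sT tT; have /andP[s0 s1] := sT.
    exact: h.
  have near_ (r : R) : 0 < r -> \forall s \near within `[0, T] (nbhs t),
      (l2sqnorm (fun x => (field s x w - field t x w)%R) <= (r ^+ 2 * pi)%:E)%E.
    move=> r0; have [dl [dl0 h]] := mod_ r r0.
    apply/nbhs_ballP; exists dl => //= s st sT.
    have {}sT : 0 <= s <= T by move: sT; rewrite /= in_itv.
    have {}st : `|s - t| < dl by rewrite distrC.
    apply: (proj2 (@square_integrable_bounded R (fun x => field s x w - field t x w) r _ _)).
      exact: (measurable_funB (measurable_field_path s w) (measurable_field_path t w)).
    by move=> x _; exact: h.
  have pos s : (0 <= l2sqnorm (fun x => (field s x w - field t x w)%R))%E.
    by apply: integral_ge0 => x _; rewrite lee_fin sqr_ge0.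
  apply/fine_cvgP; split.
    apply: filterS (near_ 1 ltr01) => s h.
    by rewrite ge0_fin_numE// (le_lt_trans h)// ltry.
  apply/cvgrPdist_le => e e0.
  have p0 := @pi_gt0 R.
  have q0 : 0 < e / pi by rewrite divr_gt0.
  have r0 : 0 < Num.sqrt (e / pi) by rewrite sqrtr_gt0.
  apply: filterS (near_ _ r0) => s /=; rewrite sqr_sqrtr ?(ltW q0)// divfK ?gt_eqF// => h.
  rewrite sub0r normrN ger0_norm ?fine_ge0// -lee_fin fineK//.
  by rewrite ge0_fin_numE// (le_lt_trans h)// ltry.
Qed.

End existence.

Theorem lemma3p2 (R : realType) (d : measure_display)
    (Omega : measurableType d) (P : probability Omega R)
    (T H1 H2 sigma : R) (B : R -> R -> {RV P >-> R})
    (o : R -> R -> Omega -> R)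
    (hT : 0 < T) (hH1 : 2^-1 <= H1 < 1) (hH2 : 2^-1 <= H2 < 1)
    (hB : fractional_brownian_sheet T H1 H2 B)
    (ho : stochastic_convolution P T sigma (fun t x w => B t x w) o) :
  (exists o' : R -> R -> Omega -> R, continuous_version P T o o') /\
  (forall p beta : R, 1 <= p -> 0 <= beta < 4 * H1 + H2 - 1 ->
    (forall o' : R -> R -> Omega -> R, continuous_version P T o o' ->
      (\int[P]_w ereal_sup
         [set poweR (hnorm beta (fun x => o' t x w)) p | t in `[0%R, T]]
       < +oo)%E) /\
    (forall eps : R, 0 < eps ->
      exists C : R, 0 < C /\
        (forall s t : R, 0 <= s -> s < t -> t <= T ->
          (\int[P]_w poweR (hnorm beta (fun x => (o t x w - o s x w)%R)) p
           <= (C * (t - s) `^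
                 (((4 * H1 + H2 - 1 - beta) / 4 - eps / 2) * p))%:E)%E) /\
        (forall x z : R, 0 < x < pi -> 0 < z < pi ->
          (ereal_sup
             [set 'E_P[fun w => (`|o t x w - o t z w| `^ p)%R] | t in `[0%R, T]]
           <= (C * `|x - z| `^ p)%:E)%E))).
Proof.
have [W hW] := modes_exist hT hH1 hH2 hB ho; have [mo _] := ho.
split; first exact: (continuous_version_exists hT hH1 hH2 mo hW).
move=> p beta p1 hbeta; split.
  by move=> o' ho'; exact: (sup_moment_finite hT hH1 hH2 mo hW p1 hbeta ho').
move=> eps e0.
have [C1 [C10 h1]] := increment_moment hT hH1 hH2 mo hW p1 hbeta e0.
have [C2 [C20 h2]] := spatial_lipschitz hT hH1 hH2 hB ho p1.
exists (C1 + C2); split; first by rewrite addr_gt0.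
split.
- move=> s t s0 st tT; apply: (le_trans (h1 s t s0 st tT)).
  by rewrite lee_fin ler_wpM2r ?powR_ge0// lerDl ltW.
- move=> x z x0 z0; apply: (le_trans (h2 x z x0 z0)).
  by rewrite lee_fin ler_wpM2r ?powR_ge0// lerDr ltW.
Qed.
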